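(* Let $k$ be a field of characteristic zero, let $\lambda\in k^{\times}$, and let $A$ be a commutative unital $k$-algebra. The following ring schemes (functors in $A$ with values in commutative unital rings) are all isomorphic: $$(\mathbb{W}(A),+_{\mathbb W},\cdot_{\mathbb W}),\quad (\operatorname{Nr}(A),+,\cdot_{\operatorname{Nr}}),\quad (\Lambda(A),+_\Lambda,\cdot_\Lambda),\quad (A^{\mathbb N},+,\cdot_\lambda),\quad (A^{\mathbb N^*},+,\cdot\ \text{point-wise}),$$ $$(\mathfrak G_+(A),\boxtimes,\circledast),\quad (A^{\mathbb N^*},\boxplus,\boxdot),\quad (\mathfrak G_+(A),\boxtimes_{\rm NS},\circledast_{\rm NS}).$$ More precisely, the following maps are isomorphisms of rings, natural in $A$, onto $(A^{\mathbb N^*},+,\cdot\ \text{point-wise})$: the ghost map $w$ from $\mathbb W(A)$; the map $\operatorname{MR}$ from $\operatorname{Nr}(A)$; the map $z\frac{d}{dz}\ln$ from $\Lambda(A)$; the map $\operatorname{GS}$ from $(A^{\mathbb N},+,\cdot_\lambda)$; the map $(z\frac{d}{dz}\ln)\circ S$ from $(\mathfrak G_+(A),\boxtimes,\circledast)$; the map $R$ from $(A^{\mathbb N^*},\boxplus,\boxdot)$; and the map $(z\frac{d}{dz}\ln)\circ F$ from $(\mathfrak G_+(A),\boxtimes_{\rm NS},\circledast_{\rm NS})$. In addition $S:(\mathfrak G_+(A),\boxtimes,\circledast)\to\Lambda(A)$, $F:(\mathfrak G_+(A),\boxtimes_{\rm NS},\circledast_{\rm NS})\to\Lambda(A)$ and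 $\operatorname{AH}:\Lambda(A)\to\mathbb W(A)$ are natural isomorphisms of rings.
   Context: $\mathbb N=\{0,1,2,\dots\}$, $\mathbb N^*=\{1,2,\dots\}$. A sequence $(c_n)_{n\ge1}$ is identified with the power series $\sum_{n\ge1}c_nz^n$. $\operatorname{NC}(n)$ is the set of non-crossing partitions of $\{1,\dots,n\}$ and $K(\pi)$ is the Kreweras complement of $\pi\in\operatorname{NC}(n)$. Witt ring: $\mathbb W(A)=A^{\mathbb N^*}$ as a set, with the functorial ring structure (given by universal integer polynomials) determined by requiring that the ghost map $w=(w_n)_{n\ge1}$, $w_n(x)=\sum_{d\mid n}d\,x_d^{n/d}$, be a natural ring homomorphism to $A^{\mathbb N^*}$ with point-wise operations. Necklace algebra of Metropolis and Rota: $\operatorname{Nr}(A)=A^{\mathbb N^*}$ with component-wise addition and $(a\cdot_{\operatorname{Nr}}b)_n=\sum_{\operatorname{lcm}(i,j)=n}\gcd(i,j)\,a_ib_j$; $\operatorname{MR}(a)_n=\sum_{d\mid n}d\,a_d$. $\Lambda(A)=1+zA[[z]]$; $+_\Lambda$ is the multiplication of power series; $\cdot_\Lambda$ is the multiplication determined functorially by $(1-az)^{-1}\cdot_\Lambda(1-bz)^{-1}=(1-abz)^{-1}$ extended bi-additively through formal factorisations $\prod_i(1-x_iz)^{-1}$. The map $z\frac{d}{dz}\ln$ sends $f$ to $zf'(z)/f(z)\in zA[[z]]\cong A^{\mathbb N^*}$. $\operatorname{AH}$ is the inverse of the Artin–Hasse exponential $E_A:\mathbb W(A)\to\Lambda(A)$,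 $(x_n)\mapsto\prod_{n\ge1}(1-x_nz^n)^{-1}$. $\lambda$-weighted Hurwitz product on $A^{\mathbb N}$: for $a=(a_n)_{n\ge 0}$, $b=(b_n)_{n\ge 0}$, $(a\cdot_\lambda b)_n=\sum_{i=0}^n\sum_{j=0}^{n-i}\binom ni\binom{n-i}{j}\lambda^i a_{n-j}b_{i+j}$, with unit $(1,0,0,\dots)$; $\operatorname{GS}(a)_n=\sum_{j=0}^n\binom nj\lambda^ja_j$, $n\in\mathbb N$, where the resulting sequence indexed by $\mathbb N$ is reindexed by $\mathbb N^*$. $R=R_A:A^{\mathbb N^*}\to A^{\mathbb N^*}$ is Voiculescu's $R$-transform, sending a moment sequence $(m_n)$ to its free cumulant sequence $(\kappa_n)$, determined by $m_n=\sum_{\pi\in\operatorname{NC}(n)}\prod_{V\in\pi}\kappa_{|V|}$. The additive free convolution $\boxplus$ (given by the universal polynomials for moments of sums of free random variables) satisfies $R(a\boxplus b)=R(a)+R(b)$, and $a\boxdot b:=R^{-1}(R(a)\cdot R(b))$ with point-wise multiplication on the right. $\mathfrak G_+(A)=\{(1,a_2,a_3,\dots)\mid a_i\in A\}$, identified with power series $f(z)=z+a_2z^2+\cdots$, and $f^{-1}$ is the compositional inverse. $S(f)=\frac{1+z}{z}f^{-1}(z)$ and $F(f)=\frac1zf^{-1}(z)$, both in $\Lambda(A)$. The multiplicative free convolution $\boxtimes$ (given by the universal polynomials for moments of products of free random variables) satisfies $S(f\boxtimes g)=S(f)S(g)$. The boxed convolution is $(f\boxtimes_{\rm NS}g)_n=\sum_{\pi\in\operatorname{NC}(n)}\prod_{V\in\pi}a_{|V|}\prod_{W\in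 K(\pi)}b_{|W|}$ for $f=(a_n)$, $g=(b_n)$, and satisfies $F(f\boxtimes_{\rm NS}g)=F(f)F(g)$. The second operations are $f\circledast g:=S^{-1}(S(f)\cdot_\Lambda S(g))$ and $f\circledast_{\rm NS}g:=F^{-1}(F(f)\cdot_\Lambda F(g))$. *)

(* Defs.v *)
From HB Require Import structures.
From mathcomp Require Import all_boot all_order all_algebra.
From Stdlib Require Import ClassicalEpsilon.

Set Implicit Arguments.
Unset Strict Implicit.
Unset Printing Implicit Defensive.

Import GRing.Theory.
Local Open Scope ring_scope.

(* Commutative rings are [comPzRingType]s, so that the zero ring is allowed
   (MathComp's [comAlgType k] would exclude it). *)

(* The element satisfying P, used where exactly one exists; [t0] is a dummy. *)
Definition the (T : Type) (t0 : T) (P : T -> Prop) : T :=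
  epsilon (inhabits t0) P.

Definition inv_map (T U : Type) (t0 : T) (f : T -> U) (u : U) : T :=
  the t0 (fun t => f t = u).

(* A^{N^*}: the entry a_n (n >= 1) of a sequence is stored at index n - 1.
   All formulas below go through [ent] and [mkseqP], which use the
   mathematical indices n >= 1. *)
Definition seqP (A : Type) : Type := nat -> A.
Definition ent (A : Type) (a : seqP A) (n : nat) : A := a n.-1.
Definition mkseqP (A : Type) (E : nat -> A) : seqP A := fun i => E i.+1.

(* Power series: [f n] is the coefficient of z^n. *)
Section PowerSeries.
Variable A : comPzRingType.
Implicit Types f g : nat -> A.

Definition ps_one : nat -> A := fun n => (n == 0%N)%:R.
Definition ps_monom (a : A) (m : nat) : nat -> A := fun n => a *+ (n == m).
Definition ps_add f g : nat -> A := fun n => f n + g n.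
Definition ps_sub f g : nat -> A := fun n => f n - g n.
Definition ps_mul f g : nat -> A := fun n => \sum_(i < n.+1) f i * g (n - i)%N.
Definition ps_exp f (m : nat) : nat -> A := iter m (ps_mul f) ps_one.

(* 1/f = sum_k (1 - f)^k, for f with constant term 1 *)
Definition ps_inv f : nat -> A :=
  fun n => \sum_(i < n.+1) ps_exp (ps_sub ps_one f) i n.

(* f(g(z)), for g without constant term *)
Definition ps_comp f g : nat -> A :=
  fun n => \sum_(i < n.+1) f i * ps_exp g i n.

(* c_1 z + c_2 z^2 + ... *)
Definition ps_of_seqP (c : seqP A) : nat -> A :=
  fun n => if n is m.+1 then ent c m.+1 else 0.

End PowerSeries.
Arguments ps_one {A}.

Record Lambda (A : comPzRingType) : Type := MkLambda {
  lam_coef :> nat -> A;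
  lam_coef0 : lam_coef 0 == 1
}.
HB.instance Definition _ A := [isSub of Lambda A for @lam_coef A].

Record Gplus (A : comPzRingType) : Type := MkGplus {
  gp_seq :> seqP A;
  gp_seq1 : ent gp_seq 1 == 1
}.
HB.instance Definition _ A := [isSub of Gplus A for @gp_seq A].

Record functor : Type := Functor {
  obj :> comPzRingType -> Type;
  fmap : forall A B : comPzRingType, {rmorphism A -> B} -> obj A -> obj B;
  fmap_id : forall (A : comPzRingType) (x : obj A),
    fmap (idfun : {rmorphism A -> A}) x = x;
  fmap_comp : forall (A B C : comPzRingType)
      (phi : {rmorphism A -> B}) (psi : {rmorphism B -> C}) (x : obj A),
    fmap (psi \o phi : {rmorphism A -> C}) x = fmap psi (fmap phi x)
}.

(* both A^{N^*} and A^N *)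
Definition seq_functor : functor.
Proof.
refine (@Functor (fun A => nat -> A)
  (fun A B (phi : {rmorphism A -> B}) a n => phi (a n)) _ _).
- by [].
- by [].
Defined.

Definition Lambda_map (A B : comPzRingType) (phi : {rmorphism A -> B})
  (f : Lambda A) : Lambda B.
Proof.
refine (@MkLambda B (fun n => phi (f n)) _).
by rewrite (eqP (lam_coef0 f)) rmorph1.
Defined.

Definition Gplus_map (A B : comPzRingType) (phi : {rmorphism A -> B})
  (f : Gplus A) : Gplus B.
Proof.
refine (@MkGplus B (fun n => phi (gp_seq f n)) _).
by have /eqP := gp_seq1 f; rewrite /ent /= => ->; rewrite rmorph1.
Defined.

Definition Lambda_functor : functor.
Proof.
by refine (@Functor Lambda Lambda_map _ _) => *; apply: val_inj.
Defined.

Definition Gplus_functor : functor.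
Proof.
by refine (@Functor Gplus Gplus_map _ _) => *; apply: val_inj.
Defined.

Definition natural_op (F : functor)
    (op : forall A : comPzRingType, F A -> F A -> F A) : Prop :=
  forall (A B : comPzRingType) (phi : {rmorphism A -> B}) (x y : F A),
    fmap phi (op A x y) = op B (fmap phi x) (fmap phi y).

Definition ptw_add (A : comPzRingType) (a b : nat -> A) : nat -> A :=
  fun n => a n + b n.
Definition ptw_mul (A : comPzRingType) (a b : nat -> A) : nat -> A :=
  fun n => a n * b n.

Definition ghost (A : comPzRingType) (x : seqP A) : seqP A :=
  mkseqP (fun n => \sum_(d <- divisors n) (ent x d ^+ (n %/ d)) *+ d).

(* The operations of the Witt ring: the functorial operations on all
   commutative rings (equivalently, by Yoneda, the operations given by
   universal integer polynomials) which the ghost map turns into the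
   point-wise ones. *)
Definition witt_add : forall A : comPzRingType, seqP A -> seqP A -> seqP A :=
  the (fun A x _ => x) (fun op =>
    @natural_op seq_functor op /\
    forall A x y, ghost (op A x y) = ptw_add (ghost x) (ghost y)).
Definition witt_mul : forall A : comPzRingType, seqP A -> seqP A -> seqP A :=
  the (fun A x _ => x) (fun op =>
    @natural_op seq_functor op /\
    forall A x y, ghost (op A x y) = ptw_mul (ghost x) (ghost y)).

Definition necklace_mul (A : comPzRingType) (a b : seqP A) : seqP A :=
  mkseqP (fun n =>
    \sum_(i <- divisors n) \sum_(j <- divisors n | lcmn i j == n)
      (ent a i * ent b j) *+ gcdn i j).
Definition MR (A : comPzRingType) (a : seqP A) : seqP A :=
  mkseqP (fun n => \sum_(d <- divisors n) ent a d *+ d).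

Lemma ps_mul_coef0 (A : comPzRingType) (f g : nat -> A) :
  f 0 == 1 -> g 0 == 1 -> ps_mul f g 0 == 1.
Proof. by move=> /eqP f0 /eqP g0; rewrite /ps_mul big_ord1 f0 g0 mulr1. Qed.

Lemma ps_inv_coef0 (A : comPzRingType) (f : nat -> A) : ps_inv f 0 == 1.
Proof. by rewrite /ps_inv big_ord1. Qed.

Definition lam_add (A : comPzRingType) (f g : Lambda A) : Lambda A :=
  MkLambda (ps_mul_coef0 (lam_coef0 f) (lam_coef0 g)).

(* (1 - a z)^{-1} *)
Definition lam_geom (A : comPzRingType) (a : A) : Lambda A :=
  MkLambda (ps_inv_coef0 (ps_sub ps_one (ps_monom a 1))).

(* The functorial bi-additive operation on Lambda with
   (1 - a z)^{-1} . (1 - b z)^{-1} = (1 - a b z)^{-1}. *)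
Definition lam_mul : forall A : comPzRingType, Lambda A -> Lambda A -> Lambda A :=
  the (fun A f _ => f) (fun op =>
    [/\ @natural_op Lambda_functor op,
        forall A, left_distributive (op A) (@lam_add A),
        forall A, right_distributive (op A) (@lam_add A)
      & forall A a b, op A (lam_geom a) (lam_geom b) = lam_geom (a * b)]).

(* z f'(z) / f(z) *)
Definition zdlog (A : comPzRingType) (f : Lambda A) : seqP A :=
  mkseqP (ps_mul (fun n => f n *+ n) (ps_inv f)).

(* The coefficient of z^m in prod_{n >= 1} (1 - x_n z^n)^{-1} only depends on
   the factors with n <= m. *)
Definition artin_hasse_coef (A : comPzRingType) (x : seqP A) : nat -> A :=
  fun m => (\big[@ps_mul A/ps_one]_(1 <= n < m.+1)
              ps_inv (ps_sub ps_one (ps_monom (ent x n) n))) m.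
Lemma artin_hasse_coef0 (A : comPzRingType) (x : seqP A) :
  artin_hasse_coef x 0 == 1.
Proof. by rewrite /artin_hasse_coef big_geq. Qed.
Definition artin_hasse (A : comPzRingType) (x : seqP A) : Lambda A :=
  MkLambda (artin_hasse_coef0 x).
Definition AH (A : comPzRingType) : Lambda A -> seqP A :=
  inv_map (fun=> 0) (@artin_hasse A).

(* [l] is the image of the weight in A. *)
Definition hurwitz_mul (A : comPzRingType) (l : A) (a b : nat -> A) : nat -> A :=
  fun n => \sum_(i < n.+1) \sum_(j < (n - i).+1)
    (l ^+ i * a (n - j)%N * b (i + j)%N) *+ ('C(n, i) * 'C(n - i, j)).
(* The result is indexed by N; read as a [seqP] it is reindexed by N^* through
   n |-> n + 1. *)
Definition GS (A : comPzRingType) (l : A) (a : nat -> A) : seqP A :=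
  fun n => \sum_(j < n.+1) (l ^+ j * a j) *+ 'C(n, j).

(* Non-crossing partitions of 'I_n, whose elements 0, ..., n-1 stand for
   1, ..., n. *)
Definition noncrossing n (P : {set {set 'I_n}}) : bool :=
  [forall V in P, forall W in P,
    [exists a in V, exists b in W, exists c in V, exists d in W,
      [&& a < b, b < c & c < d]%N] ==> (V == W)].
Definition NC n : {set {set {set 'I_n}}} :=
  [set P | partition P [set: 'I_n] && noncrossing P].

Definition refines n (P Q : {set {set 'I_n}}) : bool :=
  [forall B in P, exists C in Q, B \subset C].

Lemma even_subproof n (i : 'I_n) : (i.*2 < n.*2)%N.
Proof. by rewrite ltn_double. Qed.
Lemma odd_subproof n (i : 'I_n) : (i.*2.+1 < n.*2)%N.
Proof. by rewrite ltn_Sdouble. Qed.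
Definition even_ord n (i : 'I_n) : 'I_(n.*2) := Ordinal (even_subproof i).
Definition odd_ord n (i : 'I_n) : 'I_(n.*2) := Ordinal (odd_subproof i).

(* P u Q as a partition of {1, 1', 2, 2', ..., n, n'}, with P living on
   1, ..., n and Q on 1', ..., n' *)
Definition interleave n (P Q : {set {set 'I_n}}) : {set {set 'I_(n.*2)}} :=
  [set (@even_ord n) @: V | V : {set 'I_n} in P] :|:
  [set (@odd_ord n) @: W | W : {set 'I_n} in Q].

(* K(P) is the largest Q in NC(n) for which P u Q is non-crossing. *)
Definition is_kreweras n (P Q : {set {set 'I_n}}) : bool :=
  [&& Q \in NC n, noncrossing (interleave P Q)
    & [forall Q' in NC n, noncrossing (interleave P Q') ==> refines Q' Q]].
Definition kreweras n (P : {set {set 'I_n}}) : {set {set 'I_n}} :=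
  odflt set0 [pick Q | is_kreweras P Q].

Definition moments_of_cumulants (A : comPzRingType) (c : seqP A) : seqP A :=
  mkseqP (fun n => \sum_(P in NC n) \prod_(V in P) ent c #|V|).
Definition Rtrans (A : comPzRingType) : seqP A -> seqP A :=
  inv_map (fun=> 0) (@moments_of_cumulants A).

(* Non-commutative probability spaces over a commutative ring A: unital
   associative A-algebras with a unital A-linear functional. *)
Record ncps (A : comPzRingType) : Type := NCPS {
  nc_alg :> pzRingType;
  nc_scal : {rmorphism A -> nc_alg};
  nc_scal_central : forall a x, nc_scal a * x = x * nc_scal a;
  nc_state : nc_alg -> A;
  nc_stateD : forall x y, nc_state (x + y) = nc_state x + nc_state y;
  nc_stateZ : forall a x, nc_state (nc_scal a * x) = a * nc_state x;
  nc_state1 : nc_state 1 = 1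
}.

Section Freeness.
Variables (A : comPzRingType) (M : ncps A).

Definition moments (x : M) : seqP A := mkseqP (fun n => nc_state (x ^+ n)).

(* u lies in the unital subalgebra A[x] *)
Definition in_subalg (x u : M) : Prop :=
  exists (N : nat) (c : nat -> A), u = \sum_(i < N) nc_scal M (c i) * x ^+ i.

(* Products of centred elements taken alternately from A[x] and A[y] are
   centred; [s j] tells from which of the two the j-th factor is taken. *)
Definition free (x y : M) : Prop :=
  forall (n : nat) (s : nat -> bool) (u : nat -> M),
    (0 < n)%N ->
    (forall j, (j.+1 < n)%N -> s j != s j.+1) ->
    (forall j, (j < n)%N ->
       in_subalg (if s j then x else y) (u j) /\ nc_state (u j) = 0) ->
    nc_state (\prod_(j < n) u j) = 0.

End Freeness.

(* Additive and multiplicative free convolution: the functorial operations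
   (equivalently, the operations given by universal polynomials) computing the
   moments of x + y, resp. x y, for free x and y. *)
Definition boxplus : forall A : comPzRingType, seqP A -> seqP A -> seqP A :=
  the (fun A a _ => a) (fun op =>
    @natural_op seq_functor op /\
    forall (A : comPzRingType) (M : ncps A) (x y : M), free x y ->
      moments (x + y) = op A (moments x) (moments y)).

Definition boxdot (A : comPzRingType) (a b : seqP A) : seqP A :=
  inv_map (fun=> 0) (@Rtrans A) (ptw_mul (Rtrans a) (Rtrans b)).

Definition boxtimes : forall A : comPzRingType, Gplus A -> Gplus A -> Gplus A :=
  the (fun A f _ => f) (fun op =>
    @natural_op Gplus_functor op /\
    forall (A : comPzRingType) (M : ncps A) (x y : M) (f g : Gplus A),
      free x y -> moments x = f -> moments y = g ->
      moments (x * y) = op A f g).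

Lemma gp_id_subproof (A : comPzRingType) :
  ent (mkseqP (fun n => (n == 1%N)%:R : A)) 1 == 1.
Proof. by []. Qed.
(* the series z *)
Definition gp_id (A : comPzRingType) : Gplus A := MkGplus (gp_id_subproof A).

Definition gp_compinv (A : comPzRingType) (f : Gplus A) : Gplus A :=
  the (gp_id A) (fun g =>
    ps_comp (ps_of_seqP f) (ps_of_seqP g) = ps_monom 1 1 /\
    ps_comp (ps_of_seqP g) (ps_of_seqP f) = ps_monom 1 1).

(* f^{-1}(z) / z *)
Definition Ftrans (A : comPzRingType) (f : Gplus A) : Lambda A :=
  @MkLambda A (fun n => ent (gp_compinv f) n.+1) (gp_seq1 (gp_compinv f)).

Lemma onez_coef0 (A : comPzRingType) :
  ps_add ps_one (ps_monom 1 1) 0 == 1 :> A.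
Proof. by rewrite /ps_add /ps_one /ps_monom /= mulr0n addr0. Qed.
(* (1 + z) f^{-1}(z) / z *)
Definition Strans (A : comPzRingType) (f : Gplus A) : Lambda A :=
  MkLambda (ps_mul_coef0 (onez_coef0 A) (lam_coef0 (Ftrans f))).

Definition circledast (A : comPzRingType) (f g : Gplus A) : Gplus A :=
  inv_map (gp_id A) (@Strans A) (lam_mul (Strans f) (Strans g)).

Definition boxtimesNS_seq (A : comPzRingType) (a b : seqP A) : seqP A :=
  mkseqP (fun n => \sum_(P in NC n)
    (\prod_(V in P) ent a #|V|) * (\prod_(W in kreweras P) ent b #|W|)).

Lemma partition_ord1 (P : {set {set 'I_1}}) :
  partition P [set: 'I_1] = (P == [set [set: 'I_1]]).
Proof.
have sub1 (B : {set 'I_1}) : B != set0 -> B = setT.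
  case/set0Pn=> x xB; apply/setP=> y; rewrite inE.
  by rewrite (ord1 y) -(ord1 x).
apply/idP/eqP=> [|->].
- case/and3P=> /eqP covP _ n0P; apply/setP=> B; rewrite inE.
  have sP C : C \in P -> C = setT.
    by move=> CP; apply: sub1; apply: contraNneq n0P => <-.
  apply/idP/eqP=> [/sP //|->].
  have : ord0 \in cover P by rewrite covP inE.
  by case/bigcupP=> C CP _; rewrite -(sP C CP).
- apply/and3P; split.
  + by rewrite /cover big_set1.
  + by apply/trivIsetP=> C D /set1P-> /set1P->; rewrite eqxx.
  + by rewrite inE eq_sym; apply/set0Pn; exists ord0; rewrite inE.
Qed.

Lemma NC1 : NC 1 = [set [set [set: 'I_1]]].
Proof.
apply/setP=> P; rewrite !inE partition_ord1.
case: eqP => //= ->; apply/forall_inP=> V /set1P->.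
by apply/forall_inP=> W /set1P->; rewrite eqxx implybT.
Qed.

Lemma kreweras1 : kreweras [set [set: 'I_1]] = [set [set: 'I_1]].
Proof.
rewrite /kreweras; case: pickP => [Q /and3P[]|].
  by rewrite NC1 => /set1P.
move/(_ [set setT]); rewrite /is_kreweras NC1 set11 /=.
suff -> : noncrossing (interleave [set [set: 'I_1]] [set [set: 'I_1]]).
  move/negP; case; apply/forall_inP=> Q' /set1P->.
  apply/implyP=> _; apply/forall_inP=> B BP.
  by apply/exists_inP; exists B.
apply/forall_inP=> V _; apply/forall_inP=> W _; apply/implyP.
case/exists_inP=> a _ /exists_inP[b _ /exists_inP[c _ /exists_inP[d _]]].
case/and3P=> ab bc cd; have := ltn_ord c.
by rewrite ltnNge (leq_trans _ bc) // ltnS (leq_trans _ ab).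
Qed.

Lemma boxtimesNS_subproof (A : comPzRingType) (f g : Gplus A) :
  ent (boxtimesNS_seq f g) 1 == 1.
Proof.
rewrite /boxtimesNS_seq /ent /mkseqP /= NC1 big_set1 kreweras1 !big_set1.
rewrite cardsT card_ord; have /eqP := gp_seq1 f; have /eqP := gp_seq1 g.
by rewrite /ent /= => -> ->; rewrite mulr1.
Qed.
Definition boxtimesNS (A : comPzRingType) (f g : Gplus A) : Gplus A :=
  MkGplus (boxtimesNS_subproof f g).

Definition circledastNS (A : comPzRingType) (f g : Gplus A) : Gplus A :=
  inv_map (gp_id A) (@Ftrans A) (lam_mul (Ftrans f) (Ftrans g)).

Definition is_unity (T : Type) (mul : T -> T -> T) (e : T) : Prop :=
  left_id e mul /\ right_id e mul.

Definition is_comring (T : Type) (add mul : T -> T -> T) : Prop :=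
  exists (zero one : T) (opp : T -> T),
    [/\ associative add, commutative add, left_id zero add
      & left_inverse zero opp add] /\
    [/\ associative mul, commutative mul, is_unity mul one
      & left_distributive mul add].

Definition is_ringhom (T U : Type) (addT mulT : T -> T -> T)
    (addU mulU : U -> U -> U) (f : T -> U) : Prop :=
  [/\ forall x y, f (addT x y) = addU (f x) (f y),
      forall x y, f (mulT x y) = mulU (f x) (f y)
    & forall e, is_unity mulT e -> is_unity mulU (f e)].

Section RingSchemes.
Variable k : fieldType.

Record kalg : Type := KAlg {
  kalg_ring :> comPzRingType;
  kalg_scal : {rmorphism k -> kalg_ring}
}.

Definition is_kalg_hom (A B : kalg) (phi : {rmorphism A -> B}) : Prop :=
  forall c : k, phi (kalg_scal A c) = kalg_scal B c.

(* A functor from k-algebras to sets with two binary operations, not assumed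
   to satisfy anything; see [is_ring_scheme]. *)
Record scheme2 : Type := Scheme2 {
  carrier :> functor;
  sadd : forall A : kalg, carrier A -> carrier A -> carrier A;
  smul : forall A : kalg, carrier A -> carrier A -> carrier A
}.

Definition is_ring_scheme (X : scheme2) : Prop :=
  (forall A : kalg, is_comring (@sadd X A) (@smul X A)) /\
  (forall (A B : kalg) (phi : {rmorphism A -> B}), is_kalg_hom phi ->
     is_ringhom (@sadd X A) (@smul X A) (@sadd X B) (@smul X B)
       (@fmap X A B phi)).

Definition natural_ring_iso (X Y : scheme2)
    (h : forall A : kalg, X A -> Y A) : Prop :=
  (forall A : kalg, bijective (h A) /\
     is_ringhom (@sadd X A) (@smul X A) (@sadd Y A) (@smul Y A) (h A)) /\
  (forall (A B : kalg) (phi : {rmorphism A -> B}), is_kalg_hom phi ->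
     forall x : X A, h B (fmap phi x) = fmap phi (h A x)).

Definition isomorphic_schemes (X Y : scheme2) : Prop :=
  exists h : (forall A : kalg, X A -> Y A), @natural_ring_iso X Y h.

Definition witt_scheme : scheme2 :=
  @Scheme2 seq_functor (fun A => @witt_add A) (fun A => @witt_mul A).
Definition necklace_scheme : scheme2 :=
  @Scheme2 seq_functor (fun A => @ptw_add A) (fun A => @necklace_mul A).
Definition Lambda_scheme : scheme2 :=
  @Scheme2 Lambda_functor (fun A => @lam_add A) (fun A => @lam_mul A).
Definition hurwitz_scheme (lam : k) : scheme2 :=
  @Scheme2 seq_functor (fun A => @ptw_add A)
    (fun A => @hurwitz_mul A (kalg_scal A lam)).
Definition pointwise_scheme : scheme2 :=
  @Scheme2 seq_functor (fun A => @ptw_add A) (fun A => @ptw_mul A).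
Definition boxtimes_scheme : scheme2 :=
  @Scheme2 Gplus_functor (fun A => @boxtimes A) (fun A => @circledast A).
Definition boxplus_scheme : scheme2 :=
  @Scheme2 seq_functor (fun A => @boxplus A) (fun A => @boxdot A).
Definition boxtimesNS_scheme : scheme2 :=
  @Scheme2 Gplus_functor (fun A => @boxtimesNS A) (fun A => @circledastNS A).

Definition all_schemes (lam : k) : seq scheme2 :=
  [:: witt_scheme; necklace_scheme; Lambda_scheme; hurwitz_scheme lam;
      pointwise_scheme; boxtimes_scheme; boxplus_scheme; boxtimesNS_scheme].

End RingSchemes.

(* Main.v *)
Require Import Defs.
From HB Require Import structures.
From mathcomp Require Import all_boot all_order all_algebra.
From mathcomp Require Import boolp zify ring.
From mathcomp Require finmap.
From mathcomp.multinomials Require monalg.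
From Stdlib Require Import ClassicalEpsilon.
From Stdlib Require List.

(** The ring [A^{N^*}] with point-wise operations is the hub.  Each of the other
seven schemes is carried to it by a natural bijection compatible with both
operations; the ring axioms, the identities and the isomorphisms between any
two schemes are then transported along these bijections ([bij_comring],
[natural_ring_iso_scheme], [natural_ring_iso_span]).

Bijectivity is nearly always triangularity: the [n]-th output is an invertible
multiple of the [n]-th entry plus a function of the earlier entries
([triangular_bij]).  This settles the ghost map, [MR], [GS] and [z d/dz ln] over
algebras containing the rationals, and the Artin-Hasse exponential over every
ring.  Since [z d/dz ln] of the Artin-Hasse exponential is the ghost map, the
Witt ring is a disguise of [Lambda].

The operations characterised by functoriality have to be shown to exist over
all rings and to be determined over the algebras at hand.  For the product of
[Lambda], existence is given by the explicit formula
  [prod (1 - x_i z^i)^-1 . prod (1 - y_j z^j)^-1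
     = prod_{i,j} (1 - x_i^{l/i} y_j^{l/j} z^l)^{-g}], [l = lcm(i,j)], [g = gcd(i,j)],
whose logarithmic derivative is the point-wise product over any ring.
Distributivity follows where [z d/dz ln] is injective, that is over torsion-free
rings, and descends to all rings because each one is a quotient of a polynomial
ring over the integers ([torsion_free_cover]).  Uniqueness ([zdlogM]): read
through [z d/dz ln], a solution is a natural bi-additive operation on sequences.
Applied to the sequence [a_i t^i] over [A[t]] it yields a polynomial in [t] whose
coefficients see the entries [a_i] one at a time, so it is determined by its
values on geometric sequences, where it is prescribed.

For the free convolutions, the moments of sums and products of free variables
depend only on the individual moments ([free_moments_add], [free_moments_mul]),
so it suffices to compute them in one model.  In the model, creation operators
and annihilation operators on the full Fock space, the generating series of the
vacuum expectations satisfies a one-line functional equation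
([moment_series_functional]), from which the moment series of [x], [y], [x + y]
and [x y] are read off: the cumulant series add up, the S-transforms multiply.
The model also realises any two prescribed moment sequences, which gives
uniqueness of the convolutions.

The sums over non-crossing partitions are governed by one recursion: split off
the part between the first point and the next point of its block.  This encodes
the pairs (partition, Kreweras complement) as binary trees, and yields series
[p], [q] with [h = f o p = g o q] and [p q = z h] when [h] is the boxed convolution of
[f] and [g] ([ncsum_system]).  Composing with the inverse of [h] gives
[F(h) = F(f) F(g)]; the case where [g] has all coefficients [1] gives the
moment-cumulant equation [M(z) = C(z M(z))]. *)

Set Implicit Arguments.
Unset Strict Implicit.
Unset Printing Implicit Defensive.

Import GRing.Theory.
Local Open Scope ring_scope.

(** * Torsion-free covers *)

(** Univariate and multivariate polynomials require a non-trivial coefficient ring;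
    the trivial ring is always treated separately. *)
Lemma comNz_of_nonzero (A : comPzRingType) :
  (1 : A) != 0 -> exists R : comNzRingType, A = (R : comPzRingType).
Proof.
move=> h; pose m := GRing.PzSemiRing_isNonZero.Build A h.
pose R : comNzRingType := HB.pack (A : Type) m A.
by exists R; subst R; case: A h m => S [].
Qed.

Section Cover.
Import finmap.
Import monalg.
Variable A : comNzRingType.

(** The evaluation at the elements of [A] of a monomial in variables indexed by
    the elements of [A] themselves. *)
Definition monom_eval (m : cmonom A) : A := \prod_(a <- finsupp m) a ^+ m a.

Lemma monom_evalEw (m : cmonom A) (d : {fset A}) :
  (finsupp m `<=` d)%fset -> monom_eval m = \prod_(a <- d) a ^+ m a.
Proof.
move=> le; rewrite /monom_eval (big_fset_incl _ le) // => a _ am.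
by move: (cmE_eq0 m a); rewrite am => /eqP ->.
Qed.

Fact monom_eval_morph : mmorphism monom_eval.
Proof.
split=> [m1 m2|]; last by rewrite /monom_eval mdom1 big_seq_fset0.
rewrite (@monom_evalEw m1 (finsupp m1 `|` finsupp m2)%fset) ?fsubsetUl //.
rewrite (@monom_evalEw m2 (finsupp m1 `|` finsupp m2)%fset) ?fsubsetUr //.
rewrite /monom_eval mdomD -big_split /=.
by apply: eq_bigr => a _; rewrite cmM exprD.
Qed.

HB.instance Definition _ := isMultiplicative.Build (cmonom A) A monom_eval
  monom_eval_morph.

Lemma torsion_free_cover_nz :
  exists (B : comPzRingType) (pi : {rmorphism B -> (A : comPzRingType)}),
    (forall a, exists b, pi b = a) /\
    (forall n (b : B), b *+ n.+1 = 0 -> b = 0).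
Proof.
exists {malg int[cmonom A]}.
exists (mmap (intr : int -> A) monom_eval : {rmorphism {malg int[cmonom A]} -> A}).
split=> [a|n b bn].
  exists (mkmalgU (ucm a) 1); rewrite /= mmapU mul1r /monom_eval.
  by rewrite mdomU big_seq_fset1 cmUU expr1.
apply/malgP=> m; have /eqP := congr1 (mcoeff m) bn.
by rewrite mcoeffMn mcoeff0 Num.Theory.mulrn_eq0 /= => /eqP.
Qed.

End Cover.

(** The cover is the polynomial ring over the integers with one variable per element
    of [A]. Identities that only need torsion-freeness are proved there and pushed
    forward. *)
Lemma torsion_free_cover (A : comPzRingType) : (1 : A) != 0 ->
  exists (B : comPzRingType) (pi : {rmorphism B -> A}),
    (forall a, exists b, pi b = a) /\
    (forall n (b : B), b *+ n.+1 = 0 -> b = 0).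
Proof. by case/comNz_of_nonzero=> R ->; apply: torsion_free_cover_nz. Qed.

(** * The ring of formal power series *)

(** A fresh name for sequences, so that they carry the convolution product
    rather than a point-wise structure. *)
Definition ps (A : comPzRingType) : Type := nat -> A.

Section PsRing.
Variable A : comPzRingType.
Implicit Types f g h : ps A.

Definition ps_zero : ps A := fun=> 0.
Definition ps_opp f : ps A := fun n => - f n.

HB.instance Definition _ := gen_eqMixin (ps A).
HB.instance Definition _ := gen_choiceMixin (ps A).

Lemma ps_addA : associative (@ps_add A : ps A -> ps A -> ps A).
Proof. by move=> f g h; apply/funext=> n; rewrite /ps_add addrA. Qed.
Lemma ps_addC : commutative (@ps_add A : ps A -> ps A -> ps A).
Proof. by move=> f g; apply/funext=> n; rewrite /ps_add addrC. Qed.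
Lemma ps_add0 : left_id ps_zero (@ps_add A : ps A -> ps A -> ps A).
Proof. by move=> f; apply/funext=> n; rewrite /ps_add add0r. Qed.
Lemma ps_addN : left_inverse ps_zero ps_opp (@ps_add A : ps A -> ps A -> ps A).
Proof. by move=> f; apply/funext=> n; rewrite /ps_add addNr. Qed.

HB.instance Definition _ := GRing.isZmodule.Build (ps A)
  ps_addA ps_addC ps_add0 ps_addN.

Lemma ps_mulC : commutative (@ps_mul A : ps A -> ps A -> ps A).
Proof.
move=> f g; apply/funext=> n; rewrite /ps_mul (reindex_inj rev_ord_inj) /=.
apply: eq_bigr => i _; rewrite mulrC; congr (g _ * f _) => /=; have := ltn_ord i; lia.
Qed.

Lemma ps_mulA : associative (@ps_mul A : ps A -> ps A -> ps A).
Proof.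
move=> f g h; apply/funext=> n; rewrite /ps_mul.
pose c j k := f j * (g (n - j - k)%N * h k).
transitivity (\sum_(j < n.+1) \sum_(k < n.+1 | (k <= n - j)%N) c j k).
  apply: eq_bigr => j _.
  rewrite big_distrr /= (reindex_inj rev_ord_inj) /=.
  rewrite (big_ord_narrow_leq (leq_subr j n)) /=.
  apply: eq_bigr => k _; rewrite /c /=; congr (_ * (g _ * h _)); have := ltn_ord k;
    have := ltn_ord j; lia.
rewrite (exchange_big_dep predT) //= (reindex_inj rev_ord_inj) /=.
apply: eq_bigr => k _.
transitivity (\sum_(j < n.+1 | (j <= k)%N) c j (n - k)%N).
  by apply: eq_bigl => j; have := ltn_ord k; have := ltn_ord j; lia.
have kn : (k <= n)%N by have := ltn_ord k.
rewrite (big_ord_narrow_leq kn) /= big_distrl /=.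
apply: eq_bigr => j _; rewrite /c /= mulrA; congr (_ * g _ * h _); have := ltn_ord k;
  have := ltn_ord j; lia.
Qed.

Lemma ps_mul1 : left_id (ps_one : ps A) (@ps_mul A : ps A -> ps A -> ps A).
Proof.
move=> f; apply/funext=> n; rewrite /ps_mul big_ord_recl /= mul1r subn0.
by rewrite big1 ?addr0 // => i _; rewrite mul0r.
Qed.

Lemma ps_mulDl : left_distributive (@ps_mul A : ps A -> ps A -> ps A) (@ps_add A).
Proof.
move=> f g h; apply/funext=> n; rewrite /ps_mul /ps_add -big_split /=.
by apply: eq_bigr => i _; rewrite mulrDl.
Qed.

HB.instance Definition _ := GRing.Zmodule_isComPzRing.Build (ps A)
  ps_mulA ps_mulC ps_mul1 ps_mulDl.

Lemma psD f g n : (f + g) n = f n + g n. Proof. by []. Qed.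
Lemma psN f n : (- f) n = - f n. Proof. by []. Qed.
Lemma psB f g n : (f - g) n = f n - g n. Proof. by []. Qed.
Lemma ps1 n : (1 : ps A) n = (n == 0%N)%:R. Proof. by []. Qed.
Lemma psM f g n : (f * g) n = \sum_(i < n.+1) f i * g (n - i)%N.
Proof. by []. Qed.
Lemma ps_sum (I : Type) (r : seq I) (P : pred I) (F : I -> ps A) n :
  (\sum_(i <- r | P i) F i) n = \sum_(i <- r | P i) F i n.
Proof. by elim/big_rec2: _ => // i x y _ <-. Qed.

Lemma ps_expE f m : ps_exp f m = f ^+ m.
Proof. by elim: m => [//|m IH]; rewrite exprS -IH. Qed.

Definition psC (c : A) : ps A := ps_monom c 0.
Definition psX : ps A := ps_monom 1 1.
Definition ps_tl f : ps A := fun n => f n.+1.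

Lemma psCM c f n : (psC c * f) n = c * f n.
Proof.
rewrite psM big_ord_recl /psC /ps_monom subn0 /=.
by rewrite big1 ?addr0 // => i _; rewrite mul0r.
Qed.

Lemma psXM f n : (psX * f) n = if n is m.+1 then f m else 0.
Proof.
case: n => [|n]; first by rewrite psM big_ord1 /psX /ps_monom mul0r.
rewrite psM !big_ord_recl /psX /ps_monom /= mul0r add0r mul1r subSS subn0.
by rewrite big1 ?addr0 // => i _; rewrite mul0r.
Qed.

Lemma psM0 f g : (f * g) 0%N = f 0%N * g 0%N.
Proof. by rewrite psM big_ord1. Qed.

Lemma psCE c n : psC c n = c *+ (n == 0%N). Proof. by []. Qed.
Lemma psC1 : psC 1 = 1. Proof. by []. Qed.
Lemma psC0 : psC 0 = 0.
Proof. by apply/funext=> n; rewrite psCE mul0rn. Qed.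

Lemma ps_headE f : f = psC (f 0%N) + psX * ps_tl f.
Proof.
apply/funext=> -[|n]; rewrite psD psXM psCE ?addr0 //= add0r //.
Qed.

Lemma psX_inj f g : psX * f = psX * g -> f = g.
Proof. by move=> e; apply/funext=> n; have := congr1 (@^~ n.+1) e; rewrite /= !psXM. Qed.

(** Iterating [D x = g * D (t x)] makes [D x] divisible by every power of [z].
    This replaces all arguments of convergence and all comparisons of infinite
    expansions below. *)
Lemma contraction_zero (T : Type) (g : ps A) (t : T -> T) (D : T -> ps A) :
  g 0%N = 0 -> (forall x, D x = g * D (t x)) -> forall x, D x = 0.
Proof.
move=> g0 eD x; apply/funext=> n; elim/ltn_ind: n x => n IH x.
rewrite eD psM big_ord_recl g0 mul0r add0r big1 // => i _.
by rewrite IH ?mulr0 //= /bump /=; have := ltn_ord i; lia.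
Qed.

Lemma ps_exp_low g m n : g 0%N = 0 -> (n < m)%N -> (g ^+ m) n = 0.
Proof.
move=> g0; elim: m n => // m IH n nm.
rewrite exprS psM big_ord_recl g0 mul0r add0r big1 // => i _.
by rewrite IH ?mulr0 //= /bump /=; have := ltn_ord i; lia.
Qed.

(** Retyping of the composition and of the inverse, so that they take values in
    the ring [ps A]. *)
Definition psComp f g : ps A := ps_comp f g.
Definition psV f : ps A := ps_inv f.

Lemma ps_compE N f g n : g 0%N = 0 -> (n <= N)%N ->
  psComp f g n = \sum_(i < N.+1) f i * (g ^+ i) n.
Proof.
move=> g0 nN; rewrite /psComp /ps_comp (big_ord_widen N.+1 (fun i => f i * ps_exp g i n)) //.
rewrite big_mkcond /=; apply: eq_bigr => i _; rewrite ps_expE.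
by case: ltnP => // ni; rewrite ps_exp_low ?mulr0.
Qed.

(** The Horner form of a composition; with [contraction_zero] it gives every
    identity on compositions by comparing the two sides for [f] and for its tail. *)
Lemma ps_comp_head f g : g 0%N = 0 ->
  psComp f g = psC (f 0%N) + g * (psComp (ps_tl f) g).
Proof.
move=> g0; apply/funext=> n; rewrite psD (ps_compE (N := n.+1)) // big_ord_recl.
rewrite expr0 psCE ps1 mulr_natr; congr (_ + _).
transitivity (\sum_(i < n.+1) \sum_(m < n.+1) f i.+1 * (g m * (g ^+ i) (n - m)%N)).
  by apply: eq_bigr => i _; rewrite /= /bump /= exprS psM big_distrr.
rewrite exchange_big psM /=; apply: eq_bigr => m _.
rewrite (ps_compE (N := n)) ?leq_subr // big_distrr /=.
by apply: eq_bigr => i _; rewrite /ps_tl; ring.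
Qed.

Lemma ps_comp0 f g : psComp f g 0%N = f 0%N.
Proof. by rewrite /psComp /ps_comp big_ord1 mulr1. Qed.

Lemma ps_compDl f h g : psComp (f + h) g = (psComp f g) + psComp h g.
Proof.
apply/funext=> n; rewrite psD /psComp /ps_comp -big_split; apply: eq_bigr => i _.
by rewrite psD mulrDl.
Qed.

Lemma ps_compZl c f g : psComp (psC c * f) g = psC c * (psComp f g).
Proof.
apply/funext=> n; rewrite psCM /psComp /ps_comp big_distrr; apply: eq_bigr => i _.
by rewrite /= psCM mulrA.
Qed.

Lemma ps_tlXM f : ps_tl (psX * f) = f.
Proof. by apply/funext=> n; rewrite /ps_tl psXM. Qed.

Lemma ps_compX f g : g 0%N = 0 -> psComp (psX * f) g = g * (psComp f g).
Proof.
by move=> g0; rewrite ps_comp_head // psXM psC0 add0r ps_tlXM.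
Qed.

Lemma ps_compM f h g : g 0%N = 0 ->
  psComp (f * h) g = (psComp f g) * (psComp h g).
Proof.
move=> g0; apply/eqP; rewrite -subr_eq0; apply/eqP.
apply: (contraction_zero (t := ps_tl)
  (D := fun f => (psComp (f * h) g) - (psComp f g) * psComp h g) g0).
move=> {}f; rewrite {1}(ps_headE f) mulrDl ps_compDl ps_compZl -mulrA ps_compX //.
by rewrite (ps_comp_head f g0); ring.
Qed.

Lemma ps_compC c g : psComp (psC c) g = psC c.
Proof.
apply/funext=> n; rewrite /psComp /ps_comp big_ord_recl big1 ?addr0.
  by rewrite psCE mulr1n /= psCE -mulr_natr.
by move=> i _; rewrite psCE mul0r.
Qed.

Lemma ps_comp1 g : psComp (1 : ps A) g = (1 : ps A).
Proof. exact: ps_compC. Qed.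

Lemma ps_compXg g : g 0%N = 0 -> psComp psX g = g.
Proof. by move=> g0; rewrite -[psX]mulr1 ps_compX // ps_comp1 mulr1. Qed.

Lemma ps_compN f g : psComp (- f) g = - (psComp f g).
Proof.
apply/funext=> n; rewrite psN /psComp /ps_comp -sumrN; apply: eq_bigr => i _.
by rewrite psN mulNr.
Qed.

Lemma ps_compB f h g : psComp (f - h) g = (psComp f g) - psComp h g.
Proof. by rewrite ps_compDl ps_compN. Qed.

Lemma ps_compA f g h : g 0%N = 0 -> h 0%N = 0 ->
  psComp (psComp f g) h = psComp f (psComp g h).
Proof.
move=> g0 h0; have gh0 : psComp g h 0%N = 0 by rewrite ps_comp0.
apply/eqP; rewrite -subr_eq0; apply/eqP.
apply: (contraction_zero (t := ps_tl)
  (D := fun f => (psComp (psComp f g) h) - psComp f (psComp g h)) gh0).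
move=> {}f; rewrite {1}(ps_comp_head f g0) ps_compDl ps_compM // ps_compC.
by rewrite (ps_comp_head f gh0); ring.
Qed.

Lemma ps_comp_gX f : psComp f psX = f.
Proof.
have X0 : psX 0%N = 0 by [].
apply/eqP; rewrite -subr_eq0; apply/eqP.
apply: (contraction_zero (t := ps_tl) (D := fun f => (psComp f psX) - f) X0).
by move=> {}f; rewrite ps_comp_head // [X in _ - X = _](ps_headE f); ring.
Qed.

Definition ps_geom : ps A := fun=> 1.

Lemma ps_geomK : ps_geom * (1 - psX) = 1.
Proof.
rewrite mulrBr mulr1 [_ * psX]mulrC; apply/funext=> -[|n].
  by rewrite psB psXM subr0.
by rewrite psB psXM subrr.
Qed.

(** The inverse is the geometric series composed with [1 - f]. *)
Lemma ps_mulV f : f 0%N = 1 -> f * psV f = 1.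
Proof.
move=> f0; have u0 : (1 - f) 0%N = 0 by rewrite psB f0 subrr.
have -> : psV f = psComp ps_geom (1 - f).
  apply/funext=> n; rewrite /psV /ps_inv /psComp /ps_comp; apply: eq_bigr => i _.
  by rewrite mul1r.
have := congr1 (fun h : ps A => psComp h (1 - f) : ps A) ps_geomK.
rewrite ps_compM // ps_compB !ps_comp1 ps_compXg // => e.
by rewrite -[RHS]e; ring.
Qed.

Lemma ps_inv_uniq f g : f * g = 1 -> f 0%N = 1 -> psV f = g.
Proof.
move=> fg f0; rewrite -[LHS](mul1r (_ : ps A)) -fg mulrAC ps_mulV //.
by rewrite mul1r.
Qed.

Lemma ps_inv0 f : psV f 0%N = 1.
Proof. by rewrite /psV /ps_inv big_ord1. Qed.

End PsRing.

(** * Triangular maps and logarithmic derivatives *)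

Lemma the_spec (T : Type) (t0 : T) (P : T -> Prop) : (exists t, P t) -> P (the t0 P).
Proof. by move=> h; rewrite /the; apply: epsilon_spec. Qed.

Lemma inj_surj_bij (T U : Type) (f : T -> U) :
  injective f -> (forall u, exists t, f t = u) -> bijective f.
Proof.
move=> fi fs; have g u : {t | f t = u} by apply: cid; apply: fs.
exists (fun u => sval (g u)) => [t|u]; last exact: (svalP (g u)).
by apply: fi; apply: (svalP (g (f t))).
Qed.

Lemma bij_surj (T U : Type) (f : T -> U) : bijective f -> forall u, exists t, f t = u.
Proof. by case=> g _ gK u; exists (g u). Qed.

Lemma inv_mapK (T U : Type) (t0 : T) (f : T -> U) : bijective f ->
  forall u, f (inv_map t0 f u) = u.
Proof.
by move=> fb u; apply: (@the_spec _ t0 (fun t => f t = u)); apply: bij_surj.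
Qed.

Lemma inv_map_eq (T U : Type) (t0 : T) (f : T -> U) : bijective f ->
  forall t, inv_map t0 f (f t) = t.
Proof. by move=> fb t; apply: (bij_inj fb); rewrite inv_mapK. Qed.

(** The preimage is built one entry at a time: the [n]-th stage corrects the
    [n]-th entry by the remaining error divided by [u n], and later corrections do
    not affect the [n]-th output. *)
Lemma triangular_bij (A : comPzRingType) (u v : nat -> A)
    (T : (nat -> A) -> (nat -> A)) :
  (forall n, u n * v n = 1) ->
  (forall n a b, (forall i, (i < n)%N -> a i = b i) ->
     T a n - T b n = u n * (a n - b n)) ->
  bijective T.
Proof.
move=> uv hT; apply: inj_surj_bij => [a b Tab|c].
  apply/funext; elim/ltn_ind=> n IH; apply/eqP; rewrite -subr_eq0; apply/eqP.
  by rewrite -[LHS]mul1r -(uv n) mulrAC -hT // Tab subrr mul0r.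
(* [s n] has its first [n] entries in place and zeros afterwards. *)
pose step (n : nat) (s : nat -> A) : nat -> A :=
  fun i => if (i == n)%N then v n * (c n - T s n) else s i.
pose s := nat_rect (fun=> nat -> A) (fun=> 0) step.
have sS n : s n.+1 = step n (s n) by [].
have s_ge n i : (n <= i)%N -> s n i = 0.
  elim: n => // n IH ni; rewrite sS /step; case: eqP => [?|_]; first lia.
  by apply: IH; lia.
have s_lt n i : (i < n)%N -> s n i = s i.+1 i.
  elim: n => // n IH ni; rewrite sS {1}/step; case: eqP => [->|?].
    by rewrite sS /step eqxx.
  by apply: IH; lia.
exists (fun i => s i.+1 i); apply/funext=> n; apply/eqP.
rewrite -subr_eq0; apply/eqP.
have := hT n (fun i => s i.+1 i) (s n) (fun i ni => esym (s_lt n i ni)).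
rewrite (s_ge n n) // subr0 sS /step eqxx mulrA uv mul1r => e.
by rewrite -[T _ n](subrK (T (s n) n)) e; ring.
Qed.

Section LambdaBasics.
Variable A : comPzRingType.
Implicit Types f g h d : ps A.

Definition vanish_below m d := forall i, (i < m)%N -> d i = 0.

Lemma vanishM m d h : vanish_below m d -> vanish_below m (d * h).
Proof.
move=> dv i im; rewrite psM big1 // => j _.
by rewrite dv ?mul0r //; have := ltn_ord j; lia.
Qed.

Lemma vanish_lead m d h : vanish_below m d -> (d * h) m = d m * h 0%N.
Proof.
move=> dv; rewrite psM big_ord_recr big1 /= ?add0r ?subnn // => j _.
by rewrite dv ?mul0r.
Qed.

(** The derivation [z d/dz]. *)
Definition euler f : ps A := fun n => f n *+ n.

Lemma eulerM f g : euler (f * g) = euler f * g + f * euler g.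
Proof.
apply/funext=> n; rewrite psD /euler !psM -sumrMnl -big_split /=.
apply: eq_bigr => i _; rewrite mulrnAl mulrnAr -mulrnDr; congr (_ *+ _).
by have := ltn_ord i; lia.
Qed.

Lemma eulerD f g : euler (f + g) = euler f + euler g.
Proof. by apply/funext=> n; rewrite psD /euler psD mulrnDl. Qed.
Lemma euler1 : euler 1 = 0.
Proof. by apply/funext=> -[|n]; rewrite /euler ps1 ?mulr0n // mul0rn. Qed.
Lemma eulerN f : euler (- f) = - euler f.
Proof. by apply/funext=> n; rewrite psN /euler psN mulNrn. Qed.
Lemma euler0 f : euler f 0%N = 0. Proof. by rewrite /euler mulr0n. Qed.

(** [z f'(z) / f(z)], with its zero constant term. *)
Definition dlog f : ps A := euler f * psV f.

Lemma dlog0 f : dlog f 0%N = 0.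
Proof. by rewrite /dlog psM0 euler0 mul0r. Qed.

Lemma psVM f g : f 0%N = 1 -> g 0%N = 1 -> psV (f * g) = psV f * psV g.
Proof.
move=> f0 g0; apply: ps_inv_uniq; last by rewrite psM0 f0 g0 mulr1.
by rewrite mulrACA !ps_mulV ?mulr1.
Qed.

Lemma dlogM f g : f 0%N = 1 -> g 0%N = 1 -> dlog (f * g) = dlog f + dlog g.
Proof.
move=> f0 g0; rewrite /dlog eulerM psVM //.
have -> : (euler f * g + f * euler g) * (psV f * psV g) =
  euler f * psV f * (g * psV g) + euler g * psV g * (f * psV f) by ring.
by rewrite !ps_mulV // !mulr1.
Qed.

Lemma dlog1 : dlog 1 = 0. Proof. by rewrite /dlog euler1 mul0r. Qed.

Lemma dlogV f : f 0%N = 1 -> dlog (psV f) = - dlog f.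
Proof.
move=> f0; have := dlogM f0 (ps_inv0 f); rewrite ps_mulV // dlog1 => /eqP.
by rewrite eq_sym addrC addr_eq0 => /eqP.
Qed.

Lemma dlog_prod (I : Type) (r : seq I) (P : pred I) (F : I -> ps A) :
  (forall i, F i 0%N = 1) ->
  dlog (\prod_(i <- r | P i) F i) = \sum_(i <- r | P i) dlog (F i).
Proof.
move=> F0; suff: (\prod_(i <- r | P i) F i) 0%N = 1 /\
    dlog (\prod_(i <- r | P i) F i) = \sum_(i <- r | P i) dlog (F i) by case.
elim/big_rec2: _ => [|i y x _ [x0 <-]]; first by split=> //; apply: dlog1.
by rewrite psM0 F0 x0 mulr1 dlogM.
Qed.

(** The logarithmic derivative is triangular: from [f g (dlog f - dlog g) =
    g D(f - g) - (f - g) D g], a difference starting in degree [m] is multiplied by [m]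
    in that degree. *)
Lemma dlog_diff m f g : f 0%N = 1 -> g 0%N = 1 -> vanish_below m (f - g) ->
  vanish_below m (dlog f - dlog g) /\ (dlog f - dlog g) m = (f m - g m) *+ m.
Proof.
move=> f0 g0 dv.
have e : dlog f - dlog g = euler (f - g) * psV f - (f - g) * (euler g * psV f * psV g).
  have -> : dlog f - dlog g = euler f * psV f * (g * psV g) - euler g * psV g * (f * psV f).
    by rewrite !ps_mulV // !mulr1.
  have -> : euler (f - g) * psV f = euler (f - g) * psV f * (g * psV g).
    by rewrite ps_mulV // mulr1.
  by rewrite eulerD eulerN; ring.
have ddv : vanish_below m (euler (f - g)).
  by move=> i im; rewrite /euler dv // mul0rn.
rewrite e; split=> [i im|].
  by rewrite psB !(vanishM _ _ im) // subr0.
rewrite psB (vanish_lead _ ddv) (vanish_lead _ dv) !psM0 euler0 !mul0r mulr0 subr0 ps_inv0 mulr1.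
by rewrite /euler psB.
Qed.

Lemma ps_monomM (a : A) n f m :
  ((ps_monom a n : ps A) * f) m = if (n <= m)%N then a * f (m - n)%N else 0.
Proof.
rewrite psM /ps_monom; case: leqP => nm.
  rewrite (bigD1 (Ordinal (nm : (n < m.+1)%N))) //= eqxx mulr1n big1 ?addr0 //.
  by move=> i; rewrite -val_eqE /= => /negPf->; rewrite mul0r.
rewrite big1 // => i _; case: eqP => [e|_]; last by rewrite mul0r.
by have := ltn_ord i; lia.
Qed.

Definition geo (x : A) (n : nat) : ps A := psV (1 - (ps_monom x n : ps A)).

Lemma geo_den0 x n : (0 < n)%N -> (1 - (ps_monom x n : ps A)) 0%N = 1.
Proof. by case: n => // n _; rewrite psB /ps_monom /= mulr0n subr0. Qed.

Lemma geoE x n m : (0 < n)%N -> geo x n m = if (n %| m)%N then x ^+ (m %/ n) else 0.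
Proof.
move=> n0; pose g : ps A := fun m => if (n %| m)%N then x ^+ (m %/ n) else 0.
suff -> : geo x n = g by [].
apply: ps_inv_uniq; last exact: geo_den0.
rewrite mulrBl mul1r; apply/funext=> {}m; rewrite psB ps_monomM ps1 /g.
case: (leqP n m) => nm; last first.
  rewrite subr0; case: m nm => [|m] nm; first by rewrite dvdn0 div0n.
  by case: ifP => // /dvdn_leq; rewrite /=; lia.
have -> : (m == 0)%N = false by lia.
rewrite dvdn_subl //=; case: ifP => // [nm'|_]; last by rewrite mulr0 subrr.
have -> : (m %/ n = ((m - n) %/ n).+1)%N by rewrite divnBr // divnn n0; have := divn_gt0 m n0;
  lia.
by rewrite exprS subrr.
Qed.

Lemma geo0 x n : geo x n 0%N = 1. Proof. exact: ps_inv0. Qed.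

Lemma dlog_geo x n m : (0 < n)%N ->
  dlog (geo x n) m = if [&& 0 < m & n %| m]%N then x ^+ (m %/ n) *+ n else 0.
Proof.
move=> n0; rewrite dlogV ?geo_den0 //.
have -> : dlog (1 - (ps_monom x n : ps A)) = - ((ps_monom (x *+ n) n : ps A) * geo x n).
  rewrite /dlog -/(geo x n) eulerD euler1 eulerN add0r mulNr; congr (- (_ * _)).
  apply/funext=> i; rewrite /euler /ps_monom; case: eqP => [->|]; first by rewrite !mulr1n.
  by rewrite !mulr0n mul0rn.
rewrite opprK ps_monomM; case: (leqP n m) => nm; last first.
  by case: ifP => // /andP[m0 /dvdn_leq]; lia.
have -> : (0 < m)%N by lia.
rewrite geoE // dvdn_subl //=; case: ifP => // [nm'|_]; last by rewrite mulr0.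
have -> : (m %/ n = ((m - n) %/ n).+1)%N by rewrite divnBr // divnn n0; have := divn_gt0 m n0;
  lia.
by rewrite mulrnAl exprS.
Qed.

Definition Eprod N (x : seqP A) : ps A := \prod_(1 <= n < N.+1) geo (ent x n) n.

Lemma Eprod0 N x : Eprod N x 0%N = 1.
Proof.
rewrite /Eprod; elim/big_rec: _ => // i y _ y0.
by rewrite psM0 y0 geo0 mulr1.
Qed.

Lemma EprodS N x : Eprod N.+1 x = Eprod N x * geo (ent x N.+1) N.+1.
Proof. by rewrite /Eprod big_nat_recr. Qed.

Lemma vanish_geo x n : (0 < n)%N -> vanish_below n (geo x n - 1).
Proof.
move=> n0 [|i] im; first by rewrite psB geo0 subrr.
by rewrite psB geoE //; case: ifP => [/dvdn_leq|_]; rewrite ?ps1 /= ?subrr //; lia.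
Qed.

Lemma Eprod_stable N m x : (m <= N)%N -> Eprod N x m = Eprod m x m.
Proof.
elim: N => [|N IH] mN; first by have -> : m = 0%N by lia.
have [->//|mN'] := eqVneq m N.+1.
rewrite EprodS -IH; last by lia.
have := vanishM (Eprod N x) (@vanish_geo (ent x N.+1) N.+1 isT) (_ : m < N.+1)%N.
rewrite mulrBl mul1r mulrC psB => h; apply/eqP; rewrite -subr_eq0 h //; lia.
Qed.

End LambdaBasics.

(** * The Artin-Hasse exponential and the ghost map *)

Section Prelim.
Variable A : comPzRingType.
Implicit Types f g : ps A.

Definition agree n f g := forall i, (i < n)%N -> f i = g i.

Lemma agree_mul n f g f' g' : agree n f f' -> agree n g g' -> agree n (f * g) (f' * g').
Proof.
move=> ef eg i im; rewrite !psM; apply: eq_bigr => j _.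
by rewrite ef ?eg //; have := ltn_ord j; lia.
Qed.

(** Infinite products are handled through congruences modulo powers of [z]: the
    factors beyond the relevant degree are congruent to [1]. *)
Lemma agree_prod (I : eqType) n (r : seq I) (F G : I -> ps A) :
  {in r, forall i, agree n (F i) (G i)} ->
  agree n (\prod_(i <- r) F i) (\prod_(i <- r) G i).
Proof.
move=> h; rewrite big_seq [X in agree _ _ X]big_seq.
by apply: (big_ind2 (agree n)) => [|f f1 g g1|]; [|exact: agree_mul|exact: h].
Qed.

Lemma agree_vanish n f g : agree n f g <-> vanish_below n (f - g).
Proof.
split=> h i im; first by rewrite psB h ?subrr.
by apply/eqP; rewrite -subr_eq0; apply/eqP/h.
Qed.

Lemma agree_exp1 n f k : agree n f 1 -> agree n (f ^+ k) 1.
Proof.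
move=> h; elim: k => // k IH; rewrite exprS -[1]mulr1; exact: agree_mul.
Qed.

Lemma agree_dlog n f g : f 0%N = 1 -> g 0%N = 1 -> agree n f g -> agree n (dlog f) (dlog g).
Proof. by move=> f0 g0 /agree_vanish/(dlog_diff f0 g0)[h _]; apply/agree_vanish. Qed.

Lemma agree_geo1 x n : (0 < n)%N -> agree n (geo x n) 1.
Proof. by move=> n0; apply: (proj2 (agree_vanish _ _ _)); apply: vanish_geo. Qed.

Lemma sum_divisors (R : nmodType) n (F : nat -> R) : (0 < n)%N ->
  \sum_(d <- divisors n) F d = \sum_(1 <= d < n.+1 | (d %| n)%N) F d.
Proof.
move=> n0; rewrite -[RHS]big_filter; apply: perm_big; apply: uniq_perm.
- exact: divisors_uniq.
- by rewrite filter_uniq // iota_uniq.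
move=> d; rewrite -dvdn_divisors // mem_filter mem_index_iota.
by case: (boolP (d %| n)%N) => //= dn; rewrite ltnS (dvdn_leq n0 dn) (dvdn_gt0 n0 dn).
Qed.

End Prelim.

Section LambdaMaps.
Variable A : comPzRingType.
Implicit Types (f g : Lambda A) (x y : seqP A).

Lemma lam0 f : lam_coef f 0 = 1. Proof. exact: (eqP (lam_coef0 f)). Qed.

Lemma lam_eq f g : (forall n, lam_coef f n.+1 = lam_coef g n.+1) -> f = g.
Proof.
by move=> h; apply: val_inj; apply/funext=> -[|n]; rewrite /= ?lam0 ?h.
Qed.

Definition lam_of (a : nat -> A) : Lambda A :=
  @MkLambda A (fun n => if n is m.+1 then a m else 1) (eqxx _).

Lemma lam_ofK f : lam_of (fun n => lam_coef f n.+1) = f.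
Proof. exact: lam_eq. Qed.

Lemma zdlogE f n : zdlog f n = dlog (lam_coef f) n.+1. Proof. by []. Qed.
Lemma lam_addE f g : lam_coef (lam_add f g) = (lam_coef f : ps A) * lam_coef g :> ps A.
Proof. by []. Qed.

Lemma zdlogD f g : zdlog (lam_add f g) = ptw_add (zdlog f) (zdlog g).
Proof. by apply/funext=> n; rewrite /ptw_add !zdlogE lam_addE dlogM ?lam0. Qed.

Lemma artin_hasseE x m : lam_coef (artin_hasse x) m = Eprod m x m.
Proof. by []. Qed.

Lemma artin_hasse_eqb x N : agree N.+1 (lam_coef (artin_hasse x)) (Eprod N x).
Proof. by move=> i iN; rewrite artin_hasseE Eprod_stable. Qed.

Lemma dlog_Eprod N x m : (m <= N)%N ->
  dlog (Eprod N x) m = if m is 0 then 0 else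
    \sum_(d <- divisors m) (ent x d ^+ (m %/ d)) *+ d.
Proof.
case: m => [|m] mN; first by rewrite dlog0.
rewrite dlog_prod => [|i]; last exact: geo0.
rewrite ps_sum sum_divisors // [RHS](big_nat_widen _ _ N.+1) //.
rewrite [RHS]big_mkcond /= [LHS]big_nat [RHS]big_nat.
apply: eq_bigr => d /andP[d0 _]; rewrite dlog_geo //=.
by rewrite ltnS; case: (boolP (d %| m.+1)%N) => //= /dvdn_leq ->.
Qed.

Lemma dlog_artin_hasse x n : dlog (lam_coef (artin_hasse x)) n = dlog (Eprod n x) n.
Proof.
by apply: (@agree_dlog _ n.+1); rewrite ?lam0 ?Eprod0 //; apply: artin_hasse_eqb.
Qed.

Lemma ghostE x n : ghost x n = dlog (Eprod n.+1 x) n.+1.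
Proof. by rewrite dlog_Eprod. Qed.

(** The ghost map is the logarithmic derivative of the Artin-Hasse exponential,
    because [n x^k] is the coefficient of [z^(n k)] in [z d/dz ln (1 - x z^n)^-1]. *)
Lemma zdlog_artin_hasse x : zdlog (artin_hasse x) = ghost x.
Proof. by apply/funext=> n; rewrite zdlogE dlog_artin_hasse ghostE. Qed.

Lemma lam_bij (U : Type) (T : Lambda A -> U) :
  bijective (fun a => T (lam_of a)) -> bijective T.
Proof.
case=> S ST TS; exists (fun u => lam_of (S u)) => [f|u]; last by rewrite TS.
by rewrite -{1}(lam_ofK f) ST lam_ofK.
Qed.

(** The [n]-th factor contributes [x_n] in degree [n] and later factors nothing, so
    the exponential is unitriangular over every ring. *)
Lemma artin_hasse_bij : bijective (@artin_hasse A).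
Proof.
have [S ST TS] : bijective (fun x n => lam_coef (artin_hasse x) n.+1).
  apply: (@triangular_bij _ (fun=> 1) (fun=> 1)) => [n|n x y exy]; first exact: mulr1.
  rewrite !artin_hasseE !EprodS /= mul1r.
  have -> : Eprod n y = Eprod n x.
    apply: eq_big_nat => i /andP[i0 iN]; rewrite /ent exy //; lia.
  rewrite -psB -mulrBr mulrC vanish_lead ?Eprod0 ?mulr1.
    by rewrite psB !geoE // dvdnn divnn /= !expr1.
  move=> i im; have e z := @agree_geo1 A z n.+1 isT i im.
  by rewrite psB !e subrr.
exists (fun f => S (fun n => lam_coef f n.+1)) => [x|f]; first by rewrite ST.
by apply: lam_eq => n; exact: (congr1 (@^~ n) (TS _)).
Qed.

(** The positive integers are invertible; stated by a function since the rings
    at hand carry no inverse operation. *)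
Definition Qring (A : comPzRingType) := exists v : nat -> A, forall n, n.+1%:R * v n = 1.

Lemma zdlog_bij : Qring A -> bijective (@zdlog A).
Proof.
case=> v hv; apply: lam_bij.
apply: (@triangular_bij _ (fun n => n.+1%:R) v) => [//|n a b eab].
rewrite !zdlogE -psB (proj2 (dlog_diff _ _ _)) ?lam0 //= ?mulr_natl //.
by apply: (proj1 (agree_vanish _ _ _)) => -[|i] im //=; apply: eab.
Qed.

Lemma zdlog_inj : (forall n (a : A), a *+ n.+1 = 0 -> a = 0) -> injective (@zdlog A).
Proof.
move=> tf f g e; apply: lam_eq; elim/ltn_ind=> n IH.
apply/eqP; rewrite -subr_eq0; apply/eqP; apply: (tf n).
have fg : vanish_below n.+1 ((lam_coef f : ps A) - (lam_coef g : ps A)).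
  by apply: (proj1 (agree_vanish _ _ _)) => -[|i] im; rewrite ?lam0 // IH.
by rewrite -(proj2 (dlog_diff _ _ fg)) ?lam0 // psB -!zdlogE e subrr.
Qed.

Lemma ghost_bij : Qring A -> bijective (@ghost A).
Proof.
move=> QA; apply: (eq_bij (bij_comp (zdlog_bij QA) artin_hasse_bij)) => x.
exact: zdlog_artin_hasse.
Qed.

End LambdaMaps.

(** * Existence of the product of Lambda and of the Witt operations *)

Section Maps.
Variables (A B : comPzRingType) (phi : {rmorphism A -> B}).
Implicit Types f g : ps A.

Definition pmap f : ps B := fun n => phi (f n).

Lemma pmapM f g : pmap (f * g) = pmap f * pmap g.
Proof.
apply/funext=> n; rewrite /pmap !psM rmorph_sum; apply: eq_bigr => i _.
by rewrite rmorphM.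
Qed.
Lemma pmapD f g : pmap (f + g) = pmap f + pmap g.
Proof. by apply/funext=> n; rewrite /pmap !psD rmorphD. Qed.
Lemma pmapN f : pmap (- f) = - pmap f.
Proof. by apply/funext=> n; rewrite /pmap !psN rmorphN. Qed.
Lemma pmap1 : pmap 1 = 1.
Proof. by apply/funext=> n; rewrite /pmap !ps1 rmorph_nat. Qed.
Lemma pmap_monom a n : pmap (ps_monom a n) = ps_monom (phi a) n.
Proof. by apply/funext=> m; rewrite /pmap /ps_monom rmorphMn. Qed.
Lemma pmapX f n : pmap (f ^+ n) = pmap f ^+ n.
Proof. by elim: n => [|n IH]; rewrite ?pmap1 // !exprS pmapM IH. Qed.
Lemma pmap_prod (I : Type) (r : seq I) (P : pred I) (F : I -> ps A) :
  pmap (\prod_(i <- r | P i) F i) = \prod_(i <- r | P i) pmap (F i).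
Proof. by apply: (big_morph pmap pmapM pmap1). Qed.
Lemma pmapV f : f 0%N = 1 -> pmap (psV f) = psV (pmap f).
Proof.
move=> f0; apply/esym/ps_inv_uniq; first by rewrite -pmapM ps_mulV // pmap1.
by rewrite /pmap f0 rmorph1.
Qed.
Lemma pmap_euler f : pmap (euler f) = euler (pmap f).
Proof. by apply/funext=> n; rewrite /pmap /euler rmorphMn. Qed.
Lemma pmap_dlog f : f 0%N = 1 -> pmap (dlog f) = dlog (pmap f).
Proof. by move=> f0; rewrite /dlog pmapM pmapV // pmap_euler. Qed.
Lemma pmap_geo a n : (0 < n)%N -> pmap (geo a n) = geo (phi a) n.
Proof. by move=> n0; rewrite pmapV ?geo_den0 // pmapD pmapN pmap1 pmap_monom. Qed.
Lemma pmap_comp f g : pmap (psComp f g) = psComp (pmap f) (pmap g).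
Proof.
apply/funext=> n; rewrite /pmap /psComp /ps_comp rmorph_sum; apply: eq_bigr => i _.
by rewrite rmorphM !ps_expE -/(pmap g) -pmapX.
Qed.

Lemma zdlog_nat (f : Lambda A) :
  zdlog (Lambda_map phi f) = (fun n => phi (zdlog f n)).
Proof.
apply/funext=> n; rewrite !zdlogE; have := congr1 (@^~ n.+1) (pmap_dlog (lam0 f)).
by rewrite /pmap.
Qed.

Lemma artin_hasse_nat (x : seqP A) :
  artin_hasse (fun n => phi (x n)) = Lambda_map phi (artin_hasse x).
Proof.
apply: lam_eq => n; rewrite -[RHS]/(phi (lam_coef (artin_hasse x) n.+1)) !artin_hasseE.
have -> : Eprod n.+1 (fun n => phi (x n)) = pmap (Eprod n.+1 x); last by [].
by rewrite pmap_prod; apply: eq_big_nat => i /andP[i0 _]; rewrite pmap_geo.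
Qed.

Lemma AH_nat (f : Lambda A) : AH (Lambda_map phi f) = (fun n => phi (AH f n)).
Proof.
apply: (bij_inj (artin_hasse_bij B)).
by rewrite artin_hasse_nat /AH !inv_mapK //; apply: artin_hasse_bij.
Qed.

Lemma lam_geom_nat a : Lambda_map phi (lam_geom a) = lam_geom (phi a).
Proof.
apply: lam_eq => n; have := congr1 (@^~ n.+1) (pmap_geo a (isT : (0 < 1)%N)).
by rewrite /pmap.
Qed.

Lemma lam_add_nat (f g : Lambda A) :
  Lambda_map phi (lam_add f g) = lam_add (Lambda_map phi f) (Lambda_map phi g).
Proof.
apply: lam_eq => n; have := congr1 (@^~ n.+1) (pmapM (lam_coef f) (lam_coef g)).
by rewrite /pmap.
Qed.

End Maps.

Section LambdaMul.
Variable A : comPzRingType.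
Implicit Types (f g : Lambda A) (x y : seqP A).

Definition lam_prod_factor x y i j : ps A :=
  geo (ent x i ^+ (lcmn i j %/ i) * ent y j ^+ (lcmn i j %/ j)) (lcmn i j) ^+ gcdn i j.
Definition lam_prod_trunc N x y : ps A :=
  \prod_(1 <= i < N.+1) \prod_(1 <= j < N.+1) lam_prod_factor x y i j.

Lemma dlogX (h : ps A) k : h 0%N = 1 -> dlog (h ^+ k) = dlog h *+ k /\ (h ^+ k) 0%N = 1.
Proof.
move=> h0; elim: k => [|k [IH1 IH2]]; first by rewrite dlog1.
by rewrite exprS dlogM // IH1 -mulrS psM0 h0 IH2 mulr1.
Qed.

Lemma lam_prod_factor0 x y i j : lam_prod_factor x y i j 0%N = 1.
Proof. by case: (dlogX (gcdn i j) (geo0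
  (ent x i ^+ (lcmn i j %/ i) * ent y j ^+ (lcmn i j %/ j)) (lcmn i j))). Qed.

Lemma psMn (h : ps A) k n : (h *+ k) n = h n *+ k.
Proof. by elim: k => // k IH; rewrite !mulrS psD IH. Qed.

Lemma ps_prod0 (I : Type) (r : seq I) (F : I -> ps A) :
  (forall i, F i 0%N = 1) -> (\prod_(i <- r) F i) 0%N = 1.
Proof.
move=> F0; elim/big_rec: _ => // i h _ h0; by rewrite psM0 F0 h0 mulr1.
Qed.

(** The point-wise product of the sequences of [(1 - x z^i)^-1] and
    [(1 - y z^j)^-1] is supported on the common multiples of [i] and [j], and
    [lcm(i,j) gcd(i,j) = i j]. *)
Lemma dlog_lam_prod_factor x y i j m : (0 < i)%N -> (0 < j)%N ->
  dlog (lam_prod_factor x y i j) m = dlog (geo (ent x i) i) m * dlog (geo (ent y j) j) m.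
Proof.
move=> i0 j0; have L0 : (0 < lcmn i j)%N by rewrite lcmn_gt0 i0.
rewrite (proj1 (dlogX _ (geo0 _ _))) psMn !dlog_geo // dvdn_lcm.
case: (posnP m) => [->|m0] /=; first by rewrite mul0rn mul0r.
case: (boolP (i %| m)%N) => im /=; last by rewrite mul0rn mul0r.
case: (boolP (j %| m)%N) => jm /=; last by rewrite mul0rn mulr0.
have Lm : (lcmn i j %| m)%N by rewrite dvdn_lcm im.
have e k : (0 < k)%N -> (k %| lcmn i j)%N -> (lcmn i j %/ k * (m %/ lcmn i j) = m %/ k)%N.
  move=> k0 /dvdnP[q eq]; case/dvdnP: Lm => p ->.
  by rewrite mulnK // eq mulnK // [(q * k)%N]mulnC mulnCA mulKn // mulnC.
rewrite exprMn -!exprM !e ?dvdn_lcml ?dvdn_lcmr //.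
by rewrite -mulrnA mulrnAl mulrnAr -mulrnA muln_lcm_gcd mulnC.
Qed.

Lemma dlog_lam_prod_trunc N x y m : dlog (lam_prod_trunc N x y) m = dlog (Eprod N x) m * dlog
  (Eprod N y) m.
Proof.
rewrite dlog_prod => [|i]; last by apply: ps_prod0 => j; apply: lam_prod_factor0.
rewrite !dlog_prod => [|i|i]; try exact: geo0.
rewrite !ps_sum big_distrlr /=; apply: eq_big_nat => i /andP[i0 _].
rewrite dlog_prod => [|j]; last exact: lam_prod_factor0.
rewrite ps_sum; apply: eq_big_nat => j /andP[j0 _].
exact: dlog_lam_prod_factor.
Qed.

Lemma lam_prod_trunc0 N x y : lam_prod_trunc N x y 0%N = 1.
Proof. by apply: ps_prod0 => i; apply: ps_prod0 => j; apply: lam_prod_factor0. Qed.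

Lemma agree_lam_prod_factor x y i j m : (0 < i)%N -> (0 < j)%N -> (m < i)%N || (m < j)%N ->
  agree m.+1 (lam_prod_factor x y i j) 1.
Proof.
move=> i0 j0 mij; apply: agree_exp1.
have L0 : (0 < lcmn i j)%N by rewrite lcmn_gt0 i0.
move=> n nm; apply: (agree_geo1 _ L0).
have := dvdn_leq L0 (dvdn_lcml i j); have := dvdn_leq L0 (dvdn_lcmr i j); lia.
Qed.

Lemma agree_trim N m (F : nat -> ps A) : (m <= N)%N ->
  (forall i, (m < i)%N -> agree m.+1 (F i) 1) ->
  agree m.+1 (\prod_(1 <= i < N.+1) F i) (\prod_(1 <= i < m.+1) F i).
Proof.
move=> mN h; rewrite (big_nat_widen 1 m.+1 N.+1) // [X in agree _ _ X]big_mkcond /=.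
by apply: agree_prod => i _; case: ltnP => // mi; apply: h.
Qed.

Lemma lam_prod_trunc_stable N m x y : (m <= N)%N ->
  agree m.+1 (lam_prod_trunc N x y) (lam_prod_trunc m x y).
Proof.
move=> mN n nm; rewrite /lam_prod_trunc.
rewrite (@agree_trim N m (fun i => \prod_(1 <= j < N.+1) lam_prod_factor x y i j)) //.
  suff h : agree m.+1 (\prod_(1 <= i < m.+1) \prod_(1 <= j < N.+1) lam_prod_factor x y i j)
    (lam_prod_trunc m x y) by exact: h.
  rewrite /lam_prod_trunc; apply: agree_prod => i; rewrite mem_index_iota => /andP[i0 _].
  by apply: agree_trim => // j mj; apply: agree_lam_prod_factor => //; lia.
move=> i mi; have := @agree_prod _ _ m.+1 (index_iota 1 N.+1) (lam_prod_factor x y i) (fun=> 1).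
rewrite big1_eq; apply=> j; rewrite mem_index_iota => /andP[j0 _].
by apply: agree_lam_prod_factor; lia.
Qed.

(** The explicit product in Artin-Hasse coordinates. Each coefficient is read on a
    finite truncation of the double product. *)
Definition lam_prod f g : Lambda A := lam_of (fun n => lam_prod_trunc n.+1 (AH f) (AH g) n.+1).

Lemma lam_prod_agree f g m : agree m.+1 (lam_coef (lam_prod f g))
  (lam_prod_trunc m (AH f) (AH g)).
Proof.
by move=> [|n] nm; rewrite /= ?lam_prod_trunc0 // (@lam_prod_trunc_stable m n.+1).
Qed.

Lemma AHK f : artin_hasse (AH f) = f.
Proof. exact: (inv_mapK _ (artin_hasse_bij A)). Qed.

(** This holds over every ring, which is what the Witt product needs; over rings
    with torsion it does not characterise the product. *)
Lemma zdlog_lam_prod f g : zdlog (lam_prod f g) = ptw_mul (zdlog f) (zdlog g).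
Proof.
apply/funext=> n; rewrite /ptw_mul -{2}(AHK f) -{2}(AHK g) !zdlogE !dlog_artin_hasse.
rewrite -dlog_lam_prod_trunc; apply: (@agree_dlog A n.+2); rewrite ?lam0 ?lam_prod_trunc0 //.
exact: lam_prod_agree.
Qed.

Lemma zdlog_geom (a : A) n : zdlog (lam_geom a) n = a ^+ n.+1.
Proof. by rewrite zdlogE (dlog_geo a n.+1 (isT : (0 < 1)%N)) dvd1n divn1. Qed.

End LambdaMul.

Lemma lam_prod_nat : natural_op (F := Lambda_functor) lam_prod.
Proof.
move=> A B phi f g; apply: lam_eq => n /=; rewrite !AH_nat.
have -> : lam_prod_trunc n.+1 (fun n => phi (AH f n)) (fun n => phi (AH g n)) =
   pmap phi (lam_prod_trunc n.+1 (AH f) (AH g)); last by [].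
rewrite pmap_prod; apply: eq_big_nat => i /andP[i0 _].
rewrite pmap_prod; apply: eq_big_nat => j /andP[j0 _].
rewrite pmapX pmap_geo ?lcmn_gt0 ?i0 //.
by rewrite rmorphM !rmorphXn.
Qed.

Lemma Lambda_lift (A B : comPzRingType) (pi : {rmorphism B -> A}) :
  (forall a, exists b, pi b = a) -> forall f : Lambda A, exists g, Lambda_map pi g = f.
Proof.
move=> ps f; have s a : {b | pi b = a} by apply: cid; apply: ps.
exists (lam_of (fun n => sval (s (lam_coef f n.+1)))).
by apply: lam_eq => n /=; apply: (svalP (s _)).
Qed.

Lemma lam_trivial (A : comPzRingType) : (1 : A) == 0 -> forall f g : Lambda A, f = g.
Proof.
move=> /eqP e f g; apply: lam_eq => n.
by rewrite -[LHS]mulr1 -[RHS]mulr1 e !mulr0.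
Qed.

(** Each identity holds over torsion-free rings by injectivity of the logarithmic
    derivative; naturality pushes it to quotients. *)
Lemma lam_prod_spec :
  [/\ natural_op (F := Lambda_functor) lam_prod,
      forall A, left_distributive (@lam_prod A) (@lam_add A),
      forall A, right_distributive (@lam_prod A) (@lam_add A)
    & forall (A : comPzRingType) (a b : A), lam_prod (lam_geom a) (lam_geom b) = lam_geom
      (a * b)].
Proof.
have nat_ (A B : comPzRingType) (phi : {rmorphism A -> B}) f g :
  lam_prod (Lambda_map phi f) (Lambda_map phi g) = Lambda_map phi (lam_prod f g).
  exact: (esym (lam_prod_nat phi f g)).
split; first exact: lam_prod_nat.
- move=> A f g h; have [/lam_trivial|] := boolP ((1 : A) == 0); first exact.
  case/torsion_free_cover=> B [pi [pis tf]].
  have [f' <-] := Lambda_lift pis f; have [g' <-] := Lambda_lift pis g.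
  have [h' <-] := Lambda_lift pis h.
  rewrite -lam_add_nat !nat_ -lam_add_nat; congr (Lambda_map pi _).
  apply: (zdlog_inj tf); rewrite zdlogD !zdlog_lam_prod zdlogD; apply/funext=> n.
  exact: mulrDl.
- move=> A f g h; have [/lam_trivial|] := boolP ((1 : A) == 0); first exact.
  case/torsion_free_cover=> B [pi [pis tf]].
  have [f' <-] := Lambda_lift pis f; have [g' <-] := Lambda_lift pis g.
  have [h' <-] := Lambda_lift pis h.
  rewrite -lam_add_nat !nat_ -lam_add_nat; congr (Lambda_map pi _).
  apply: (zdlog_inj tf); rewrite zdlogD !zdlog_lam_prod zdlogD; apply/funext=> n.
  exact: mulrDr.
move=> A a b; have [/lam_trivial|] := boolP ((1 : A) == 0); first exact.
case/torsion_free_cover=> B [pi [pis tf]].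
have [a' <-] := pis a; have [b' <-] := pis b.
rewrite -rmorphM -!lam_geom_nat nat_; congr (Lambda_map pi _).
apply: (zdlog_inj tf); rewrite !zdlog_lam_prod; apply/funext=> n.
by rewrite /ptw_mul !zdlog_geom exprMn.
Qed.

Lemma lam_mul_spec :
  [/\ natural_op (F := Lambda_functor) lam_mul,
      forall A, left_distributive (@lam_mul A) (@lam_add A),
      forall A, right_distributive (@lam_mul A) (@lam_add A)
    & forall (A : comPzRingType) (a b : A), lam_mul (lam_geom a) (lam_geom b) = lam_geom (a * b)].
Proof.
rewrite /lam_mul.
match goal with |- context [the ?t ?P] => apply: (@the_spec _ t P) end.
by exists lam_prod; apply: lam_prod_spec.
Qed.

Lemma artin_hasseK (A : comPzRingType) (x : seqP A) : AH (artin_hasse x) = x.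
Proof. exact: (inv_map_eq _ (artin_hasse_bij A)). Qed.

Lemma ghost_AH (A : comPzRingType) (f : Lambda A) : ghost (AH f) = zdlog f.
Proof. by rewrite -zdlog_artin_hasse AHK. Qed.

Lemma witt_add_spec : natural_op (F := seq_functor) witt_add /\
  forall (A : comPzRingType) (x y : seqP A),
    ghost (witt_add x y) = ptw_add (ghost x) (ghost y).
Proof.
rewrite /witt_add.
match goal with |- context [the ?t ?P] => apply: (@the_spec _ t P) end.
exists (fun A x y => AH (lam_add (artin_hasse x) (artin_hasse y))); split.
  move=> A B phi x y; rewrite /= !artin_hasse_nat -lam_add_nat AH_nat //.
by move=> A x y; rewrite ghost_AH zdlogD !zdlog_artin_hasse.
Qed.

(** The Witt operations are those of [Lambda] in Artin-Hasse coordinates. *)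
Lemma witt_mul_spec : natural_op (F := seq_functor) witt_mul /\
  forall (A : comPzRingType) (x y : seqP A),
    ghost (witt_mul x y) = ptw_mul (ghost x) (ghost y).
Proof.
rewrite /witt_mul.
match goal with |- context [the ?t ?P] => apply: (@the_spec _ t P) end.
exists (fun A x y => AH (lam_prod (artin_hasse x) (artin_hasse y))); split.
  move=> A B phi x y; rewrite /= !artin_hasse_nat.
  by rewrite -AH_nat; congr AH; apply: (lam_prod_nat phi).
by move=> A x y; rewrite ghost_AH zdlog_lam_prod !zdlog_artin_hasse.
Qed.

(** * Uniqueness of the product of Lambda over rational algebras *)

(** Over a non-reduced ring a polynomial may have many roots; here the roots are
    the integers, whose differences are invertible, so factors can be divided out
    one after the other. *)
Lemma poly_nat0 (R : comNzRingType) (p : {poly R}) : Qring R ->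
  (forall m : nat, p.[m%:R] = 0) -> p = 0.
Proof.
case=> v hv hp.
have {}hp m : p.[(m + 0)%:R] = 0 by rewrite addn0 hp.
have [n] := ubnP (size p); elim: n p 0%N hp => // n IH p s hp pn.
have /factor_theorem[q pq] : root p s%:R by apply/rootP; apply: (hp 0%N).
suff ncsum_q0 : q = 0 by rewrite pq ncsum_q0 mul0r.
have [//|qn0] := eqVneq q 0.
apply: (IH q s.+1) => [m|].
  have := hp m.+1; rewrite pq hornerM hornerXsubC.
  rewrite addSnnS natrD [X in _ * X]addrC.
  have -> : - s%:R + (m%:R + s.+1%:R) = m.+1%:R :> R by rewrite !mulrS; ring.
  by move=> e; rewrite -[LHS]mulr1 -[X in _ * X](hv m) mulrA e mul0r.
move: pn; rewrite pq size_Mmonic ?monicXsubC // size_XsubC.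
by case: (size q) => //= k; rewrite addn2.
Qed.

Lemma poly_nat_eq (R : comNzRingType) (p q : {poly R}) : Qring R ->
  (forall m : nat, p.[m%:R] = q.[m%:R]) -> p = q.
Proof.
move=> QR h; apply/eqP; rewrite -subr_eq0; apply/eqP; apply: poly_nat0 => // m.
by rewrite hornerD hornerN h subrr.
Qed.

Section Additive.
Variable R : comNzRingType.
Hypothesis QR : Qring R.
Variables (L0 : (nat -> R) -> R) (L1 : (nat -> {poly R}) -> {poly R}).
Hypothesis L0D : forall a b, L0 (fun i => a i + b i) = L0 a + L0 b.
Hypothesis L1D : forall a b, L1 (fun i => a i + b i) = L1 a + L1 b.
Hypothesis L1E : forall (c : R) a, (L1 a).[c] = L0 (fun i => (a i).[c]).

Definition delta_seq (S : pzRingType) (i : nat) : nat -> S := fun j => (j == i)%:R.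

Lemma L0_zero : L0 (fun=> 0) = 0.
Proof.
have := L0D (fun=> 0) (fun=> 0); have -> : (fun=> 0 + 0) = (fun=> 0 : R) :> (nat -> R).
  by apply/funext=> i; rewrite addr0.
by move=> /eqP; rewrite -[X in X == _]addr0 => /eqP/addrI.
Qed.

(** An additive map is compatible with multiplication by integers; when it
    extends to polynomials, both sides of the scaling identity are polynomial in
    the scalar and agree at all integers. *)
Lemma L0_linear c a : L0 (fun i => c * a i) = c * L0 a.
Proof.
have e : L1 (fun i => 'X * (a i)%:P) = 'X * (L0 a)%:P.
  apply: poly_nat_eq => // m; rewrite L1E hornerM hornerX hornerC.
  have -> : (fun i => ('X * (a i)%:P).[m%:R]) = (fun i => m%:R * a i).
    by apply/funext=> i; rewrite hornerM hornerX hornerC.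
  elim: m => [|m IH].
    by rewrite mul0r -L0_zero; congr L0; apply/funext=> i; rewrite mul0r.
  rewrite mulrS mulrDl mul1r -IH -L0D; congr L0; apply/funext=> i.
  by rewrite mulrDl mul1r.
have := congr1 (horner^~ c) e; rewrite L1E hornerM hornerX hornerC => <-.
by congr L0; apply/funext=> i; rewrite hornerM hornerX hornerC.
Qed.

Lemma L1_linear k a : L1 (fun i => 'X^k * a i) = 'X^k * L1 a.
Proof.
apply: poly_nat_eq => // m; rewrite hornerM hornerXn !L1E -L0_linear.
by congr L0; apply/funext=> i; rewrite hornerM hornerXn.
Qed.

Definition graded_tail (a : nat -> R) N : nat -> {poly R} :=
  fun i => if (i < N)%N then 0 else (a i)%:P * 'X^(i.+1).

Lemma L1_tail a N : L1 (graded_tail a 0) =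
  \sum_(j < N) (a j * L0 (delta_seq R j))%:P * 'X^(j.+1) + L1 (graded_tail a N).
Proof.
elim: N => [|N ->]; first by rewrite big_ord0 add0r.
rewrite big_ord_recr -addrA; congr (_ + _).
have -> : graded_tail a N = fun i => (a N)%:P * 'X^(N.+1) * (delta_seq {poly R} N i) +
  graded_tail a N.+1 i.
  apply/funext=> i; rewrite /graded_tail /delta_seq ltnS; case: (ltngtP i N) => [iN|iN|->].
  - by rewrite mulr0 addr0.
  - by rewrite mulr0 add0r.
  - by rewrite mulr1 addr0.
rewrite L1D; congr (_ + _).
apply: poly_nat_eq => // m; rewrite L1E hornerM hornerC hornerXn mulrAC -L0_linear.
congr L0; apply/funext=> i; rewrite !hornerM hornerC hornerXn.
by rewrite /delta_seq; case: eqP => _; rewrite ?hornerC ?mulr0 // hornerC.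
Qed.

(** The part of [a_i t^(i+1)] beyond the index [i] is divisible by [t^(i+2)], hence does
    not contribute to the coefficient of [t^(i+1)]. This is how an operation that
    may depend on infinitely many entries is shown to be computed entrywise. *)
Lemma L1_coef a i : (L1 (graded_tail a 0))`_i.+1 = a i * L0 (delta_seq R i).
Proof.
rewrite (L1_tail a i.+1).
have -> : graded_tail a i.+1 = fun j => 'X^(i.+2) *
  (if (j < i.+1)%N then 0 else (a j)%:P * 'X^(j - i.+1)).
  apply/funext=> j; rewrite /graded_tail; case: ltnP => ij; first by rewrite mulr0.
  by rewrite mulrCA -exprD; congr (_ * 'X^_); lia.
rewrite L1_linear coefD coefXnM ltnSn addr0 coef_sum big_ord_recr big1 /= => [|j _].
  by rewrite coefCM coefXn eqxx mulr1 add0r.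
by rewrite coefCM coefXn eqSS gtn_eqF ?ltn_ord // mulr0.
Qed.

Lemma L1_coef0 a : (L1 (graded_tail a 0))`_0 = 0.
Proof.
have -> : graded_tail a 0 = fun j => 'X^1 * ((a j)%:P * 'X^j).
  by apply/funext=> j; rewrite /graded_tail /= mulrCA -exprD.
by rewrite L1_linear coefXnM.
Qed.

(** Evaluating at [t = 1] the polynomial whose coefficients are known. *)
Lemma L0_support n c : (forall i, L0 (delta_seq R i) = c *+ (i == n)) ->
  forall a, L0 a = a n * c.
Proof.
move=> h a; have e : L1 (graded_tail a 0) = (a n * c)%:P * 'X^(n.+1).
  apply/polyP=> -[|i]; first by rewrite L1_coef0 coefCM coefXn mulr0.
  by rewrite L1_coef h coefCM coefXn eqSS; case: eqP => [->|];
    rewrite ?mulr1n ?mulr1 ?mulr0n ?mulr0.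
have := congr1 (horner^~ 1) e; rewrite L1E hornerM hornerXn hornerC expr1n mulr1 => <-.
by congr L0; apply/funext=> i; rewrite /graded_tail /= hornerM hornerC hornerXn expr1n mulr1.
Qed.

End Additive.

Definition zdlog_inv (A : comPzRingType) : seqP A -> Lambda A :=
  inv_map (lam_geom 0) (@zdlog A).
(** A product of [Lambda], read through the logarithmic derivative. *)
Definition dlog_mul (A : comPzRingType) (a b : seqP A) : seqP A :=
  zdlog (lam_mul (zdlog_inv a) (zdlog_inv b)).

Lemma zdlog_invK (A : comPzRingType) : Qring A -> forall a : seqP A, zdlog (zdlog_inv a) = a.
Proof. by move=> QA a; apply: inv_mapK; apply: zdlog_bij. Qed.
Lemma zdlogK (A : comPzRingType) : Qring A -> forall f : Lambda A, zdlog_inv (zdlog f) = f.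
Proof. by move=> QA a; apply: inv_map_eq; apply: zdlog_bij. Qed.

Lemma zdlog_inv_nat (A B : comPzRingType) (phi : {rmorphism A -> B}) (a : seqP A) :
  Qring A -> Qring B -> zdlog_inv (fun n => phi (a n)) = Lambda_map phi (zdlog_inv a).
Proof.
move=> QA QB; apply: (bij_inj (zdlog_bij QB)).
by rewrite zdlog_nat !zdlog_invK.
Qed.

Lemma zdlog_invD (A : comPzRingType) (a b : seqP A) : Qring A ->
  zdlog_inv (fun n => a n + b n) = lam_add (zdlog_inv a) (zdlog_inv b).
Proof.
by move=> QA; apply: (bij_inj (zdlog_bij QA)); rewrite zdlogD !zdlog_invK.
Qed.

Lemma dlog_mul_nat (A B : comPzRingType) (phi : {rmorphism A -> B}) (a b : seqP A) n :
  Qring A -> Qring B ->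
  dlog_mul (fun n => phi (a n)) (fun n => phi (b n)) n = phi (dlog_mul a b n).
Proof.
move=> QA QB; rewrite /dlog_mul !zdlog_inv_nat //; case: lam_mul_spec => nat_ _ _ _.
by rewrite -[lam_mul _ _](nat_ _ _ phi (zdlog_inv a) (zdlog_inv b)) /= zdlog_nat.
Qed.

Lemma dlog_mulDl (A : comPzRingType) (a b c : seqP A) n : Qring A ->
  dlog_mul (fun i => a i + b i) c n = dlog_mul a c n + dlog_mul b c n.
Proof.
move=> QA; case: lam_mul_spec => _ dl _ _.
by rewrite /dlog_mul zdlog_invD // dl zdlogD.
Qed.

Lemma dlog_mulDr (A : comPzRingType) (a b c : seqP A) n : Qring A ->
  dlog_mul c (fun i => a i + b i) n = dlog_mul c a n + dlog_mul c b n.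
Proof.
move=> QA; case: lam_mul_spec => _ _ dr _.
by rewrite /dlog_mul zdlog_invD // dr zdlogD.
Qed.

Lemma dlog_mul_geom (A : comPzRingType) (a b : A) n : Qring A ->
  dlog_mul (fun i => a ^+ i.+1) (fun i => b ^+ i.+1) n = (a * b) ^+ n.+1.
Proof.
move=> QA; case: lam_mul_spec => _ _ _ gm.
have e (c : A) : zdlog_inv (fun i => c ^+ i.+1) = lam_geom c.
  by rewrite -[RHS]zdlogK //; congr (zdlog_inv _); apply/funext=> i; rewrite zdlog_geom.
by rewrite /dlog_mul !e gm zdlog_geom.
Qed.

Lemma Qring_poly (R : comNzRingType) : Qring R -> Qring {poly R}.
Proof.
case=> v hv; exists (fun n => (v n)%:P) => n.
by have := congr1 polyC (hv n); rewrite polyCM rmorph_nat.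
Qed.

Section DlogMulGeom.
Variable R : comNzRingType.
Hypothesis QR : Qring R.

Let ev c : {rmorphism {poly R} -> R} := horner_eval c.

(** Geometric sequences in the variable of a polynomial ring contain all unit
    sequences as coefficients. *)
Lemma dlog_mul_delta_geom (beta : R) i n :
  dlog_mul (delta_seq R i) (fun j => beta ^+ j.+1) n = beta ^+ n.+1 *+ (i == n).
Proof.
have QP := Qring_poly QR.
pose L0 (a : nat -> R) := dlog_mul a (fun j => beta ^+ j.+1) n.
pose L1 (a : nat -> {poly R}) := dlog_mul a (fun j => beta%:P ^+ j.+1) n.
have h := @L1_coef R QR L0 L1 _ _ _ (fun=> 1) i.
rewrite mul1r in h; rewrite -[LHS]h.
- rewrite /L1; have -> : graded_tail (fun=> 1 : R) 0 = fun j => 'X ^+ j.+1.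
    by apply/funext=> j; rewrite /graded_tail mul1r.
  by rewrite dlog_mul_geom // exprMn -rmorphXn mulrC coefCM coefXn eqSS mulr_natr.
- by move=> a b; apply: dlog_mulDl.
- by move=> a b; apply: dlog_mulDl.
- move=> c a; rewrite /L1 /L0 -[LHS](dlog_mul_nat (ev c)) //=; congr (dlog_mul _ _ n).
  by apply/funext=> j; rewrite /horner_eval horner_exp hornerC.
Qed.
End DlogMulGeom.

Lemma dlog_mul_delta (R : comNzRingType) (QR : Qring R) b i n :
  dlog_mul (delta_seq R i) b n = b n *+ (i == n).
Proof.
have QP := Qring_poly QR.
pose ev c : {rmorphism {poly R} -> R} := horner_eval c.
pose L0 (b : nat -> R) := dlog_mul (delta_seq R i) b n.
pose L1 (b : nat -> {poly R}) := dlog_mul (delta_seq {poly R} i) b n.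
have D0 a b' : L0 (fun i => a i + b' i) = L0 a + L0 b' by apply: dlog_mulDr.
have D1 a b' : L1 (fun i => a i + b' i) = L1 a + L1 b' by apply: dlog_mulDr.
have E c a : (L1 a).[c] = L0 (fun i => (a i).[c]).
  rewrite /L1 /L0 -[LHS](dlog_mul_nat (ev c)) //=; congr (dlog_mul _ _ n).
  by apply/funext=> j; rewrite /horner_eval /delta_seq; case: eqP; rewrite /= ?hornerC.
rewrite -[LHS]/(L0 b) -mulr_natr; apply: (L0_support QR D0 D1 E) => j.
have := @L1_coef R QR L0 L1 D0 D1 E (fun=> 1) j; rewrite mul1r => <-.
rewrite /L1; have -> : graded_tail (fun=> 1 : R) 0 = fun j => 'X ^+ j.+1.
  by apply/funext=> k; rewrite /graded_tail mul1r.
by rewrite dlog_mul_delta_geom // coefMn coefXn eqSS -mulrnA mulnC mulrnA.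
Qed.

(** Both arguments are handled in turn: the product of two geometric sequences
    determines that of a unit sequence and a geometric one, then of a unit sequence
    and any sequence, then of any two. *)
Lemma dlog_mulE (R : comNzRingType) (QR : Qring R) (a b : nat -> R) n :
  dlog_mul a b n = a n * b n.
Proof.
have QP := Qring_poly QR.
pose ev c : {rmorphism {poly R} -> R} := horner_eval c.
pose L0 (a : nat -> R) := dlog_mul a b n.
pose L1 (a : nat -> {poly R}) := dlog_mul a (fun j => (b j)%:P) n.
apply: (@L0_support R QR L0 L1).
- by move=> c d; apply: dlog_mulDl.
- by move=> c d; apply: dlog_mulDl.
- move=> c d; rewrite /L1 /L0 -[LHS](dlog_mul_nat (ev c)) //=; congr (dlog_mul _ _ n).
  by apply/funext=> j; rewrite /horner_eval hornerC.
- by move=> i; apply: dlog_mul_delta.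
Qed.

Lemma zdlogM (A : comPzRingType) (f g : Lambda A) : Qring A ->
  zdlog (lam_mul f g) = ptw_mul (zdlog f) (zdlog g).
Proof.
move=> QA; apply/funext=> n.
have -> : zdlog (lam_mul f g) n = dlog_mul (zdlog f) (zdlog g) n.
  by rewrite /dlog_mul !zdlogK.
rewrite /ptw_mul; move: (zdlog f) (zdlog g) => a b {f g}.
have [/eqP e|] := boolP ((1 : A) == 0).
  by rewrite -[LHS]mulr1 -[RHS]mulr1 e !mulr0.
by case/comNz_of_nonzero=> R eR; move: QA a b; rewrite eR => QA a b; apply: (dlog_mulE QA).
Qed.

(** * The necklace algebra and the weighted Hurwitz product *)

Section Necklace.
Variable A : comPzRingType.
Implicit Types a b : seqP A.

Lemma sum_divisors_sub (n d : nat) (F : nat -> A) : (0 < n)%N -> (d %| n)%N ->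
  \sum_(i <- divisors d) F i = \sum_(i <- divisors n | (i %| d)%N) F i.
Proof.
move=> n0 dn; have d0 := dvdn_gt0 n0 dn.
rewrite -[RHS]big_filter; apply: perm_big; apply: uniq_perm.
- exact: divisors_uniq.
- by rewrite filter_uniq // divisors_uniq.
move=> i; rewrite mem_filter -!dvdn_divisors //.
by case: (boolP (i %| d)%N) => //= id; rewrite (dvdn_trans id dn).
Qed.

Lemma ent_mkseqP (E : nat -> A) d : (0 < d)%N -> ent (Defs.mkseqP E) d = E d.
Proof. by case: d. Qed.

(** Grouping by the lcm, the sum over [d | n] becomes the sum over all pairs of
    divisors of [n], weighted by [gcd * lcm], the product of the two divisors. *)
Lemma MR_mul a b : MR (necklace_mul a b) = ptw_mul (MR a) (MR b).
Proof.
apply/funext=> n'; rewrite /MR /ptw_mul /Defs.mkseqP; set n := n'.+1.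
have n0 : (0 < n)%N by [].
rewrite big_distrlr /=.
transitivity (\sum_(d <- divisors n) \sum_(i <- divisors n) \sum_(j <- divisors n)
   if lcmn i j == d then ent a i * ent b j *+ (gcdn i j * lcmn i j) else 0).
  apply: eq_big_seq => d; rewrite -dvdn_divisors // => dn.
  have d0 := dvdn_gt0 n0 dn.
  rewrite ent_mkseqP //.
  rewrite (sum_divisors_sub _ n0 dn) -sumrMnl big_mkcond /=; apply: eq_bigr => i _.
  rewrite -big_mkcond /=; case: (boolP (i %| d)%N) => id; last first.
    by rewrite big1 // => j /eqP e; case/negP: id; rewrite -e dvdn_lcml.
  rewrite (big_mkcond (fun j => lcmn i j == d)) (sum_divisors_sub _ n0 dn) /=.
  rewrite -sumrMnl big_mkcond [RHS]big_mkcond; apply: eq_bigr => j _.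
  case: (eqVneq (lcmn i j) d) => [<-|_]; last by rewrite mul0rn; case: ifP.
  by rewrite dvdn_lcmr mulrnA.
rewrite exchange_big /=; apply: eq_big_seq => i; rewrite -dvdn_divisors // => id.
rewrite exchange_big /=; apply: eq_big_seq => j; rewrite -dvdn_divisors // => jd.
rewrite -big_mkcond /= -big_filter.
have -> : [seq d <- divisors n | lcmn i j == d] = [:: lcmn i j].
  apply: perm_small_eq => //; apply: uniq_perm => //.
    by rewrite filter_uniq ?divisors_uniq.
  move=> d; rewrite mem_filter mem_seq1 -dvdn_divisors // eq_sym.
  by case: eqP => // ->; rewrite dvdn_lcm id jd.
by rewrite big_seq1 mulrnAl mulrnAr -mulrnA mulnC muln_lcm_gcd mulnC.
Qed.

Lemma MR_bij : Qring A -> bijective (@MR A).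
Proof.
case=> v hv; apply: (@triangular_bij _ (fun n => n.+1%:R) v) => [//|n a b eab].
have e c : MR c n = \sum_(1 <= d < n.+1) (if (d %| n.+1)%N then ent c d *+ d else 0) + c n *+
  n.+1.
  by rewrite /MR /Defs.mkseqP sum_divisors // big_mkcond big_nat_recr //= dvdnn.
rewrite !e (_ : \sum_(1 <= d < n.+1) _ =
    \sum_(1 <= d < n.+1) (if (d %| n.+1)%N then ent b d *+ d else 0)).
  by rewrite opprD addrACA subrr add0r -mulrnBl mulr_natl.
by apply: eq_big_nat => d /andP[d0 dn]; rewrite /ent eab //; lia.
Qed.
End Necklace.

Lemma pascal_sum (V : nmodType) (f : nat -> V) n :
  \sum_(j < n.+2) f j *+ 'C(n.+1, j) = \sum_(j < n.+1) (f j + f j.+1) *+ 'C(n, j).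
Proof.
rewrite big_ord_recl bin0 /=.
under eq_bigr => i _ do rewrite /bump /= binS mulrnDr.
rewrite big_split /= big_ord_recr /= bin_small // mulr0n addr0 addrA.
under [RHS]eq_bigr => i _ do rewrite mulrnDl.
rewrite big_split /= [in RHS]big_ord_recl /= bin0; congr (_ + _).
Qed.

(** A form of the Vandermonde convolution that keeps the summand [c] general; it
    follows from the rule of Pascal alone. *)
Lemma bin_conv (V : nmodType) (c : nat -> V) s p :
  \sum_(j < s.+1) \sum_(i < p.+1) c (i + j)%N *+ 'C(p, i) *+ 'C(s, j) =
  \sum_(q < (s + p).+1) c q *+ 'C(s + p, q).
Proof.
elim: s p => [|s IH] p.
  by rewrite big_ord1 bin0; apply: eq_bigr => i _; rewrite addn0 mulr1n.
rewrite addSnnS -IH.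
under eq_bigr => j _ do rewrite sumrMnl.
rewrite (pascal_sum (fun j => \sum_(i < p.+1) c (i + j)%N *+ 'C(p, i))).
apply: eq_bigr => j _; rewrite sumrMnl (pascal_sum (fun i => c (i + j)%N)); congr (_ *+ _).
by rewrite -big_split; apply: eq_bigr => i _; rewrite mulrnDl addSnnS.
Qed.

Lemma bin_trinom n m p : (p <= m)%N -> (m <= n)%N ->
  ('C(n, m) * 'C(m, p) = 'C(n, p) * 'C(n - p, m - p))%N.
Proof.
move=> pm mn; have d0 : (0 < p`! * (m - p)`! * (n - m)`!)%N by rewrite !muln_gt0 !fact_gt0.
suff: ('C(n, m) * 'C(m, p) * (p`! * (m - p)`! * (n - m)`!) =
       'C(n, p) * 'C(n - p, m - p) * (p`! * (m - p)`! * (n - m)`!))%N.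
  by move/eqP; rewrite eqn_pmul2r // => /eqP.
transitivity (n`!)%N.
  by rewrite -(bin_fact mn) -(bin_fact pm) !mulnA.
rewrite -(bin_fact (leq_trans pm mn)) -(bin_fact (leq_sub2r p mn)).
by rewrite subnBA // (subnK (leq_trans pm mn)) !mulnA; congr (_ * _ * _)%N; rewrite mulnAC.
Qed.

Section Hurwitz.
Variables (A : comPzRingType) (l : A).
Implicit Types a b : nat -> A.

(** With [p] and [q] the indices of [a] and [b], the summand is
    [l^(p+q) a_p b_q] times a product of three binomials. It factors as
    [C(n,p)] times a Vandermonde summand for [C(n,q)]. *)
Lemma GS_hurwitz a b : GS l (hurwitz_mul l a b) = ptw_mul (GS l a) (GS l b).
Proof.
apply/funext=> n; rewrite /GS /ptw_mul /hurwitz_mul.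
pose T p m i := l ^+ p * a p * (l ^+ (i + (m - p)) * b (i + (m - p))%N) *+
  ('C(n, p) * 'C(p, i) * 'C(n - p, m - p)).
(* The index of [a] is [p = m - j], that of [b] is [i + (m - p)]. *)
transitivity (\sum_(m < n.+1) \sum_(p < n.+1 | (p <= m)%N) \sum_(i < p.+1) T p m i).
  apply: eq_bigr => m _.
  have mn : (m <= n)%N by have := ltn_ord m.
  rewrite big_distrr /= -sumrMnl.
  transitivity (\sum_(j < m.+1) \sum_(i < m.+1 | (i <= m - j)%N) T (m - j)%N m i).
    under eq_bigr => i _ do rewrite big_distrr -sumrMnl /=.
    transitivity (\sum_(i < m.+1) \sum_(j < m.+1 | (j <= m - i)%N) T (m - j)%N m i).
      apply: eq_bigr => i _.
      have im : (i <= m)%N by have := ltn_ord i.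
      rewrite (big_ord_narrow_leq (leq_subr i m)) /=; apply: eq_bigr => j _ /=.
      have jm : (j <= m - i)%N by have := ltn_ord j.
      rewrite /T (_ : (m - (m - j) = j)%N); last by lia.
      have e1 : l ^+ m * l ^+ i = l ^+ (m - j) * l ^+ (i + j).
        by rewrite -!exprD; congr (_ ^+ _); lia.
      rewrite mulrnAr -mulrnA; congr (_ *+ _).
        rewrite -!mulrA mulrA e1 -!mulrA; congr (_ * _).
        by rewrite mulrCA.
      have e2 : ('C(n, m) * 'C(m, m - j) = 'C(n, m - j) * 'C(n - (m - j), j))%N.
        by rewrite bin_trinom ?leq_subr // subKn //; lia.
      have e3 : ('C(m, i) * 'C(m - i, j) = 'C(m, m - j) * 'C(m - j, i))%N.
        rewrite bin_trinom ?leq_subr //; last by lia.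
        by rewrite -(bin_sub jm); congr (_ * 'C(_, _))%N; lia.
      by rewrite e3 mulnC mulnA e2; ring.
    rewrite (exchange_big_dep predT) //=; apply: eq_bigr => j _; apply: eq_bigl => i.
    by have := ltn_ord i; have := ltn_ord j; lia.
  rewrite (reindex_inj rev_ord_inj) /=.
  rewrite (big_ord_narrow_leq mn) /=; apply: eq_bigr => p _.
  have pm : (p <= m)%N by have := ltn_ord p.
  by rewrite subSS subKn // (big_ord_narrow_leq pm).
rewrite (exchange_big_dep predT) //= big_distrl /=; apply: eq_bigr => p _.
have pn : (p <= n)%N by have := ltn_ord p.
rewrite -(big_geq_mkord p n.+1 xpredT (fun m => \sum_(i < p.+1) T p m i)).
rewrite -[X in \sum_(X <= _ < _) _](add0n p) big_addn big_mkord subSn //.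
have -> : \sum_(q < n.+1) l ^+ q * b q *+ 'C(n, q) =
   \sum_(j < (n - p).+1) \sum_(i < p.+1) l ^+ (i + j) * b (i + j)%N *+ 'C(p, i) *+ 'C(n - p, j).
  by rewrite (bin_conv (fun q => l ^+ q * b q)) subnK.
rewrite mulrnAl big_distrr /= -sumrMnl; apply: eq_bigr => j _.
rewrite big_distrr /= -sumrMnl; apply: eq_bigr => i _.
rewrite /T addnK !mulrnAr -!mulrnA; congr (_ *+ _); ring.
Qed.

Lemma GS_bij (l' : A) : l * l' = 1 -> bijective (@GS A l).
Proof.
move=> ll; apply: (@triangular_bij _ (fun n => l ^+ n) (fun n => l' ^+ n)) => [n|n a b eab].
  by rewrite -exprMn ll expr1n.
rewrite /GS !big_ord_recr /= binn !mulr1n.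
rewrite (_ : \sum_(j < n) _ = \sum_(j < n) (l ^+ j * b j) *+ 'C(n, j)).
  by rewrite opprD addrACA subrr add0r mulrBr.
by apply: eq_bigr => j _; rewrite eab.
Qed.

Lemma GS_unit n : GS l (fun n => (n == 0%N)%:R) n = 1.
Proof.
rewrite /GS big_ord_recl /= bin0 expr0 mulr1 big1 ?addr0 // => i _.
by rewrite mulr0 mul0rn.
Qed.

End Hurwitz.

(** * Operators on the full Fock space *)

Section Endo.
Variable A : comPzRingType.

(** Vectors of the full Fock space on two letters are arbitrary functions on
    words. Allowing infinite support makes power series in a creation operator
    well defined. *)
Definition fock : Type := seq bool -> A.
Implicit Types xi eta : fock.
Definition fadd xi eta : fock := fun w => xi w + eta w.
Definition fscale (c : A) xi : fock := fun w => c * xi w.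

Record endo : Type := Endo {
  efun :> fock -> fock;
  efunD : forall xi eta, efun (fadd xi eta) = fadd (efun xi) (efun eta);
  efunZ : forall c xi, efun (fscale c xi) = fscale c (efun xi)
}.

Lemma endo_eq (S T : endo) : (forall xi w, S xi w = T xi w) -> S = T.
Proof.
case: S T => [s sD sZ] [t tD tZ] /= e.
have est : s = t by apply/funext=> xi; apply/funext=> w; apply: e.
by subst t; congr Endo; apply: Prop_irrelevance.
Qed.

HB.instance Definition _ := gen_eqMixin endo.
HB.instance Definition _ := gen_choiceMixin endo.

Fact endo0D xi eta : (fun=> 0 : A) = fadd (fun=> 0) (fun=> 0).
Proof. by apply/funext=> w; rewrite /fadd addr0. Qed.
Fact endo0Z c xi : (fun=> 0 : A) = fscale c (fun=> 0).
Proof. by apply/funext=> w; rewrite /fscale mulr0. Qed.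
Definition endo0 : endo := @Endo (fun=> (fun=> 0)) endo0D endo0Z.

Fact endoND (T : endo) xi eta : (fun w => - T (fadd xi eta) w) =
  fadd (fun w => - T xi w) (fun w => - T eta w).
Proof. by apply/funext=> w; rewrite efunD /fadd opprD. Qed.
Fact endoNZ (T : endo) c xi : (fun w => - T (fscale c xi) w) = fscale c (fun w => - T xi w).
Proof. by apply/funext=> w; rewrite efunZ /fscale mulrN. Qed.
Definition endoN (T : endo) : endo := Endo (endoND T) (endoNZ T).

Fact endoDD (S T : endo) xi eta : (fun w => S (fadd xi eta) w + T (fadd xi eta) w) =
  fadd (fun w => S xi w + T xi w) (fun w => S eta w + T eta w).
Proof. by apply/funext=> w; rewrite !efunD /fadd addrACA. Qed.
Fact endoDZ (S T : endo) c xi : (fun w => S (fscale c xi) w + T (fscale c xi) w) =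
  fscale c (fun w => S xi w + T xi w).
Proof. by apply/funext=> w; rewrite !efunZ /fscale mulrDr. Qed.
Definition endoD (S T : endo) : endo := Endo (endoDD S T) (endoDZ S T).

Definition endo1 : endo := @Endo id (fun _ _ => erefl) (fun _ _ => erefl).

Fact endoMD (S T : endo) xi eta : S (T (fadd xi eta)) = fadd (S (T xi)) (S (T eta)).
Proof. by rewrite !efunD. Qed.
Fact endoMZ (S T : endo) c xi : S (T (fscale c xi)) = fscale c (S (T xi)).
Proof. by rewrite !efunZ. Qed.
Definition endoM (S T : endo) : endo := Endo (endoMD S T) (endoMZ S T).

Fact endo_addA : associative endoD.
Proof. by move=> R S T; apply: endo_eq => xi w /=; rewrite addrA. Qed.
Fact endo_addC : commutative endoD.
Proof. by move=> S T; apply: endo_eq => xi w /=; rewrite addrC. Qed.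
Fact endo_add0 : left_id endo0 endoD.
Proof. by move=> T; apply: endo_eq => xi w /=; rewrite add0r. Qed.
Fact endo_addN : left_inverse endo0 endoN endoD.
Proof. by move=> T; apply: endo_eq => xi w /=; rewrite addNr. Qed.
HB.instance Definition _ := GRing.isZmodule.Build endo
  endo_addA endo_addC endo_add0 endo_addN.

Fact endo_mulA : associative endoM. Proof. by move=> R S T; apply: endo_eq. Qed.
Fact endo_mul1 : left_id endo1 endoM. Proof. by move=> T; apply: endo_eq. Qed.
Fact endo_mulr1 : right_id endo1 endoM. Proof. by move=> T; apply: endo_eq. Qed.
Fact endo_mulDl : left_distributive endoM endoD.
Proof. by move=> R S T; apply: endo_eq. Qed.
Fact endo_mulDr : right_distributive endoM endoD.
Proof. move=> R S T; apply: endo_eq => xi w.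
exact: (congr1 (@^~ w) (efunD R (S xi) (T xi))). Qed.
HB.instance Definition _ := GRing.Zmodule_isPzRing.Build endo
  endo_mulA endo_mul1 endo_mulr1 endo_mulDl endo_mulDr.

Lemma endo_addE (S T : endo) xi w : (S + T) xi w = S xi w + T xi w.
Proof. by []. Qed.
Lemma endo_mulE (S T : endo) xi : (S * T) xi = S (T xi). Proof. by []. Qed.

Fact scalD c xi eta : fscale c (fadd xi eta) = fadd (fscale c xi) (fscale c eta).
Proof. by apply/funext=> w; rewrite /fscale /fadd mulrDr. Qed.
Fact scalZ c d xi : fscale c (fscale d xi) = fscale d (fscale c xi).
Proof. by apply/funext=> w; rewrite /fscale mulrCA. Qed.
Definition escal (c : A) : endo := Endo (scalD c) (scalZ c).

Fact escal_zmod : zmod_morphism escal.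
Proof.
move=> a b; apply: endo_eq => xi w.
by rewrite endo_addE /= /fscale mulrBl.
Qed.
Fact escal_monoid : monoid_morphism escal.
Proof.
split; first by apply: endo_eq => xi w /=; rewrite /fscale mul1r.
by move=> a b; apply: endo_eq => xi w; rewrite endo_mulE /= /fscale mulrA.
Qed.
HB.instance Definition _ := GRing.isZmodMorphism.Build A endo escal escal_zmod.
HB.instance Definition _ := GRing.isMonoidMorphism.Build A endo escal escal_monoid.

Definition vac : fock := fun w => (w == [::])%:R.
Definition vstate (T : endo) : A := T vac [::].

Fact escal_central a (T : endo) : escal a * T = T * escal a.
Proof. by apply: endo_eq => xi w; rewrite !endo_mulE /= efunZ. Qed.
Fact vstateD (S T : endo) : vstate (S + T) = vstate S + vstate T.
Proof. by []. Qed.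
Fact vstateZ a (T : endo) : vstate (escal a * T) = a * vstate T.
Proof. by []. Qed.
Fact vstate1 : vstate 1 = 1. Proof. by []. Qed.
Definition fock_ncps : ncps A := @NCPS A endo escal escal_central vstate vstateD vstateZ vstate1.

Definition annih_fun (i : bool) xi : fock := fun w => xi (i :: w).
Definition annih (i : bool) : endo := @Endo (annih_fun i) (fun _ _ => erefl) (fun _ _ => erefl).

(** The power series [f] in the creation operator of the letter [i]: a word
    receives contributions from its suffixes obtained by removing initial letters
    [i]. *)
Fixpoint creat_fun (i : bool) (f : nat -> A) xi (w : seq bool) : A :=
  f 0 * xi w + (if w is j :: w' then
    if j == i then creat_fun i (fun n => f n.+1) xi w' else 0 else 0).

Fact creat_funD i f xi eta : creat_fun i f (fadd xi eta) = fadd (creat_fun i f xi)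
  (creat_fun i f eta).
Proof.
apply/funext=> w; elim: w f => [|j w IH] f; rewrite /fadd /=; first by ring.
by rewrite IH /fadd; case: ifP => _; ring.
Qed.
Fact creat_funZ i f c xi : creat_fun i f (fscale c xi) = fscale c (creat_fun i f xi).
Proof.
apply/funext=> w; elim: w f => [|j w IH] f; rewrite /fscale /=; first by ring.
by rewrite IH /fscale; case: ifP => _; ring.
Qed.
Definition creat i f : endo := Endo (creat_funD i f) (creat_funZ i f).

Definition not_headed (i : bool) (w : seq bool) := if w is j :: _ then j != i else true.

(** Operators that act on the initial run of the letter [i] only, in the same way
    whatever follows. They form an algebra, and those of distinct letters are free. *)
Definition leg_local (i : bool) (T : endo) : Prop :=
  exists t : (nat -> A) -> (nat -> A),
    [/\ forall a b, t (fun n => a n + b n) = (fun n => t a n + t b n),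
        forall c a, t (fun n => c * a n) = (fun n => c * t a n)
      & forall xi w n, not_headed i w ->
         T xi (nseq n i ++ w) = t (fun m => xi (nseq m i ++ w)) n].

Lemma local_mul i S T : leg_local i S -> leg_local i T -> leg_local i (S * T).
Proof.
case=> s [sD sZ sE] [t [tD tZ tE]]; exists (s \o t); split=> [a b|c a|xi w n iw] /=.
- by rewrite tD sD.
- by rewrite tZ sZ.
rewrite -[LHS]/(S (T xi) (nseq n i ++ w)) sE //; congr (s _ n); apply/funext=> m; exact: tE.
Qed.
Lemma local_add i S T : leg_local i S -> leg_local i T -> leg_local i (S + T).
Proof.
case=> s [sD sZ sE] [t [tD tZ tE]]; exists (fun a n => s a n + t a n).
split=> [a b|c a|xi w n iw] /=.
- by rewrite tD sD; apply/funext=> n; rewrite addrACA.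
- by rewrite tZ sZ; apply/funext=> n; rewrite mulrDr.
by rewrite -[LHS]/(S xi (nseq n i ++ w) + T xi (nseq n i ++ w)) sE // tE.
Qed.
Lemma local_scal i c : leg_local i (escal c).
Proof.
exists (fun a n => c * a n); split=> // [a b|d a].
- by apply/funext=> n; rewrite mulrDr.
- by apply/funext=> n; rewrite mulrCA.
Qed.
Lemma local_1 i : leg_local i 1.
Proof. by exists id. Qed.
Lemma local_annih i : leg_local i (annih i).
Proof. by exists (fun a n => a n.+1). Qed.
Lemma local_creat i f : leg_local i (creat i f).
Proof.
exists (fun a => ps_mul f a); split=> [a b|c a|xi w n iw].
- exact: (@mulrDr (ps A) f a b).
- apply/funext=> n; rewrite /ps_mul big_distrr; apply: eq_bigr => i0 _.
  by rewrite /= mulrCA.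
rewrite -[LHS]/(creat_fun i f xi (nseq n i ++ w)).
elim: n f => [|n IH] f.
  rewrite /ps_mul big_ord1 /=; case: w iw => [|j w] /=; first by rewrite addr0.
  by move=> /negPf->; rewrite addr0.
by rewrite /= eqxx IH /ps_mul [RHS]big_ord_recl /= ?subn0.
Qed.

Lemma local_subalg i (x u : fock_ncps) : leg_local i x -> in_subalg x u -> leg_local i u.
Proof.
move=> xi [N [c ->]]; elim: N => [|N IH].
  rewrite big_ord0; have -> : 0 = escal 0 by rewrite rmorph0.
  exact: local_scal.
rewrite big_ord_recr; apply: local_add; first exact: IH.
apply: local_mul; first exact: local_scal.
elim: {IH} N => [|N IH]; first exact: local_1.
by rewrite exprS; apply: local_mul.
Qed.

(** Seen from the initial runs of [i], a vector that vanishes on words starting with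
    [i] is a multiple of the vacuum. *)
Lemma local_apply i T eta w : leg_local i T -> (forall w', eta (i :: w') = 0) ->
  not_headed i w -> T eta w = eta w * vstate T.
Proof.
case=> t [tD tZ tE] eta0 iw; have := tE eta w 0%N iw; rewrite /= => ->.
rewrite /vstate (tE vac [::] 0%N isT) -/(nat -> A).
have -> : (fun m => eta (nseq m i ++ w)) = (fun m => eta w * vac (nseq m i ++ [::])).
  by apply/funext=> -[|m] /=; rewrite /vac ?mulr1 // eta0 mulr0.
by rewrite tZ.
Qed.

(** A centred local operator for [i] sends a vector supported away from the words
    starting with [i] to one supported on such words. Hence alternating products of
    centred operators move the vacuum to vectors without vacuum component. *)
Lemma local_free (x y : fock_ncps) : leg_local true x -> leg_local false y -> Defs.free x y.
Proof.
move=> lx ly n s u n0 alternates hu.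
suff h : forall w, not_headed (s 0%N) w -> (\prod_(j < n) u j : endo) vac w = 0 by apply: h.
have lu j : (j < n)%N -> leg_local (s j) (u j : endo) /\ vstate (u j) = 0.
  move=> jn; have [sub st] := hu j jn; split; last exact: st.
  by case: (s j) sub; apply: local_subalg.
elim: n s u n0 alternates lu {hu} => // n IH s u _ alternates lu w sw.
rewrite big_ord_recl endo_mulE.
have [l0 c0] := lu 0%N isT.
rewrite (local_apply l0) ?c0 ?mulr0 // => w'.
case: n IH alternates lu => [|n] IH alternates lu; first by rewrite big_ord0.
apply: (IH (fun j => s j.+1) (fun j => u j.+1)) => //=.
- by move=> j jn; apply: alternates.
- by move=> j jn; apply: lu.
exact: alternates.
Qed.

End Endo.

(** * Moment series in the Fock space, and uniqueness of free moments *)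

Section Resolvent.
Variable A : comPzRingType.
Implicit Types (xi eta : fock A) (U X : endo A) (f P Q : ps A).

(** The vacuum component of [(1 - z U)^-1 xi]. For a suitable [U] it is an
    eigenfunctional of the creation operators, with eigenvalue [z]. *)
Definition resolvent U xi : ps A := fun n => (U ^+ n : endo A) xi [::].

Lemma resolventD U xi eta : resolvent U (fadd xi eta) = resolvent U xi + resolvent U eta.
Proof. by apply/funext=> n; rewrite psD /resolvent efunD. Qed.
Lemma resolventZ U c xi : resolvent U (fscale c xi) = psC c * resolvent U xi.
Proof. by apply/funext=> n; rewrite psCM /resolvent efunZ. Qed.

Lemma resolvent_head U xi : resolvent U xi = psC (xi [::]) + psX A * resolvent U (U xi).
Proof.
apply/funext=> -[|n]; rewrite psD psXM psCE /resolvent ?addr0 //.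
by rewrite exprSr add0r.
Qed.

Lemma resolvent0 U : resolvent U (fun=> 0) = 0.
Proof.
have -> : (fun=> 0) = fscale 0 (fun=> 0) :> fock A.
  by apply/funext=> w; rewrite /fscale mulr0.
by rewrite resolventZ psC0 mul0r.
Qed.

Lemma resolvent_vac U : U (vac A) = (fun=> 0) -> resolvent U (vac A) = 1.
Proof. by move=> U0; rewrite resolvent_head U0 resolvent0 mulr0 addr0 psC1. Qed.

Definition push (i : bool) xi : fock A :=
  fun w => if w is j :: w' then if j == i then xi w' else 0 else 0.

Lemma creat_unfold i f xi :
  creat i f xi = fadd (fscale (f 0%N) xi) (push i (creat i (ps_tl f) xi)).
Proof. by apply/funext=> -[|j w]. Qed.

Lemma push_nil i xi : push i xi [::] = 0. Proof. by []. Qed.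

Lemma annih_push i j eta :
  annih A i (push j eta) = if i == j then eta else (fun=> 0).
Proof. by apply/funext=> w; rewrite /= /annih_fun /=; case: ifP. Qed.

(** A functional that turns creation into multiplication by [z] turns the series
    [f] of creations into multiplication by [f(z)]. *)
Lemma eval_creat i (T : fock A -> ps A) :
  (forall xi eta, T (fadd xi eta) = T xi + T eta) ->
  (forall c xi, T (fscale c xi) = psC c * T xi) ->
  (forall eta, T (push i eta) = psX A * T eta) ->
  forall f xi, T (creat i f xi) = f * T xi.
Proof.
move=> TD TZ TL f xi; apply/eqP; rewrite -subr_eq0; apply/eqP.
apply: (contraction_zero (g := psX A) (t := @ps_tl A) (D :=
  fun f => T (creat i f xi) - f * T xi)) => //.
by move=> {}f; rewrite creat_unfold TD TZ TL [X in _ - X * _](ps_headE f); ring.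
Qed.

Definition moment_series X : ps A := fun n => vstate (X ^+ n).

(** Put [T_n = T (X^n vac)]. The hypothesis reads
    [T_n = m_n Q / P + (z / P) T_(n+1)]; iterating from [T_0 = 1] gives
    [1 = (Q / P) M(z / P)]. *)
Lemma moment_series_functional X (T : fock A -> ps A) P Q : P 0%N = 1 ->
  T (vac A) = 1 ->
  (forall xi, psX A * T (X xi) = P * T xi - psC (xi [::]) * Q) ->
  Q * psComp (moment_series X) (psX A * psV P) = P.
Proof.
move=> P0 T1 TX; set v := psX A * psV P.
have v0 : v 0%N = 0 by rewrite /v psM0 mul0r.
have D0 n : T ((X ^+ n : endo A) (vac A)) - psV P * Q * psComp
  (fun k => moment_series X (k + n)%N) v = 0.
  apply: (contraction_zero (g := v) (t := S) (D := fun n => T ((X ^+ n : endo A) (vac A)) -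
     psV P * Q * psComp (fun k => moment_series X (k + n)%N) v)) => // {}n.
  rewrite (ps_comp_head (fun k => moment_series X (k + n)%N) v0) add0n.
  have -> : ps_tl (fun k => moment_series X (k + n)%N) = fun k => moment_series X (k + n.+1)%N.
    by apply/funext=> k; rewrite /ps_tl addSnnS.
  have e := TX ((X ^+ n : endo A) (vac A)).
  rewrite exprS endo_mulE.
  have {}e : v * T (X ((X ^+ n : endo A) (vac A))) = psV P * P * T ((X ^+ n : endo A) (vac A))
    - psV P * psC (moment_series X n) * Q.
    by rewrite /v mulrAC e; ring.
  by rewrite mulrBr e [psV P * P]mulrC ps_mulV //; ring.
move/eqP: (D0 0%N); rewrite expr0 T1 subr_eq0 => /eqP e.
have -> : moment_series X = fun k => moment_series X (k + 0)%N by apply/funext=> k; rewrite addn0.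
by rewrite -[RHS]mulr1 e !mulrA ps_mulV // mul1r.
Qed.

(** Its cumulant series is [z f(z)]: on the dual side this is the canonical
    model of Voiculescu of a variable with R-transform [f]. *)
Definition add_model i f : endo A := annih A i + creat i f.
(** Its S-transform is [1 / f] when [f] has constant term [1]; this is the model of
    Haagerup. *)
Definition mul_model i f : endo A := creat i f * (1 + annih A i).

Lemma moment_series_add_model i f :
  psComp (moment_series (add_model i f)) (psX A * psV (1 + psX A * f)) = 1 + psX A * f.
Proof.
set U := annih A i.
have TL eta : resolvent U (push i eta) = psX A * resolvent U eta.
  by rewrite resolvent_head annih_push eqxx psC0 add0r.
have := @moment_series_functional (add_model i f) (resolvent U) (1 + psX A * f) 1.
rewrite mul1r; apply.
- by rewrite psD psXM addr0.
- by apply: resolvent_vac; apply/funext=> w.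
move=> xi; rewrite -[add_model i f xi]/(fadd (U xi) (creat i f xi)) resolventD.
rewrite (eval_creat (resolventD U) (resolventZ U) TL) [in RHS](resolvent_head U xi).
have e := resolvent_head U xi.
by rewrite e; ring.
Qed.

Lemma moment_series_mul_model i f : f 0%N = 1 ->
  psComp (moment_series (mul_model i f)) (psX A * psV ((1 + psX A) * f)) = 1 + psX A.
Proof.
move=> f0; set U := annih A i.
have TL eta : resolvent U (push i eta) = psX A * resolvent U eta.
  by rewrite resolvent_head annih_push eqxx psC0 add0r.
set c := psComp _ _; suff e : f * c = (1 + psX A) * f.
  by rewrite -[LHS]mul1r -[X in X * _](ps_mulV f0) mulrAC e -mulrA ps_mulV // mulr1.
apply: (@moment_series_functional (mul_model i f) (resolvent U)).
- by rewrite psM0 f0 psD mulr1 addr0.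
- by apply: resolvent_vac; apply/funext=> w.
move=> xi; rewrite -[mul_model i f xi]/(creat i f (fadd xi (U xi))).
rewrite (eval_creat (resolventD U) (resolventZ U) TL) resolventD.
have e := resolvent_head U xi.
by rewrite e; ring.
Qed.

(** The resolvent of the sum of the two annihilations is an eigenfunctional of
    both creations, so the two series add up. *)
Lemma moment_series_add_model2 f g :
  psComp (moment_series (add_model true f + add_model false g))
    (psX A * psV (1 + psX A * (f + g))) =
  1 + psX A * (f + g).
Proof.
set U := annih A true + annih A false.
have TL i eta : resolvent U (push i eta) = psX A * resolvent U eta.
  rewrite resolvent_head push_nil psC0 add0r; case: i; congr (_ * resolvent U _).
    by apply/funext=> w; rewrite /U endo_addE !annih_push addr0.
  by apply/funext=> w; rewrite /U endo_addE !annih_push add0r.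
have := @moment_series_functional (add_model true f + add_model false g) (resolvent U)
  (1 + psX A * (f + g)) 1.
rewrite mul1r; apply.
- by rewrite psD psXM addr0.
- by apply: resolvent_vac; apply/funext=> w; rewrite /U /= /annih_fun /vac /= addr0.
move=> xi.
have -> : (add_model true f + add_model false g) xi =
    fadd (U xi) (fadd (creat true f xi) (creat false g xi)).
  by apply/funext=> w; rewrite /fadd /U !endo_addE addrACA.
rewrite (resolventD U (U xi)) (resolventD U (creat true f xi)).
rewrite !(eval_creat (resolventD U) (resolventZ U) (TL _)).
have e := resolvent_head U xi.
by rewrite e; ring.
Qed.

(** With [1 + U = (1 + a)(1 + b)] for the two annihilations [a], [b], the resolvent of
    [U] is an eigenfunctional of the creations for [a], and its composite with
    [1 + a] one of the creations for [b]. *)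
Lemma moment_series_mul_model2 f g : f 0%N = 1 -> g 0%N = 1 ->
  psComp (moment_series (mul_model true f * mul_model false g))
    (psX A * psV ((1 + psX A) * (f * g))) =
  1 + psX A.
Proof.
move=> f0 g0; set U := annih A false + annih A true + annih A true * annih A false.
have fg0 : (f * g) 0%N = 1 by rewrite psM0 f0 g0 mulr1.
(* [T] is the resolvent after [1 + a]; it lets the creations of the inner factor pass. *)
pose T xi := resolvent U (fadd xi (annih A true xi)).
have TL eta : resolvent U (push true eta) = psX A * resolvent U eta.
  rewrite resolvent_head push_nil psC0 add0r; congr (_ * resolvent U _).
  apply/funext=> w; rewrite /U !endo_addE endo_mulE !annih_push /= /annih_fun.
  by rewrite add0r addr0.
have TL' eta : T (push false eta) = psX A * T eta.
  rewrite /T annih_push /=; have -> : fadd (push false eta) (fun=> 0) = push false eta.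
    by apply/funext=> w; rewrite /fadd addr0.
  rewrite resolvent_head push_nil psC0 add0r; congr (_ * resolvent U _).
  apply/funext=> w; rewrite /U !endo_addE endo_mulE !annih_push /= /fadd.
  by rewrite addr0.
have TD xi eta : T (fadd xi eta) = T xi + T eta.
  rewrite /T efunD -resolventD; congr (resolvent U _).
  by apply/funext=> w; rewrite /fadd addrACA.
have TZ c xi : T (fscale c xi) = psC c * T xi.
  rewrite /T efunZ -resolventZ; congr (resolvent U _).
  by apply/funext=> w; rewrite /fadd /fscale mulrDr.
set c := psComp _ _; suff e : (f * g) * c = (1 + psX A) * (f * g).
  by rewrite -[LHS]mul1r -[X in X * _](ps_mulV fg0) mulrAC e -mulrA ps_mulV // mulr1.
apply: (@moment_series_functional (mul_model true f * mul_model false g) (resolvent U)).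
- by rewrite psM0 fg0 psD mulr1 addr0.
- apply: resolvent_vac; apply/funext=> w.
  by rewrite /U !endo_addE endo_mulE /= /annih_fun /vac /= !addr0.
move=> xi.
have -> : (mul_model true f * mul_model false g) xi = creat true f
   (fadd (creat false g (fadd xi (annih A false xi)))
      (annih A true (creat false g (fadd xi (annih A false xi))))) by [].
rewrite (eval_creat (resolventD U) (resolventZ U) TL) -/(T _) (eval_creat TD TZ TL').
have -> : T (fadd xi (annih A false xi)) = resolvent U xi + resolvent U (U xi).
  rewrite -resolventD /T; congr (resolvent U _); apply/funext=> w.
  by rewrite efunD /fadd /U !endo_addE endo_mulE !addrA.
have e := resolvent_head U xi.
by rewrite e; ring.
Qed.

End Resolvent.

Section Determinism.
Variable A : comPzRingType.

Fixpoint scal_poly (M : ncps A) (x : M) (l : seq A) : M :=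
  if l is c :: l' then nc_scal M c + x * scal_poly x l' else 0.

Lemma scal_poly_subalg (M : ncps A) (x : M) l : in_subalg x (scal_poly x l).
Proof.
exists (size l), (nth 0 l); elim: l => [|c l IH] /=; first by rewrite big_ord0.
rewrite big_ord_recl /= mulr1 IH big_distrr; congr (_ + _); apply: eq_bigr => i _.
by rewrite /= exprS !mulrA nc_scal_central.
Qed.

Fixpoint seq_add (l m : seq A) : seq A :=
  match l, m with
  | c :: l', d :: m' => (c + d) :: seq_add l' m'
  | [::], _ => m
  | _, [::] => l
  end.

Lemma scal_poly_add (M : ncps A) (x : M) l m : scal_poly x (seq_add l m) = scal_poly x l +
  scal_poly x m.
Proof.
elim: l m => [|c l IH] [|d m] //=; rewrite ?add0r ?addr0 //.
by rewrite IH rmorphD mulrDr addrACA.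
Qed.

Lemma scal_poly_scal (M : ncps A) (x : M) c l :
  scal_poly x [seq c * a | a <- l] = nc_scal M c * scal_poly x l.
Proof.
elim: l => [|a l IH] /=; first by rewrite mulr0.
rewrite IH rmorphM mulrDr; congr (_ + _).
by rewrite mulrA -nc_scal_central -mulrA.
Qed.

Fixpoint seq_mul (l m : seq A) : seq A :=
  if l is c :: l' then seq_add [seq c * a | a <- m] (0 :: seq_mul l' m) else [::].

Lemma scal_poly_mul (M : ncps A) (x : M) l m : scal_poly x (seq_mul l m) = scal_poly x l *
  scal_poly x m.
Proof.
elim: l => [|c l IH]; first by rewrite mul0r.
by rewrite -[LHS]/(scal_poly x (seq_add _ _)) scal_poly_add scal_poly_scal /= rmorph0 add0r IH
  mulrDl mulrA.
Qed.

Lemma nc_state_scal (M : ncps A) c : nc_state (nc_scal M c) = c.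
Proof. by rewrite -[nc_scal M c]mulr1 nc_stateZ nc_state1 mulr1. Qed.

Lemma nc_state0 (M : ncps A) : nc_state (0 : M) = 0.
Proof. by rewrite -(rmorph0 (nc_scal M)) nc_state_scal. Qed.

Lemma nc_stateB_scal (M : ncps A) c (u : M) : nc_state (u + nc_scal M (- c)) = nc_state u - c.
Proof. by rewrite nc_stateD nc_state_scal. Qed.

Variables M M' : ncps A.
Variables (x y : M) (x' y' : M').
Hypothesis fxy : Defs.free x y.
Hypothesis fxy' : Defs.free x' y'.
Hypothesis mx : moments x = moments x'.
Hypothesis my : moments y = moments y'.

(** The comparison of two free pairs is carried out on both sides at once, with the
    same polynomials; they are hidden by the quantifier. *)
Definition twin (s : bool) (u : M) (u' : M') : Prop :=
  exists l, u = scal_poly (if s then x else y) l /\ u' = scal_poly (if s then x' else y') l.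

Lemma state_exp s n : nc_state ((if s then x else y) ^+ n) = nc_state
  ((if s then x' else y') ^+ n).
Proof.
case: n => [|n]; first by rewrite !expr0 !nc_state1.
by case: s; [exact: (congr1 (@^~ n) mx) | exact: (congr1 (@^~ n) my)].
Qed.

Lemma twin_state s u u' : twin s u u' -> nc_state u = nc_state u'.
Proof.
case=> l [-> ->].
suff h k : nc_state ((if s then x else y) ^+ k * scal_poly (if s then x else y) l) =
           nc_state ((if s then x' else y') ^+ k * scal_poly (if s then x' else y') l).
  by have := h 0%N; rewrite !expr0 !mul1r.
elim: l k => [|c l IH] k /=; first by rewrite !mulr0 !nc_state0.
rewrite !mulrDr !nc_stateD -!nc_scal_central !nc_stateZ state_exp; congr (_ + _).
by rewrite !mulrA -!exprSr IH.
Qed.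

Lemma twin_mul s u u' v v' : twin s u u' -> twin s v v' -> twin s (u * v) (u' * v').
Proof.
by case=> l [-> ->] [m [-> ->]]; exists (seq_mul l m); rewrite !scal_poly_mul.
Qed.

Lemma twin_center s u u' c : twin s u u' ->
  twin s (u + nc_scal M (- c)) (u' + nc_scal M' (- c)).
Proof.
case=> l [-> ->]; exists (seq_add l [:: - c]).
by rewrite !scal_poly_add /= !mulr0 !addr0.
Qed.

Lemma twin_gen s : twin s (if s then x else y) (if s then x' else y').
Proof.
exists [:: 0; 1]; rewrite /= !rmorph0 !rmorph1 !mulr0 !addr0 !mulr1 !add0r //.
Qed.

Definition factor : Type := bool * M * M'.
Definition lprod (L : seq factor) : M := \prod_(t <- L) t.1.2.
Definition rprod (L : seq factor) : M' := \prod_(t <- L) t.2.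
Definition all_twin (L : seq factor) := forall t, t \in L -> twin t.1.1 t.1.2 t.2.
Definition centred (L : seq factor) := forall t, t \in L -> nc_state t.1.2 = 0.
Definition alternates (t t' : factor) := t.1.1 != t'.1.1.

Lemma alternating_state (N : ncps A) (a b : N) (pr : factor -> N) (P : seq factor) :
  Defs.free a b -> P != [::] -> sorted alternates P ->
  (forall t, t \in P -> in_subalg (if t.1.1 then a else b) (pr t) /\ nc_state (pr t) = 0) ->
  nc_state (\prod_(t <- P) pr t) = 0.
Proof.
case: P => // t0 P' fab _ aP hP; set P := t0 :: P' in aP hP *.
rewrite (big_nth t0) big_mkord.
apply: (fab (size P) (fun j => (nth t0 P j).1.1) (fun j => pr (nth t0 P j))) => //.
- by move=> j jP; have /sortedP := aP; move/(_ t0)/(_ _ jP).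
- by move=> j jP; apply: hP; apply: mem_nth.
Qed.

(** Freeness computes the state of a word of polynomials from shorter words. The
    centred prefix [P], stored in reverse, grows by centring the next factor; the
    constant removed leaves a shorter word, and two neighbours from the same algebra
    are merged. Both pairs of variables follow the same steps. *)
Lemma state_words n P L : (size P + (size L).*2 < n)%N -> all_twin P -> centred P ->
  sorted alternates P -> all_twin L ->
  nc_state (lprod (rev P) * lprod L) = nc_state (rprod (rev P) * rprod L).
Proof.
elim: n P L => // n IH P [|[[s u] u'] L] ltn gP cP aP gL.
  rewrite /lprod /rprod !big_nil !mulr1.
  case: P gP cP aP {ltn IH} => [|t P] gP cP aP; first by rewrite !big_nil !nc_state1.
  have raP : sorted alternates (rev (t :: P)).
    rewrite rev_sorted (eq_sorted (e' := alternates)) // => a b.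
    by rewrite /alternates eq_sym.
  have nP : rev (t :: P) != [::] by rewrite rev_cons; case: (rev P).
  rewrite (alternating_state fxy) ?(alternating_state fxy') //.
  - move=> t'; rewrite mem_rev => tP; have tw := gP _ tP.
    rewrite -(twin_state tw) cP //; split=> //.
    by case: tw => l [_ ->]; apply: scal_poly_subalg.
  - move=> t'; rewrite mem_rev => tP; have tw := gP _ tP.
    rewrite cP //; split=> //.
    by case: tw => l [-> _]; apply: scal_poly_subalg.
have tu : twin s u u' by apply: (gL (s, u, u')); rewrite mem_head.
have {}gL : all_twin L by move=> t tL; apply: gL; rewrite inE tL orbT.
(* Centring the next factor: legitimate when it does not continue the prefix. *)
have step : (forall p P', P = p :: P' -> p.1.1 != s) ->
  nc_state (lprod (rev P) * lprod ((s, u, u') :: L)) =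
  nc_state (rprod (rev P) * rprod ((s, u, u') :: L)).
  move=> hs; pose c := nc_state u.
  pose t := (s, u + nc_scal M (- c), u' + nc_scal M' (- c)) : factor.
  have e1 : nc_state (lprod (rev P) * lprod ((s, u, u') :: L)) =
     nc_state (lprod (rev (t :: P)) * lprod L) + c * nc_state (lprod (rev P) * lprod L).
    rewrite /lprod rev_cons -cats1 big_cat big_seq1 big_cons /=.
    rewrite -nc_stateZ -nc_stateD mulrDr mulrDl rmorphN mulrN mulNr -nc_scal_central.
    by rewrite -!mulrA subrK.
  have e2 : nc_state (rprod (rev P) * rprod ((s, u, u') :: L)) =
     nc_state (rprod (rev (t :: P)) * rprod L) + c * nc_state (rprod (rev P) * rprod L).
    rewrite /rprod rev_cons -cats1 big_cat big_seq1 big_cons /=.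
    rewrite -nc_stateZ -nc_stateD mulrDr mulrDl rmorphN mulrN mulNr -nc_scal_central.
    by rewrite -!mulrA subrK.
  rewrite e1 e2; congr (_ + _ * _).
    apply: IH => //.
    - by move: ltn; rewrite /= doubleS; lia.
    - by move=> t'; rewrite inE => /orP[/eqP->|/gP//]; apply: twin_center.
    - by move=> t'; rewrite inE => /orP[/eqP->|/cP//]; rewrite /= nc_stateB_scal subrr.
    - case: P hs {ltn gP cP e1 e2} aP => [//|p P] hs aP /=.
      by apply/andP; split; [rewrite /alternates /= eq_sym (hs p P) | exact: aP].
  apply: IH => //; move: ltn; rewrite /= doubleS; lia.
case: P gP cP aP ltn step => [|[[s' p] p'] P] gP cP aP ltn step; first by apply: step.
have [es|ns] := eqVneq s' s; last by apply: step => q P' [<- _].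
subst s'.
have := IH P ((s, p * u, p' * u') :: L).
rewrite /lprod /rprod !rev_cons -!cats1 !big_cat !big_seq1 !big_cons /= !mulrA; apply.
- by move: ltn; rewrite /= !doubleS; lia.
- by move=> t tP; apply: gP; rewrite inE tP orbT.
- by move=> t tP; apply: cP; rewrite inE tP orbT.
- exact: path_sorted aP.
- move=> t; rewrite inE => /orP[/eqP->|/gL//]; apply: twin_mul => //.
  by apply: (gP (s, p, p')); rewrite mem_head.
Qed.

Lemma state_addX n L : all_twin L ->
  nc_state (lprod L * (x + y) ^+ n) = nc_state (rprod L * (x' + y') ^+ n).
Proof.
elim: n L => [|n IH] L gL.
  have := @state_words _ [::] L (ltnSn _).
  rewrite /lprod /rprod !big_nil !mul1r !mulr1; exact.
have gS s : all_twin (rcons L (s, if s then x else y, if s then x' else y')).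
  by move=> t; rewrite mem_rcons inE => /orP[/eqP->|/gL//]; apply: twin_gen.
rewrite !exprS !mulrDl !mulrDr !nc_stateD; congr (_ + _).
  have := IH _ (gS true); rewrite /lprod /rprod -!cats1 !big_cat !big_seq1 /=.
  by rewrite -!mulrA.
have := IH _ (gS false); rewrite /lprod /rprod -!cats1 !big_cat !big_seq1 /=.
by rewrite -!mulrA.
Qed.

Lemma state_mulX n L : all_twin L ->
  nc_state (lprod L * (x * y) ^+ n) = nc_state (rprod L * (x' * y') ^+ n).
Proof.
elim: n L => [|n IH] L gL.
  have := @state_words _ [::] L (ltnSn _).
  rewrite /lprod /rprod !big_nil !mul1r !mulr1; exact.
have gS : all_twin (rcons (rcons L (true, x, x')) (false, y, y')).
  move=> t; rewrite mem_rcons inE => /orP[/eqP->|]; first exact: (twin_gen false).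
  rewrite mem_rcons inE => /orP[/eqP->|/gL//]; exact: (twin_gen true).
have := IH _ gS; rewrite /lprod /rprod -!cats1 !big_cat !big_seq1 /=.
by rewrite !exprS -!mulrA.
Qed.

Lemma free_moments_add : moments (x + y) = moments (x' + y').
Proof.
apply/funext=> n; have := @state_addX n.+1 [::]; rewrite /lprod /rprod !big_nil !mul1r.
exact.
Qed.

Lemma free_moments_mul : moments (x * y) = moments (x' * y').
Proof.
apply/funext=> n; have := @state_mulX n.+1 [::]; rewrite /lprod /rprod !big_nil !mul1r.
exact.
Qed.

End Determinism.

(** * Non-crossing partitions and Kreweras complements as binary trees *)

(** The node joins the tree of the points strictly between the first point and the
    next point of its block to the tree of the rest, starting at this next point.
    The first point is counted by the node; without a next point the second
    subtree is empty. *)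
Inductive tree := Lf | Nd of tree & tree.
HB.instance Definition _ := gen_eqMixin tree.

Fixpoint tsize t := if t is Nd l r then (tsize l + tsize r).+1 else 0%N.

(** A partition is recorded by the sequence of the minima of the blocks of its
    points, and its Kreweras complement by the sequence of the maxima. In the second
    subtree the first point, hence the value [0], belongs to the block of the
    overall first point. In the complement, the first point joins the last point
    before the second subtree. *)
Definition node_mins (m m' : seq nat) : seq nat :=
  0%N :: [seq x.+1 | x <- m] ++ [seq (if x == 0 then 0 else x + (size m).+1)%N | x <- m'].
Definition node_maxs (k k' : seq nat) : seq nat :=
  size k :: [seq x.+1 | x <- k] ++ [seq (x + (size k).+1)%N | x <- k'].

Fixpoint mins t := if t is Nd l r then node_mins (mins l) (mins r) else [::].
Fixpoint maxs t := if t is Nd l r then node_maxs (maxs l) (maxs r) else [::].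

Lemma size_node_mins m m' : size (node_mins m m') = (size m + size m').+1.
Proof. by rewrite /= size_cat !size_map. Qed.
Lemma size_node_maxs k k' : size (node_maxs k k') = (size k + size k').+1.
Proof. by rewrite /= size_cat !size_map. Qed.
Lemma size_mins t : size (mins t) = tsize t.
Proof. by elim: t => //= l IHl r IHr; rewrite size_cat !size_map IHl IHr. Qed.
Lemma size_maxs t : size (maxs t) = tsize t.
Proof. by elim: t => //= l IHl r IHr; rewrite size_cat !size_map IHl IHr. Qed.

Lemma minsE l r : mins (Nd l r) = node_mins (mins l) (mins r). Proof. by []. Qed.
Lemma maxsE l r : maxs (Nd l r) = node_maxs (maxs l) (maxs r). Proof. by []. Qed.
Lemma tsizeE l r : tsize (Nd l r) = (tsize l + tsize r).+1. Proof. by []. Qed.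

Local Notation "m @ i" := (nth 0%N m i) (at level 20).

Lemma node_mins0 m m' : node_mins m m' @ 0 = 0%N. Proof. by []. Qed.
Lemma node_minsS m m' u : (u < size m)%N -> node_mins m m' @ u.+1 = (m @ u).+1.
Proof. by move=> um; rewrite /= nth_cat size_map um (nth_map 0%N). Qed.
Lemma node_minsJ m m' u : (u < size m')%N ->
  node_mins m m' @ ((size m).+1 + u) = if m' @ u == 0%N then 0%N else (m' @ u + (size m).+1)%N.
Proof.
move=> um; rewrite addSn /= nth_cat size_map ltnNge leq_addr /= addKn.
by rewrite (nth_map 0%N).
Qed.
Lemma node_maxs0 k k' : node_maxs k k' @ 0 = size k. Proof. by []. Qed.
Lemma node_maxsS k k' u : (u < size k)%N -> node_maxs k k' @ u.+1 = (k @ u).+1.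
Proof. by move=> um; rewrite /= nth_cat size_map um (nth_map 0%N). Qed.
Lemma node_maxsJ k k' u : (u < size k')%N ->
  node_maxs k k' @ ((size k).+1 + u) = (k' @ u + (size k).+1)%N.
Proof.
move=> um; rewrite addSn /= nth_cat size_map ltnNge leq_addr /= addKn.
by rewrite (nth_map 0%N).
Qed.

Variant node_index (p q : nat) : nat -> Type :=
  | IdxZero : node_index p q 0
  | IdxLeft u of (u < p)%N : node_index p q u.+1
  | IdxRight u of (u < q)%N : node_index p q (p.+1 + u)%N.

Lemma node_indexP p q i : (i < (p + q).+1)%N -> node_index p q i.
Proof.
case: i => [|i] ipq; first exact: IdxZero.
case: (ltnP i p) => ip; first exact: IdxLeft.
have -> : i.+1 = (p.+1 + (i - p))%N by lia.
by apply: IdxRight; lia.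
Qed.

(** The sequences of block minima of non-crossing partitions. *)
Record min_seq (m : seq nat) : Prop := MinSeq {
  min_seq_le : forall i, (i < size m)%N -> (m @ i <= i)%N;
  min_seq_idem : forall i, (i < size m)%N -> m @ (m @ i) = m @ i;
  min_seq_nest : forall i l, (i < l)%N -> (l < size m)%N -> (m @ l <= i)%N -> (m @ l <= m @ i)%N
}.

Lemma min_seq_nil : min_seq [::].
Proof. by []. Qed.

Lemma min_seq_node m m' : min_seq m -> min_seq m' -> min_seq (node_mins m m').
Proof.
move=> gm gm'; have sz := size_node_mins m m'; split.
- move=> i; rewrite sz => /node_indexP[//|u um|u um].
    by rewrite node_minsS // ltnS; apply: min_seq_le gm _ um.
  rewrite node_minsJ //; case: eqP => // _; have := min_seq_le gm' um; lia.
- move=> i; rewrite sz => /node_indexP[//|u um|u um].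
    rewrite node_minsS // node_minsS; last by have := min_seq_le gm um; lia.
    by rewrite (min_seq_idem gm um).
  rewrite node_minsJ //; case: eqP => // e; rewrite addnC node_minsJ;
    last by have := min_seq_le gm' um; lia.
  by rewrite (min_seq_idem gm' um); case: eqP => //; lia.
move=> i l il; rewrite sz => ln; have hi := ltn_trans il ln.
case/node_indexP: ln il => [//|u um|u um]; case/node_indexP: hi => [|v vm|v vm] il.
- by rewrite node_minsS.
- by rewrite !node_minsS // !ltnS => h; apply: (min_seq_nest gm) => //; lia.
- by lia.
- by rewrite node_minsJ //; case: eqP => // _; lia.
- by rewrite node_minsJ //; case: eqP => // _; lia.
rewrite !node_minsJ //; case: eqP => // e h.
have uv : (v < u)%N by lia.
by have := @min_seq_nest _ gm' v u uv um; case: eqP; lia.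
Qed.

Lemma min_seq_mins t : min_seq (mins t).
Proof. by elim: t => [|l IHl r IHr]; [exact: min_seq_nil | exact: min_seq_node]. Qed.

Lemma eq_nth0 (m m' : seq nat) : size m = size m' ->
  (forall i, (i < size m)%N -> m @ i = m' @ i) -> m = m'.
Proof. by move=> sz h; apply: (@eq_from_nth _ 0%N). Qed.

(** The second subtree starts at the first return of the value [0]; nestedness
    confines the values between to the first subtree and the values after it to the
    second. *)
Lemma min_seq_node_inv m n : min_seq m -> size m = n.+1 ->
  exists m1 m2, [/\ min_seq m1, min_seq m2, (size m1 + size m2)%N = n & m = node_mins m1 m2].
Proof.
move=> gm sm; (* [p] is the size of the first subtree; without a second [0] it is [n]. *)
pose p := index 0%N (behead m).
have m0 : m @ 0 = 0%N by apply/eqP; rewrite -leqn0; apply: (min_seq_le gm); rewrite sm.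
have nb i : behead m @ i = m @ i.+1 by rewrite nth_behead.
have sb : size (behead m) = n by rewrite size_behead sm.
have pn : (p <= n)%N by rewrite -sb index_size.
have hlt u : (u < p)%N -> (0 < m @ u.+1)%N.
  by move=> up; rewrite lt0n -nb; have /= -> := before_find 0%N up.
have hp : (p < n)%N -> m @ p.+1 = 0%N.
  by move=> lpn; rewrite -nb nth_index // -index_mem sb.
have hge u : (p < u)%N -> (u <= n)%N -> (m @ u = 0%N \/ p.+1 < m @ u)%N.
  move=> pu un; have [->|np] := eqVneq u p.+1; first by left; apply: hp; lia.
  have := @min_seq_nest _ gm p.+1 u; rewrite hp ?sm; last by lia.
  by case: (leqP (m @ u) p.+1); [lia | right].
pose m1 := [seq x.-1 | x <- take p (behead m)].
pose m2 := [seq (x - p.+1)%N | x <- drop p (behead m)].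
have s1 : size m1 = p by rewrite size_map size_take sb; case: ltnP => //; lia.
have s2 : size m2 = (n - p)%N by rewrite size_map size_drop sb.
have n1 u : (u < p)%N -> m1 @ u = (m @ u.+1).-1.
  move=> up; rewrite (nth_map 0%N) ?nth_take ?nb //.
  by rewrite size_take sb; case: ifP => //; lia.
have n2 u : (u < n - p)%N -> m2 @ u = (m @ (p.+1 + u) - p.+1)%N.
  by move=> up; rewrite (nth_map 0%N) ?size_drop ?sb // nth_drop nb.
exists m1, m2; split; last first.
- apply: eq_nth0; first by rewrite size_node_mins s1 s2 sm; lia.
  rewrite sm => i; have -> : n = (p + (n - p))%N by lia.
  case/node_indexP=> [|u up|u up]; first by rewrite m0.
    by rewrite node_minsS ?s1 // n1 // prednK // hlt.
  rewrite -s1 node_minsJ ?s2 // s1 n2 //.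
  by have := @hge (p.+1 + u)%N; case: eqP; lia.
- by rewrite s1 s2; lia.
- split=> [i|i|i l il]; rewrite s2 => ip.
  + by rewrite n2 //; have := @min_seq_le _ gm (p.+1 + i)%N; rewrite sm; lia.
  + have lt1 : (p < p.+1 + i)%N by lia.
    have lt2 : (p.+1 + i <= n)%N by lia.
    have lt3 : (p.+1 + i < size m)%N by rewrite sm.
    have e1 := min_seq_le gm lt3; have e2 := min_seq_idem gm lt3.
    rewrite (n2 _ ip); case: (hge _ lt1 lt2) => e.
      by rewrite e sub0n n2 ?addn0 ?hp ?sub0n //; lia.
    rewrite n2; last by lia.
    by rewrite subnKC ?e2; lia.
  rewrite !n2 //; last by lia.
  have h := @min_seq_nest _ gm (p.+1 + i)%N (p.+1 + l)%N; rewrite sm in h.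
  have lt1 : (p < p.+1 + l)%N by lia.
  have lt2 : (p.+1 + l <= n)%N by lia.
  by case: (hge _ lt1 lt2); lia.
split=> [i|i|i l il]; rewrite s1 => ip.
+ by rewrite n1 //; have := @min_seq_le _ gm i.+1; rewrite sm; lia.
+ have := @min_seq_le _ gm i.+1; have := @min_seq_idem _ gm i.+1; have := hlt i ip.
  rewrite sm (n1 _ ip) => h1 h2 h3; rewrite n1; last by lia.
  by rewrite prednK // h2; lia.
rewrite !n1 //; last by lia.
have := @min_seq_nest _ gm i.+1 l.+1; rewrite sm; have := hlt l ip; have := hlt i; lia.
Qed.

Lemma min_seq_tree m : min_seq m -> exists t, mins t = m.
Proof.
have [n] := ubnP (size m); elim: n m => // n IH [|x m] // sm gm.
  by exists Lf.
have [m1 [m2 [g1 g2 sz ->]]] := @min_seq_node_inv _ (size m) gm erefl.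
have [|t1 <-] := IH m1 _ g1; first by move: sm => /=; lia.
have [|t2 <-] := IH m2 _ g2; first by move: sm => /=; lia.
by exists (Nd t1 t2).
Qed.

(** The size of the first subtree is visible as the position of the second [0]. *)
Lemma mins_inj : injective mins.
Proof.
elim=> [|l IHl r IHr] [|l' r'] //; rewrite !minsE => e.
have sz t t' s s' : node_mins (mins t) (mins s) = node_mins (mins t') (mins s') ->
  (size (mins t') <= size (mins t))%N.
  move=> e'; rewrite leqNgt; apply/negP=> lt.
  have s0 : (0 < size (mins s))%N by have := congr1 size e'; rewrite !size_node_mins; lia.
  have : node_mins (mins t) (mins s) @ ((size (mins t)).+1 + 0) =
    node_mins (mins t') (mins s') @ (size (mins t)).+1 by rewrite e' addn0.
  by rewrite node_minsS // node_minsJ //; case: s s0 {e'}.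
have el : size (mins l) = size (mins l').
  by apply/eqP; rewrite eqn_leq (sz _ _ _ _ e) (sz _ _ _ _ (esym e)).
have er : size (mins r) = size (mins r').
  by have := congr1 size e; rewrite !size_node_mins; lia.
congr Nd.
  apply: IHl; apply: eq_nth0 => // i il.
  have : node_mins (mins l) (mins r) @ i.+1 = node_mins (mins l') (mins r') @ i.+1 by rewrite e.
  by rewrite !node_minsS -?el // => -[].
apply: IHr; apply: eq_nth0 => // i ir.
have : node_mins (mins l) (mins r) @ ((size (mins l)).+1 + i) =
  node_mins (mins l') (mins r') @ ((size (mins l')).+1 + i) by rewrite e el.
by rewrite !node_minsJ -?er // el; do 2!case: eqP; lia.
Qed.

Lemma maxs_lt t i : (i < tsize t)%N -> (maxs t @ i < tsize t)%N.
Proof.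
elim: t i => // l IHl r IHr i; rewrite maxsE tsizeE.
case/node_indexP=> [|u ul|u ur]; first by rewrite node_maxs0 size_maxs; lia.
  by rewrite node_maxsS ?size_maxs //; have := IHl _ ul; lia.
by rewrite -{1}size_maxs node_maxsJ ?size_maxs //; have := IHr _ ur; lia.
Qed.

Lemma maxs_last t : (0 < tsize t)%N -> maxs t @ (tsize t).-1 = (tsize t).-1.
Proof.
elim: t => // l IHl r IHr _; rewrite maxsE tsizeE.
case: (posnP (tsize r)) => [r0|r0].
  rewrite r0 addn0 /=; case: (posnP (tsize l)) => [l0|l0].
    by rewrite l0 node_maxs0 size_maxs.
  by rewrite -(prednK l0) node_maxsS ?size_maxs ?IHl //; lia.
have -> : (tsize l + tsize r).+1.-1 = ((size (maxs l)).+1 + (tsize r).-1)%N.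
  by rewrite size_maxs; lia.
by rewrite node_maxsJ ?IHr ?size_maxs //; lia.
Qed.

Lemma maxs_idem t i : (i < tsize t)%N -> maxs t @ (maxs t @ i) = maxs t @ i.
Proof.
elim: t i => // l IHl r IHr i; rewrite maxsE tsizeE.
(* The first [tsize l + 1] points of the complement end with a maximum. *)
have key : node_maxs (maxs l) (maxs r) @ (tsize l) = tsize l.
  case: (posnP (tsize l)) => [l0|l0]; first by rewrite l0 node_maxs0 size_maxs.
  by rewrite -{1}(prednK l0) node_maxsS ?size_maxs ?maxs_last //; lia.
case/node_indexP=> [|u ul|u ur]; first by rewrite node_maxs0 size_maxs.
  by rewrite node_maxsS ?size_maxs // node_maxsS ?size_maxs ?IHl // maxs_lt.
rewrite -!size_maxs node_maxsJ ?size_maxs // addnC -size_maxs node_maxsJ ?size_maxs ?maxs_lt //.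
by rewrite IHr // addnC.
Qed.

Lemma mins_lt t i : (i < tsize t)%N -> (mins t @ i < tsize t)%N.
Proof.
rewrite -size_mins => it; exact: leq_ltn_trans (min_seq_le (min_seq_mins t) it) it.
Qed.

Lemma mins0 t : mins t @ 0 = 0%N. Proof. by case: t. Qed.

(** [i] and [l] lie in the same block of the Kreweras complement when no block
    of the partition has points both inside and outside of the interval from [i]
    excluded to [l] included. *)
Definition sealed (m : seq nat) i l : Prop :=
  forall u, (u < size m)%N -> (i < u <= l)%N = (i < m @ u <= l)%N.

(** Along a node, no sealed interval crosses the start of the second subtree, since
    that point shares its block with the first point; intervals inside a subtree
    are sealed there, and intervals starting at the first point are the complements
    of final intervals of the first subtree. *)
Lemma maxs_sealed t i l : (i <= l)%N -> (l < tsize t)%N ->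
  (maxs t @ i = maxs t @ l) <-> sealed (mins t) i l.
Proof.
elim: t i l => // t1 IH1 t2 IH2 i l il; rewrite maxsE minsE tsizeE => ln.
have hi := leq_ltn_trans il ln.
have szk := size_maxs; have szm := size_mins.
have szc : size (node_mins (mins t1) (mins t2)) = (tsize t1 + tsize t2).+1.
  by rewrite size_node_mins !size_mins.
have c0 := node_mins0 (mins t1) (mins t2).
have cS u : (u < tsize t1)%N -> node_mins (mins t1) (mins t2) @ u.+1 = (mins t1 @ u).+1.
  by move=> ut; rewrite node_minsS ?szm.
have cJ u : (u < tsize t2)%N -> node_mins (mins t1) (mins t2) @ ((tsize t1).+1 + u) =
   if mins t2 @ u == 0%N then 0%N else (mins t2 @ u + (tsize t1).+1)%N.
  by move=> ut; rewrite -{1}szm node_minsJ ?szm.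
have k0 : node_maxs (maxs t1) (maxs t2) @ 0 = tsize t1 by rewrite node_maxs0 szk.
have kS u : (u < tsize t1)%N -> node_maxs (maxs t1) (maxs t2) @ u.+1 = (maxs t1 @ u).+1.
  by move=> ut; rewrite node_maxsS ?szk.
have kJ u : (u < tsize t2)%N -> node_maxs (maxs t1) (maxs t2) @ ((tsize t1).+1 + u) =
   (maxs t2 @ u + (tsize t1).+1)%N.
  by move=> ut; rewrite -{1}szk node_maxsJ ?szk.
rewrite /sealed szc.
(* An interval across the start of the second subtree contains that point, whose
   minimum is [0]; on the other side the maxima are separated. *)
have cross i' u : (i' <= tsize t1)%N -> (u < tsize t2)%N ->
  ((node_maxs (maxs t1) (maxs t2) @ i' = node_maxs (maxs t1) (maxs t2) @ ((tsize t1).+1 + u)) <->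
   (forall v, (v < (tsize t1 + tsize t2).+1)%N ->
      (i' < v <= (tsize t1).+1 + u)%N =
        (i' < node_mins (mins t1) (mins t2) @ v <= (tsize t1).+1 + u)%N)).
  move=> hi' u2; rewrite kJ //; split=> [e|h].
    case: i' hi' e => [|i'] hi'; rewrite ?k0 ?kS //; first by lia.
    by have := @maxs_lt t1 i' hi'; lia.
  have t20 : (0 < tsize t2)%N by lia.
  by have := h ((tsize t1).+1 + 0)%N; rewrite cJ // mins0 /=; lia.
case/node_indexP: ln il => [|u u1|u u2].
- rewrite leqn0 => /eqP ->; split=> // _ v _; lia.
- case/node_indexP: hi => [|v v1|v v2] il; last by lia.
    rewrite k0 kS //.
    have l1 : (0 < tsize t1)%N by lia.
    have e1 := maxs_last l1.
    have lu : (u <= (tsize t1).-1)%N by lia.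
    have lp : ((tsize t1).-1 < tsize t1)%N by lia.
    have [h1 h2] := IH1 u (tsize t1).-1 lu lp; rewrite e1 in h1 h2.
    split=> [e|h].
      have {}h1 : sealed (mins t1) u (tsize t1).-1 by apply: h1; lia.
      move=> w; case/node_indexP=> [|w' w1|w' w2].
      - by rewrite c0.
      - have := h1 w'; rewrite szm => /(_ w1); rewrite cS //.
        by have := mins_lt w1; lia.
      - by rewrite cJ //; case: eqP; lia.
    rewrite h2 ?prednK // => w; rewrite szm => w1.
    by have := h w.+1; rewrite cS //; have := mins_lt w1; lia.
  rewrite !kS //; have [|//|h1 h2] := IH1 v u; first by lia.
  split=> [[/h1 h] w|h].
    case/node_indexP=> [|w' w1|w' w2].
    - by rewrite c0.
    - by rewrite cS //; have := h w'; rewrite szm; lia.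
    - by rewrite cJ //; case: eqP; lia.
  congr S; apply: h2 => w; rewrite szm => w1.
  by have := h w.+1; rewrite cS //; lia.
case/node_indexP: hi => [|v v1|v v2] il.
- exact: cross.
- exact: cross.
rewrite !kJ //; have [|//|h1 h2] := IH2 v u; first by lia.
split=> [e w|h].
  have {}h1 := h1 _; case/node_indexP=> [|w' w1|w' w2].
  - by rewrite c0.
  - by rewrite cS //; have := @mins_lt t1 w' w1; lia.
  - rewrite cJ //; have := h1 _ w'; rewrite szm => h; have := h _ w2.
    by case: eqP; lia.
have h' : sealed (mins t2) v u.
  move=> w; rewrite szm => w2; have := h ((tsize t1).+1 + w)%N; rewrite cJ //.
  by case: eqP; lia.
by rewrite (h2 h').
Qed.

(** * Weighted enumeration of trees *)

HB.instance Definition _ := gen_choiceMixin tree.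

Definition node_trees (T : nat -> seq tree) (n : nat) : seq tree :=
  [seq Nd p.1 p.2 | i <- iota 0 n.+1, p <- [seq (l, r) | l <- T i, r <- T (n - i)%N]].

Lemma node_trees_ext T T' n : (forall i, (i <= n)%N -> T i = T' i) ->
  node_trees T n = node_trees T' n.
Proof.
move=> e; congr flatten; apply/eq_in_map => i; rewrite mem_iota => /andP[_ ilt].
by rewrite !e //; lia.
Qed.

(** The first argument is fuel. *)
Fixpoint trees_of (fuel n : nat) : seq tree :=
  match fuel, n with
  | f.+1, n'.+1 => node_trees (trees_of f) n'
  | _, 0 => [:: Lf]
  | 0, _ => [::]
  end.
Definition trees n := trees_of n n.

Lemma trees_ofE f g n : (n <= f)%N -> (n <= g)%N -> trees_of f n = trees_of g n.
Proof.
elim: f g n => [|f IH] [|g] [|n] // nf ng.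
by apply: node_trees_ext => i ni; apply: IH; lia.
Qed.

Lemma treesS n : trees n.+1 = node_trees trees n.
Proof. by apply: node_trees_ext => i ni; apply: trees_ofE. Qed.

Lemma mem_trees n t : (t \in trees n) = (tsize t == n).
Proof.
elim/ltn_ind: n t => -[|n] IH t; first by rewrite inE; case: t => [|l r];
  [rewrite eqxx | apply/eqP].
rewrite treesS; apply/allpairsPdep/eqP => [[i [[l r] [+ /allpairsP[[l' r'] /= [+ + [->
  ->]]] ->]]]|].
  rewrite mem_iota => /andP[_ ilt].
  by rewrite !IH /=; try lia; move=> /eqP-> /eqP->; lia.
case: t => // l r; rewrite tsizeE => -[e]; exists (tsize l), (l, r); split=> //.
  by rewrite mem_iota; lia.
apply/allpairsP; exists (l, r); by split=> //=; rewrite IH; lia.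
Qed.

Lemma uniq_trees n : uniq (trees n).
Proof.
elim/ltn_ind: n => -[|n] IH //.
rewrite treesS /node_trees.
have : forall i, i \in iota 0 n.+1 -> (i <= n)%N by move=> i; rewrite mem_iota; lia.
move: (iota 0 n.+1) (iota_uniq 0 n.+1) => s us hs.
apply: allpairs_uniq_dep => // [i /hs i_n|].
  apply: allpairs_uniq; [by apply: IH; lia | by apply: IH; lia |].
  by move=> [a b] [c d] _ _ /= [-> ->].
have ht p : p \in [seq existT (fun=> (tree * tree)%type) x y | x <- s,
    y <- [seq (l, r) | l <- trees x, r <- trees (n - x)]] -> tag p = tsize (tagged p).1.
  case/allpairsPdep=> x [y [_ /allpairsP[ab [h _ e2]] e]].
  by rewrite e /= e2 /=; move: h; rewrite mem_trees => /eqP->.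
move=> [i [l r]] [j [l' r']] /ht /= -> /ht /= -> [el er].
by rewrite el er.
Qed.

Section Weights.
Variable A : comPzRingType.
Implicit Types a b : nat -> A.

(** Blocks are indexed by the fixed points of the sequence, one for each block. *)
Definition prod_fixed (c : seq nat) (F : nat -> A) : A :=
  \prod_(0 <= i < size c | c @ i == i) F i.

Lemma prod_fixed_eq c F G : (forall i, (i < size c)%N -> c @ i = i -> F i = G i) ->
  prod_fixed c F = prod_fixed c G.
Proof.
move=> h; rewrite /prod_fixed big_nat_cond [RHS]big_nat_cond.
by apply: eq_bigr => i /andP[/andP[_ ilt] /eqP]; apply: h.
Qed.

Lemma prod_fixed_node x (c1 c2 : seq nat) (y : nat -> nat) F :
  prod_fixed (x :: [seq z.+1 | z <- c1] ++ [seq y z | z <- c2]) F =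
  (if x == 0%N then F 0%N else 1) * prod_fixed c1 (fun i => F i.+1) *
  \prod_(0 <= i < size c2 | y (c2 @ i) == ((size c1).+1 + i)%N) F ((size c1).+1 + i)%N.
Proof.
rewrite /prod_fixed /= size_cat !size_map big_mkcond big_nat_recl //=.
rewrite -mulrA; congr (_ * _).
rewrite (@big_cat_nat _ _ _ (size c1)) //=; last exact: leq_addr.
congr (_ * _).
  rewrite [RHS]big_mkcond /=; apply: eq_big_nat => i /andP[_ i1].
  by rewrite nth_cat size_map i1 (nth_map 0%N) // eqSS.
rewrite (big_addn 0 _ (size c1)) addKn [RHS]big_mkcond /=.
apply: eq_big_nat => i /andP[_ i2].
rewrite nth_cat size_map ltnNge leq_addl /= addnK (nth_map 0%N) //.
by rewrite addnC.
Qed.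

(** The product over the blocks of [a] of their size, where the block of the first
    point counts [r] more points. The empty tree gets [a r], the weight of a first
    block whose points have all been removed. *)
Fixpoint weight_mins a r t : A := if t is Nd l t' then weight_mins a 0 l * weight_mins a r.+1 t'
  else a r.
(** The same for the Kreweras complement, where the block of the last point
    counts [s] more points. If the second subtree is empty, the first point and the
    [s] extra points join the last block of the first subtree. *)
Fixpoint weight_maxs b s t : A :=
  if t is Nd l t' then
    if t' is Lf then weight_maxs b s.+1 l else weight_maxs b 1 l * weight_maxs b s t'
  else b s.

Definition prod_mins a r (m : seq nat) : A :=
  prod_fixed m (fun i => a (count_mem i m + (if i == 0%N then r else 0))%N).
Definition prod_maxs b s (k : seq nat) : A :=
  prod_fixed k (fun i => b (count_mem i k + (if i == (size k).-1 then s else 0))%N).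

Lemma prod_mins_weight a r t : a 0%N = 1 ->
  prod_mins a r (mins t) = if t is Lf then 1 else weight_mins a r t.
Proof.
move=> a0; elim: t r => [|l IHl t IHt] r; first by rewrite /prod_mins /prod_fixed big_geq.
rewrite minsE /prod_mins {1}/node_mins prod_fixed_node eqxx.
rewrite -[RHS]/(weight_mins a 0 l * weight_mins a r.+1 t).
have cl i : (i < size (mins l))%N -> count_mem i.+1 (node_mins (mins l) (mins t)) = count_mem i
  (mins l).
  move=> il; rewrite /= add0n count_cat !count_map.
  rewrite [X in (_ + X)%N](_ : _ = 0%N) ?addn0.
    by apply: eq_count => z /=; rewrite eqSS.
  apply/eqP; rewrite -leqn0 leqNgt -has_count; apply/negP => /hasP[z _ /=].
  by case: ifP => _ /eqP; lia.
have cr i : (0 < i)%N ->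
  count_mem ((size (mins l)).+1 + i)%N (node_mins (mins l) (mins t)) = count_mem i (mins t).
  move=> i0; rewrite /= add0n count_cat !count_map.
  rewrite [X in (X + _)%N](_ : _ = 0%N) ?add0n.
    by apply: eq_count => z /=; case: (eqVneq z 0%N) => [->|nz]; apply/eqP/eqP; lia.
  apply/eqP; rewrite -leqn0 leqNgt -has_count; apply/negP => /hasP[z zl /= /eqP e].
  have zs : (index z (mins l) < size (mins l))%N by rewrite index_mem.
  have := min_seq_le (min_seq_mins l) zs; rewrite nth_index //; lia.
have c0 : count_mem 0%N (node_mins (mins l) (mins t)) = (count_mem 0%N (mins t)).+1.
  rewrite /= count_cat !count_map add1n; congr S.
  rewrite [X in (X + _)%N](_ : _ = 0%N) ?add0n.
    by apply: eq_count => z /=; case: (eqVneq z 0%N) => // nz; apply/eqP/eqP; lia.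
  by apply/eqP; rewrite -leqn0 leqNgt -has_count; apply/negP => /hasP[z _ /=].
rewrite c0.
have -> : prod_fixed (mins l) (fun i => a (count_mem i.+1 (node_mins (mins l) (mins t)) +
   (if i.+1 == 0%N then r else 0))%N) = weight_mins a 0 l.
  transitivity (prod_mins a 0 (mins l)).
    by apply: prod_fixed_eq => i il _; rewrite cl //=; case: ifP.
  by rewrite IHl; case: l {IHl cl cr c0} => //=; rewrite a0.
rewrite mulrAC mulrC; congr (_ * _).
transitivity (a ((count_mem 0%N (mins t)).+1 + r)%N *
  \prod_(0 <= i < size (mins t) | (mins t @ i == i) && (i != 0)%N) a (count_mem i (mins t))).
  congr (_ * _); rewrite big_mkcond [RHS]big_mkcond; apply: eq_big_nat => i _.
  case: (eqVneq (mins t @ i) 0%N) => [e0|ne].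
    by rewrite e0; case: eqP => //; case: eqP => // <-.
  have -> : (mins t @ i + (size (mins l)).+1 == (size (mins l)).+1 + i)%N = (mins t @ i == i).
    by apply/eqP/eqP; lia.
  case: eqP => // e; have i0 : (i != 0)%N by rewrite -e.
  by rewrite i0 cr ?lt0n //= addn0.
case: t IHt {cl cr c0} => [|t1 t2] IHt.
  by rewrite /= big_geq // mulr1 ?add1n.
set t := Nd t1 t2 in IHt *; rewrite -[RHS]/(weight_mins a r.+1 t) -IHt /prod_mins /prod_fixed.
have -> : size (mins t) = (tsize t1 + tsize t2).+1 by rewrite size_mins.
rewrite big_mkcond big_nat_recl //= [RHS]big_mkcond big_nat_recl //=.
rewrite mul1r addSnnS; congr (_ * _); apply: eq_bigr => i _.
by rewrite andbT addn0.
Qed.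

Lemma prod_maxs_weight b s t : b 0%N = 1 ->
  prod_maxs b s (maxs t) = if t is Lf then 1 else weight_maxs b s t.
Proof.
move=> b0; elim: t s => [|l IHl t IHt] s; first by rewrite /prod_maxs /prod_fixed big_geq.
rewrite maxsE /prod_maxs {1}/node_maxs prod_fixed_node size_node_maxs !size_maxs succnK.
have cl i : (i < tsize l)%N -> count_mem i.+1 (node_maxs (maxs l) (maxs t)) =
    ((tsize l == i.+1) + count_mem i (maxs l))%N.
  move=> il; rewrite /= size_maxs; congr (_ + _)%N; rewrite count_cat !count_map.
  rewrite [X in (_ + X)%N](_ : _ = 0%N) ?addn0.
    by apply: eq_count => z /=; rewrite eqSS.
  by apply/eqP; rewrite -leqn0 leqNgt -has_count; apply/negP => /hasP[z _ /= /eqP]; lia.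
have cr i : count_mem ((tsize l).+1 + i)%N (node_maxs (maxs l) (maxs t)) = count_mem i (maxs t).
  rewrite /= size_maxs (_ : (tsize l == _)%N = false) ?add0n; last by lia.
  rewrite count_cat !count_map.
  rewrite [X in (X + _)%N](_ : _ = 0%N) ?add0n.
    by apply: eq_count => z /=; apply/eqP/eqP; lia.
  apply/eqP; rewrite -leqn0 leqNgt -has_count; apply/negP => /hasP[z zl /= /eqP e].
  have zs : (index z (maxs l) < tsize l)%N by rewrite -size_maxs index_mem.
  by have := maxs_lt zs; rewrite nth_index //; lia.
have c0 : tsize l = 0%N -> count_mem 0%N (node_maxs (maxs l) (maxs t)) = 1%N.
  case: l {IHl cl cr} => // _; rewrite /= count_map -[RHS]addn0; congr (_ + _)%N.
  by apply/eqP; rewrite -leqn0 leqNgt -has_count; apply/negP => /hasP[z _ /= /eqP]; lia.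
set G := (X in X * \prod_(0 <= i < _ | _) _).
have -> : G = weight_maxs b (if tsize t == 0%N then s else 0%N).+1 l.
  rewrite {}/G; case: (posnP (tsize l)) => [l0|l0].
    case: l l0 c0 {IHl cl cr} => // _ c0.
    rewrite c0 // /prod_fixed big_geq // mulr1 add0n eq_sym add1n.
    by [].
  rewrite mul1r.
  transitivity (prod_maxs b (if tsize t == 0%N then s else 0%N).+1 (maxs l)).
    apply: prod_fixed_eq => i; rewrite size_maxs => il _; rewrite cl //; congr b.
    case: (eqVneq (tsize l) i.+1) => [->|ne].
      rewrite /= eqxx -{1}[i.+1]addn0 eqn_add2l eq_sym; case: ifP => _; lia.
    have -> : (i.+1 == tsize l + tsize t)%N = false by lia.
    by have -> : (i == (tsize l).-1)%N = false by lia.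
  by rewrite IHl; case: l l0 {IHl cl cr c0}.
case: t IHt {G cl c0} cr => [|t1 t2] IHt cr; first by rewrite big_geq ?mulr1.
set t := Nd t1 t2 in IHt cr *; rewrite -[RHS]/(weight_maxs b 1 l * weight_maxs b s t) -IHt
  /prod_maxs /prod_fixed.
congr (_ * _); rewrite size_maxs big_mkcond [RHS]big_mkcond; apply: eq_big_nat => i _.
have -> : (maxs t @ i + (tsize l).+1 == (tsize l).+1 + i)%N = (maxs t @ i == i).
  by apply/eqP/eqP; lia.
case: eqP => // e; rewrite cr; congr (b (_ + _)).
have t0 : (0 < tsize t)%N by [].
by have -> : ((tsize l).+1 + i == tsize l + tsize t)%N = (i == (tsize t).-1)%N by apply/eqP/eqP;
  lia.
Qed.

(** The shifts [r] and [s] of the sizes of the first block and of the last block of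
    the complement make the recursion close up. *)
Definition ncsum a b r s : ps A := fun n => \sum_(t <- trees n) weight_mins a r t * weight_maxs
  b s t.

Lemma ncsum0 a b r s : ncsum a b r s 0%N = a r * b s.
Proof. by rewrite /ncsum big_seq1. Qed.

(** The last term is the case of an empty second subtree, where the last block of
    the complement extends that of the first subtree. *)
Lemma ncsum_S a b r s n : b 0%N = 1 -> ncsum a b r s n.+1 =
  \sum_(i < n) ncsum a b 0 1 i * ncsum a b r.+1 s (n - i)%N + a r.+1 * ncsum a b 0 s.+1 n.
Proof.
move=> b0; rewrite /ncsum treesS /node_trees big_allpairs_dep.
rewrite -[iota 0 n.+1]/(index_iota 0 n.+1) big_nat_recr //= big_mkord.
congr (_ + _).
  apply: eq_bigr => i _; rewrite big_allpairs /= big_distrlr /=.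
  apply: eq_big_seq => l _; apply: eq_big_seq => t; rewrite mem_trees => tn.
  case: t tn => [|t1 t2] /= tn; first by have := ltn_ord i; lia.
  by rewrite mulrACA.
rewrite big_allpairs subnn /= big_distrr /=; apply: eq_bigr => l _.
by rewrite big_seq1 /=; ring.
Qed.

End Weights.

(** * From set partitions to trees *)

Section Parts.
Variable n : nat.
Implicit Types (P Q : {set {set 'I_n}}) (c : seq nat).

Definition fibre c (v : nat) : {set 'I_n} := [set j : 'I_n | c @ j == v].
Definition fibre_partition c : {set {set 'I_n}} := [set fibre c (c @ i) | i : 'I_n].

Lemma fibre_partitionP c : partition (fibre_partition c) [set: 'I_n].
Proof.
apply/and3P; split.
- apply/eqP/setP=> j; rewrite inE; apply/bigcupP; exists (fibre c (c @ j)).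
    by apply: imset_f.
  by rewrite inE.
- apply/trivIsetP=> B C /imsetP[i _ ->] /imsetP[j _ ->] ne.
  apply/pred0P=> x /=; rewrite !inE; apply: contraNF ne => /andP[/eqP<- /eqP<-] //.
apply/imsetP=> -[i _ e]; have : i \in fibre c (c @ i) by rewrite inE.
by rewrite -e inE.
Qed.

Lemma card_fibre c v : size c = n -> #|fibre c v| = count_mem v c.
Proof.
move=> sc; rewrite -sum1_card -sum1_count (big_nth 0%N) sc big_mkord.
by apply: eq_bigl => i; rewrite inE.
Qed.

Record retract c : Prop := Retract {
  retract_size : size c = n;
  retract_lt : forall i, (i < n)%N -> (c @ i < n)%N;
  retractK : forall i, (i < n)%N -> c @ (c @ i) = c @ i
}.

Lemma prod_fibre_partition (A : comPzRingType) c (F : nat -> A) : retract c ->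
  \prod_(V in fibre_partition c) F #|V| = prod_fixed c (fun i => F (count_mem i c)).
Proof.
case=> sc lc ic.
have -> : fibre_partition c = [set fibre c i | i : 'I_n in [set i : 'I_n | c @ i == i]].
  apply/setP=> V; apply/imsetP/imsetP => [[i _ ->]|[i ii ->]].
    exists (Ordinal (lc _ (ltn_ord i))) => //.
    by rewrite inE /= ic.
  by exists i => //; move: ii; rewrite inE => /eqP ->.
rewrite big_imset /=; last first.
  move=> i j; rewrite !inE => /eqP ii /eqP jj e; apply/val_inj => /=.
  have : i \in fibre c i by rewrite inE ii.
  by rewrite e inE => /eqP <-.
rewrite /prod_fixed sc big_mkord; apply: eq_big => [i|i _]; first by rewrite inE.
by rewrite card_fibre.
Qed.

Lemma fibre_partition_same c B (i j : 'I_n) : B \in fibre_partition c -> i \in B -> j \in B ->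
  c @ i = c @ j.
Proof. by case/imsetP=> x _ ->; rewrite !inE => /eqP-> /eqP->. Qed.

Lemma mem_fibre_partition c (i : 'I_n) : fibre c (c @ i) \in fibre_partition c.
Proof. exact: imset_f. Qed.

Lemma noncrossingP P : reflect
  (forall V W (a b c d : 'I_n), V \in P -> W \in P -> a \in V -> b \in W -> c \in V -> d \in W ->
    (a < b)%N -> (b < c)%N -> (c < d)%N -> V = W)
  (noncrossing P).
Proof.
apply: (iffP forall_inP) => [h V W a b c d VP WP aV bW cV dW ab bc cd|h V VP].
  apply/eqP; move/(_ V VP): h => /forall_inP/(_ W WP)/implyP; apply.
  apply/exists_inP; exists a => //; apply/exists_inP; exists b => //.
  apply/exists_inP; exists c => //; apply/exists_inP; exists d => //.
  by rewrite ab bc cd.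
apply/forall_inP=> W WP; apply/implyP.
case/exists_inP=> a aV /exists_inP[b bW /exists_inP[c cV /exists_inP[d dW]]].
by case/and3P=> ab bc cd; apply/eqP; apply: (h V W a b c d).
Qed.

(** For a crossing [i < j < k < l], nestedness applied to [j < k] and to [k < l]
    forces the two minima to coincide. *)
Lemma min_seq_noncrossing c : size c = n -> min_seq c -> noncrossing (fibre_partition c).
Proof.
move=> sc gc; apply/noncrossingP=> V W i j k l VP WP iV jW kV lW ij jk kl.
have e1 := fibre_partition_same VP iV kV; have e2 := fibre_partition_same WP jW lW.
have e3 : c @ k = c @ j.
  have := @min_seq_nest _ gc j k jk; have := @min_seq_nest _ gc k l kl.
  have := @min_seq_le _ gc i; have := @min_seq_le _ gc j.
  rewrite sc -e1 -e2 !ltn_ord; lia.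
case/imsetP: VP iV kV => x _ -> ; rewrite !inE => _ /eqP e4.
case/imsetP: WP jW lW => y _ -> ; rewrite !inE => /eqP e5 _.
by rewrite -e4 -e5 e3.
Qed.

Lemma retract_mins t : tsize t = n -> retract (mins t).
Proof.
move=> tn; split; first by rewrite size_mins.
  by move=> i; rewrite -tn; apply: mins_lt.
by move=> i; rewrite -tn -size_mins; apply: min_seq_idem (min_seq_mins t) _.
Qed.
Lemma retract_maxs t : tsize t = n -> retract (maxs t).
Proof.
move=> tn; split; first by rewrite size_maxs.
  by move=> i; rewrite -tn; apply: maxs_lt.
by move=> i; rewrite -tn; apply: maxs_idem.
Qed.

Lemma mins_NC t : tsize t = n -> fibre_partition (mins t) \in NC n.
Proof.
move=> tn; rewrite inE fibre_partitionP min_seq_noncrossing ?size_mins //.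
exact: min_seq_mins.
Qed.

(** Every point lies above the minimum of its block, which is determined by the
    partition. *)
Lemma fibre_partition_inj c c' : size c = n -> size c' = n -> min_seq c -> min_seq c' ->
  fibre_partition c = fibre_partition c' -> c = c'.
Proof.
move=> sc sc' gc gc' e.
suff h c1 c2 : size c1 = n -> size c2 = n -> min_seq c1 -> min_seq c2 ->
  fibre_partition c1 = fibre_partition c2 ->
    forall i : 'I_n, (c1 @ i <= c2 @ i)%N.
  apply: eq_nth0 => [|i]; first by rewrite sc.
  rewrite sc => ilt; apply/eqP; rewrite eqn_leq.
  by rewrite (h c c' _ _ _ _ _ (Ordinal ilt)) // (h c' c _ _ _ _ _ (Ordinal ilt)).
move=> s1 s2 g1 g2 e12 i.
have lt2 : (c2 @ i < n)%N.
  by apply: leq_ltn_trans (ltn_ord i); apply: (min_seq_le g2); rewrite s2.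
pose m := Ordinal lt2.
have iV : i \in fibre c2 (c2 @ i) by rewrite inE.
have mV : m \in fibre c2 (c2 @ i) by rewrite inE /= (min_seq_idem g2) ?s2.
have VP : fibre c2 (c2 @ i) \in fibre_partition c1 by rewrite e12 mem_fibre_partition.
by rewrite (fibre_partition_same VP iV mV); apply: (min_seq_le g1); rewrite s1.
Qed.

(** The sequence of block minima of a non-crossing partition is nested: a block
    whose minimum lies strictly between [m(i)] and [i] cannot contain a point
    beyond [i]. *)
Lemma NC_tree P : P \in NC n -> exists2 t, tsize t = n & P = fibre_partition (mins t).
Proof.
rewrite inE => /andP[pP /noncrossingP ncP].
have tP : trivIset P by case/and3P: pP.
have covP : cover P = setT by case/and3P: pP => /eqP.
have n0P : set0 \notin P by case/and3P: pP.
have memb (i : 'I_n) : i \in pblock P i by rewrite mem_pblock covP inE.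
have pbP (i : 'I_n) : pblock P i \in P by rewrite pblock_mem // covP inE.
pose f (i : 'I_n) : 'I_n := [arg min_(l < i | l \in pblock P i) val l].
have fP (i : 'I_n) : f i \in pblock P i /\ forall l, l \in pblock P i -> (f i <= l)%N.
  by rewrite /f; case: arg_minnP => [|l lP h]; rewrite ?memb.
have same (i l : 'I_n) : l \in pblock P i -> pblock P l = pblock P i.
  by move=> li; apply: same_pblock.
have fsame (i l : 'I_n) : l \in pblock P i -> f l = f i.
  move=> li; apply/val_inj/eqP; rewrite /= eqn_leq.
  have [h1 h2] := fP i; have [h3 h4] := fP l.
  by rewrite h4 ?h2 ?(same _ _ li) // -(same _ _ li).
pose c := [seq val (f i) | i <- enum 'I_n].
have sc : size c = n by rewrite size_map size_enum_ord.
have cE (i : 'I_n) : c @ i = f i.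
  by rewrite (nth_map i) ?size_enum_ord // nth_ord_enum.
have gc : min_seq c.
  split; rewrite sc.
  - by move=> i ilt; rewrite (cE (Ordinal ilt));
    exact: (proj2 (fP (Ordinal ilt)) (Ordinal ilt) (memb _)).
  - move=> i ilt; rewrite (cE (Ordinal ilt)) cE; congr (val _).
    by apply: fsame; case: (fP (Ordinal ilt)).
  move=> i l il llt; have ilt := ltn_trans il llt.
  rewrite (cE (Ordinal ilt)) (cE (Ordinal llt)).
  set i' := Ordinal ilt; set l' := Ordinal llt => h.
  rewrite leqNgt; apply/negP => lt.
  have [e|ne] := eqVneq (f l') i'.
    have := fsame l' i'; rewrite -{1}e (fP l').1 => /(_ isT) e2.
    by rewrite e2 ltnn in lt.
  have lt2 : (f l' < i')%N by rewrite ltn_neqAle h andbT.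
  have e : pblock P i' = pblock P l'.
    apply: (ncP _ _ (f i') (f l') i' l') => //; [exact: (fP i').1 | exact: (fP l').1].
  have : i' \in pblock P l' by rewrite -e memb.
  by move/fsame => e2; rewrite e2 ltnn in lt.
have [t tc] := min_seq_tree gc; exists t; first by rewrite -size_mins tc.
rewrite tc; apply/setP=> B; apply/idP/imsetP => [BP|[i _ ->]].
  have [i iB] : exists i, i \in B by apply/set0Pn; apply: contraNneq n0P => <-.
  exists i => //; have Bi : B = pblock P i by rewrite (def_pblock tP BP iB).
  apply/setP=> j; rewrite inE !cE val_eqE Bi; apply/idP/eqP => [/fsame //|e].
  have := (fP i).1; rewrite -e => h; rewrite -(same _ _ h).
  have := (fP j).1 => h2; by rewrite (same _ _ h2).
suff -> : fibre c (c @ i) = pblock P i by apply: pbP.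
apply/setP=> j; rewrite inE !cE val_eqE; apply/eqP/idP => [e|/fsame //].
have := (fP i).1; rewrite -e => h; rewrite -(same _ _ h).
have := (fP j).1 => h2; by rewrite (same _ _ h2).
Qed.

Lemma partition_refines_anti P Q : partition P [set: 'I_n] -> partition Q [set: 'I_n] ->
  refines P Q -> refines Q P -> P = Q.
Proof.
suff h P1 Q1 : partition P1 [set: 'I_n] -> partition Q1 [set: 'I_n] ->
    refines P1 Q1 -> refines Q1 P1 -> P1 \subset Q1.
  by move=> pP pQ PQ QP; apply/eqP; rewrite eqEsubset !h.
move=> pP pQ /forall_inP PQ /forall_inP QP; apply/subsetP=> B BP.
have tP : trivIset P1 by case/and3P: pP.
have n0P : set0 \notin P1 by case/and3P: pP.
have [i iB] : exists i, i \in B by apply/set0Pn; apply: contraNneq n0P => <-.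
have /exists_inP[C CQ BC] := PQ B BP.
have /exists_inP[B' BP' CB] := QP C CQ.
have e : B = B'.
  have iB' : i \in B' by apply: (subsetP CB); apply: (subsetP BC).
  by rewrite -(def_pblock tP BP iB) (def_pblock tP BP' iB').
have -> : B = C by apply/eqP; rewrite eqEsubset BC e.
exact: CQ.
Qed.

End Parts.

Lemma even_lt_odd n (i j : 'I_n) : (even_ord i < odd_ord j)%N = (i <= j)%N.
Proof. by rewrite /= ltnS leq_double. Qed.
Lemma odd_lt_even n (i j : 'I_n) : (odd_ord i < even_ord j)%N = (i < j)%N.
Proof. by rewrite /= ltn_Sdouble. Qed.
Lemma even_lt_even n (i j : 'I_n) : (even_ord i < even_ord j)%N = (i < j)%N.
Proof. by rewrite /= ltn_double. Qed.
Lemma odd_lt_odd n (i j : 'I_n) : (odd_ord i < odd_ord j)%N = (i < j)%N.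
Proof. by rewrite /= ltnS ltn_double. Qed.

Section Kreweras.
Variable n : nat.
Variable t : tree.
Hypothesis tn : tsize t = n.
Let m := mins t.
Let k := maxs t.

Lemma maxs_sealedP (i l : 'I_n) : (i <= l)%N -> (k @ i = k @ l) <-> sealed m i l.
Proof. by move=> il; apply: maxs_sealed => //; rewrite tn. Qed.

Lemma mins_ltn u : (u < n)%N -> (m @ u < n)%N.
Proof. by rewrite -tn; apply: mins_lt. Qed.
Lemma mins_leq u : (u < n)%N -> (m @ u <= u)%N.
Proof. by move=> un; apply: (min_seq_le (min_seq_mins t)); rewrite size_mins tn. Qed.
Lemma mins_retract u : (u < n)%N -> m @ (m @ u) = m @ u.
Proof. by move=> un; apply: (min_seq_idem (min_seq_mins t)); rewrite size_mins tn. Qed.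

Lemma maxs_sealed_mins (i l : 'I_n) : (i <= l)%N -> k @ i = k @ l ->
  forall u, (u < n)%N -> (i < u <= l)%N = (i < m @ u <= l)%N.
Proof. by move=> il /(maxs_sealedP il) h u un; apply: h; rewrite size_mins tn. Qed.

Lemma maxs_NC : fibre_partition n k \in NC n.
Proof.
rewrite inE fibre_partitionP /=.
apply/noncrossingP=> V W a b c d VP WP aV bW cV dW ab bc cd.
have e1 := maxs_sealed_mins (ltnW (ltn_trans ab bc)) (fibre_partition_same VP aV cV).
have e2 := maxs_sealed_mins (ltnW (ltn_trans bc cd)) (fibre_partition_same WP bW dW).
have e3 : k @ b = k @ c.
  apply/(maxs_sealedP (ltnW bc)) => u; rewrite size_mins tn => un.
  by have := e1 _ un; have := e2 _ un; lia.
case/imsetP: VP aV cV => x _ -> ; rewrite !inE => _ /eqP e4.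
case/imsetP: WP bW dW => y _ -> ; rewrite !inE => /eqP e5 _.
by rewrite -e4 -e5 e3.
Qed.

Lemma interleave_noncrossing : noncrossing
  (interleave (fibre_partition n m) (fibre_partition n k)).
Proof.
apply/noncrossingP=> V W a b c d; rewrite !inE.
have ncm : noncrossing (fibre_partition n m) by have := mins_NC tn; rewrite inE => /andP[].
have nck : noncrossing (fibre_partition n k) by have := maxs_NC; rewrite inE => /andP[].
case/orP=> /imsetP[V' VP ->]; case/orP=> /imsetP[W' WP ->];
  move=> /imsetP[a' aV ->] /imsetP[b' bW ->] /imsetP[c' cV ->] /imsetP[d' dW ->];
  rewrite ?(even_lt_odd, odd_lt_even, even_lt_even, odd_lt_odd) => ab bc cd.
- have -> // : V' = W' by move/noncrossingP: ncm => h; apply: (h _ _ a' b' c' d').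
- have bd : (b' <= d')%N by apply: leq_trans (ltnW bc) cd.
  have := maxs_sealed_mins bd (fibre_partition_same WP bW dW) (ltn_ord a').
  have := maxs_sealed_mins bd (fibre_partition_same WP bW dW) (ltn_ord c').
  by rewrite (fibre_partition_same VP aV cV) => <-; rewrite bc cd ltnNge ab.
- have ac : (a' <= c')%N by apply: leq_trans (ltnW ab) bc.
  have := maxs_sealed_mins ac (fibre_partition_same VP aV cV) (ltn_ord b').
  have := maxs_sealed_mins ac (fibre_partition_same VP aV cV) (ltn_ord d').
  rewrite (fibre_partition_same WP bW dW) => <-.
  by rewrite ab bc (leqNgt d') cd andbF.
have -> // : V' = W' by move/noncrossingP: nck => h; apply: (h _ _ a' b' c' d').
Qed.

(** If [x < y] lie in the same block of [Q] and a block of the partition has a point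
    inside and its minimum outside of the interval between them, these four points
    cross; likewise if the minimum is inside and the point outside. *)
Lemma interleave_refines Q : Q \in NC n -> noncrossing (interleave (fibre_partition n m) Q) ->
  refines Q (fibre_partition n k).
Proof.
rewrite inE => /andP[pQ _] /noncrossingP nc; apply/forall_inP=> B BQ.
have n0Q : set0 \notin Q by case/and3P: pQ.
have [i iB] : exists i, i \in B by apply/set0Pn; apply: contraNneq n0Q => <-.
have key (x y : 'I_n) : x \in B -> y \in B -> (x <= y)%N -> k @ x = k @ y.
  move=> xB yB xy; apply/(maxs_sealedP xy) => u; rewrite size_mins tn => un.
  pose u1 := Ordinal un; pose u2 := Ordinal (mins_ltn un).
  have VP := mem_fibre_partition m u1.
  have u1V : u1 \in fibre n m (m @ u1) by rewrite inE.
  have u2V : u2 \in fibre n m (m @ u1) by rewrite inE /= mins_retract.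
  set V := fibre n m (m @ u1) in VP u1V u2V.
  have VI : (@even_ord n) @: V \in interleave (fibre_partition n m) Q by rewrite inE imset_f.
  have BI : (@odd_ord n) @: B \in interleave (fibre_partition n m) Q by rewrite inE orbC imset_f.
  have ne : (@even_ord n) @: V <> (@odd_ord n) @: B.
    move=> e; have : even_ord u1 \in (@odd_ord n) @: B by rewrite -e imset_f.
    by case/imsetP=> z _ /(congr1 (odd \o val)) /=; rewrite !odd_double.
  have mu := mins_leq un.
  case: (boolP (x < u <= y)%N) => hu; case: (boolP (x < m @ u <= y)%N) => hm //.
    have [xu uy] := andP hu.
    have ux : (m @ u <= x)%N by move: hm; rewrite (leq_trans mu uy) andbT -leqNgt.
    case: ne; apply: (nc _ _ (even_ord u2) (odd_ord x) (even_ord u1) (odd_ord y));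
      by rewrite ?imset_f ?even_lt_odd ?odd_lt_even.
  have [xm my] := andP hm.
  have yu : (y < u)%N by move: hu; rewrite (leq_trans xm mu) /= -ltnNge.
  case: ne; apply/esym.
  apply: (nc _ _ (odd_ord x) (even_ord u2) (odd_ord y) (even_ord u1));
    by rewrite ?imset_f ?even_lt_odd ?odd_lt_even.
apply/exists_inP; exists (fibre n k (k @ i)); first exact: mem_fibre_partition.
apply/subsetP=> j jB; rewrite inE; apply/eqP.
by case: (leqP i j) => ij; [apply/esym; apply: key | apply: key => //; apply: ltnW].
Qed.

(** The partition of the maxima is the largest one allowed, and two partitions
    refining each other are equal. *)
Lemma kreweras_mins : kreweras (fibre_partition n m) = fibre_partition n k.
Proof.
rewrite /kreweras; case: pickP => [Q
  /and3P[QNC Qnc /forall_inP Qmax]|/(_ (fibre_partition n k))] /=.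
  apply: partition_refines_anti.
  - by move: QNC; rewrite inE => /andP[].
  - exact: fibre_partitionP.
  - exact: interleave_refines.
  by have := Qmax _ maxs_NC; rewrite interleave_noncrossing.
move/negP; case; apply/and3P; split.
- exact: maxs_NC.
- exact: interleave_noncrossing.
by apply/forall_inP=> Q QNC; apply/implyP => Qnc; apply: interleave_refines.
Qed.

End Kreweras.

Lemma sum_NC (A : comPzRingType) n (F : {set {set 'I_n}} -> A) :
  \sum_(P in NC n) F P = \sum_(t <- trees n) F (fibre_partition n (mins t)).
Proof.
rewrite -[RHS](big_map (fun t => fibre_partition n (mins t)) xpredT F) -big_enum /=.
apply: perm_big; apply: uniq_perm; first exact: enum_uniq.
  rewrite map_inj_in_uniq ?uniq_trees // => t t'; rewrite !mem_trees => /eqP tn /eqP tn' e.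
  apply: mins_inj; apply: fibre_partition_inj e; rewrite ?size_mins //; exact: min_seq_mins.
move=> P; rewrite mem_enum; apply/idP/mapP => [/NC_tree[t tn ->]|[t]].
  by exists t => //; rewrite mem_trees tn.
by rewrite mem_trees => /eqP tn ->; apply: mins_NC.
Qed.

Section NCsums.
Variable A : comPzRingType.

Definition cons1 (a : seqP A) : nat -> A := fun k => if k is k'.+1 then a k' else 1.

Lemma prod_cons1 n (a : seqP A) (P : {set {set 'I_n}}) : partition P [set: 'I_n] ->
  \prod_(V in P) ent a #|V| = \prod_(V in P) cons1 a #|V|.
Proof.
case/and3P=> _ _ n0P; apply: eq_bigr => V VP.
have : #|V| != 0%N by rewrite cards_eq0; apply: contraNneq n0P => <-.
by case: #|V|.
Qed.

Lemma boxtimesNS_ncsum (a b : seqP A) n :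
  boxtimesNS_seq a b n = ncsum (cons1 a) (cons1 b) 0 0 n.+1.
Proof.
rewrite /boxtimesNS_seq /Defs.mkseqP sum_NC /ncsum.
apply: eq_big_seq => t; rewrite mem_trees => /eqP tn; rewrite kreweras_mins //.
rewrite !prod_cons1 ?fibre_partitionP // !prod_fibre_partition;
  [|exact: retract_maxs|exact: retract_mins].
have := @prod_mins_weight _ (cons1 a) 0 t erefl; have := @prod_maxs_weight _ (cons1 b) 0 t erefl.
case: t tn => // l r _ <- <-; congr (_ * _).
  by apply: prod_fixed_eq => i _ _; case: ifP; rewrite addn0.
by apply: prod_fixed_eq => i _ _; case: ifP; rewrite addn0.
Qed.

Lemma moments_ncsum (a : seqP A) n :
  moments_of_cumulants a n = ncsum (cons1 a) (fun=> 1) 0 0 n.+1.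
Proof.
rewrite /moments_of_cumulants /Defs.mkseqP sum_NC /ncsum.
apply: eq_big_seq => t; rewrite mem_trees => /eqP tn.
rewrite !prod_cons1 ?fibre_partitionP // !prod_fibre_partition; last exact: retract_mins.
have pm : prod_maxs (fun=> 1 : A) 0 (maxs t) = 1 by rewrite /prod_maxs /prod_fixed big1.
have := @prod_mins_weight _ (cons1 a) 0 t erefl; have := @prod_maxs_weight A (fun=> 1) 0 t erefl.
rewrite pm; case: t tn {pm} => // l r _ <- <-; rewrite mulr1.
by apply: prod_fixed_eq => i _ _; case: ifP; rewrite addn0.
Qed.

End NCsums.

(** * Functional equations and compositional inverses *)

Section NCSystem.
Variables (A : comPzRingType) (a b : ps A).
Hypotheses (a0 : a 0%N = 1) (b0 : b 0%N = 1).
Let N r s : ps A := ncsum a b r s.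
Let X := psX A.
Let p := X * N 0 1.
Let sh (f : ps A) r : ps A := fun k => f (k + r)%N.
Let q := X * psComp (ps_tl a) p.

Lemma ncsum_shiftS f r : ps_tl (sh f r) = sh f r.+1.
Proof. by apply/funext=> k; rewrite /ps_tl /sh addSnnS. Qed.
Lemma ncsum_shift0 f : sh f 0 = f.
Proof. by apply/funext=> k; rewrite /sh addn0. Qed.

(** The recursion on trees as an identity of series; [p] is [z] times the sum where
    the last block of the complement is enlarged by one. *)
Lemma ncsum_rec r s : N r s = psC (a r * b s) + p * N r.+1 s - psC (a r.+1 * b s) * p
  + X * psC (a r.+1) * N 0 s.+1.
Proof.
have -> : psC (a r * b s) + p * N r.+1 s - psC (a r.+1 * b s) * p + X * psC (a r.+1) * N 0 s.+1 =
  psC (a r * b s) + X * (N 0 1 * N r.+1 s - psC (a r.+1 * b s) * N 0 1 + psC (a r.+1) * N 0 s.+1).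
  by rewrite /p; ring.
apply/funext=> -[|n]; rewrite psD psXM psCE /= ?addr0.
  by rewrite /N ncsum0.
rewrite add0r /N ncsum_S // psD psB !psCM psM big_ord_recr /= subnn ncsum0.
by rewrite [_ * ncsum a b 0 1 n]mulrC addrK.
Qed.

Lemma ncsum_p0 : p 0%N = 0. Proof. by rewrite /p psXM. Qed.
Lemma ncsum_q0 : q 0%N = 0. Proof. by rewrite /q psXM. Qed.

(** Solving the recursion in [r] for fixed [s] leaves a recursion in [s] alone. *)
Lemma ncsum_left s : N 0 s = psC (b s) + q * N 0 s.+1.
Proof.
have h r : N r s - (psC (b s) * psComp (sh a r) p - psC (b s) * p * psComp (sh a r.+1) p
   + X * psComp (sh a r.+1) p * N 0 s.+1) = 0.
  apply: (contraction_zero (g := p) (t := S) (D := fun r => N r s -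
   (psC (b s) * psComp (sh a r) p - psC (b s) * p * psComp (sh a r.+1) p
   + X * psComp (sh a r.+1) p * N 0 s.+1)) ncsum_p0) => {}r.
  rewrite {1}ncsum_rec (ps_comp_head (sh a r) ncsum_p0) ncsum_shiftS
    (ps_comp_head (sh a r.+1) ncsum_p0) ncsum_shiftS.
  have -> : psC (a r * b s) = psC (a r) * psC (b s).
    by apply/funext=> n; rewrite psCM !psCE mulrnAr.
  have -> : psC (a r.+1 * b s) = psC (a r.+1) * psC (b s).
    by apply/funext=> n; rewrite psCM !psCE mulrnAr.
  by rewrite /sh !add0n; ring.
move/eqP: (h 0%N); rewrite subr_eq0 => /eqP ->.
rewrite ncsum_shift0 -ncsum_shiftS ncsum_shift0 (ps_comp_head a ncsum_p0) a0 psC1 /q.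
by rewrite -/X; ring.
Qed.

Lemma ncsum_right : N 0 0 = psComp b q.
Proof.
have h s : N 0 s - psComp (sh b s) q = 0.
  apply: (contraction_zero (g := q) (t := S) (D :=
    fun s => N 0 s - psComp (sh b s) q) ncsum_q0) => {}s.
  by rewrite ncsum_left (ps_comp_head (sh b s) ncsum_q0) ncsum_shiftS /sh add0n; ring.
by move/eqP: (h 0%N); rewrite subr_eq0 ncsum_shift0 => /eqP.
Qed.

Lemma ncsum_up : N 0 0 = psComp a p.
Proof.
have h r : N r 0 - psComp (sh a r) p = 0.
  apply: (contraction_zero (g := p) (t := S) (D :=
    fun r => N r 0 - psComp (sh a r) p) ncsum_p0) => {}r.
  rewrite {1}ncsum_rec (ps_comp_head (sh a r) ncsum_p0) ncsum_shiftS /sh add0n b0 !mulr1 /p -/X.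
  by ring.
by move/eqP: (h 0%N); rewrite subr_eq0 ncsum_shift0 => /eqP.
Qed.

Lemma ncsum_system : exists p q : ps A, [/\ p 0%N = 0, q 0%N = 0,
  ncsum a b 0 0 = psComp a p, ncsum a b 0 0 = psComp b q &
  p * q = psX A * (ncsum a b 0 0 - 1)] /\ p = psX A * ncsum a b 0 1 /\
  ncsum a b 0 1 = psComp (ps_tl b) q.
Proof.
exists p, q; split; [split | split].
- exact: ncsum_p0.
- exact: ncsum_q0.
- exact: ncsum_up.
- exact: ncsum_right.
- by rewrite -/(N 0 0) ncsum_up (ps_comp_head a ncsum_p0) a0 psC1 /q -/X; ring.
- by [].
have h s : N 0 s - psComp (sh b s) q = 0.
  apply: (contraction_zero (g := q) (t := S) (D :=
    fun s => N 0 s - psComp (sh b s) q) ncsum_q0) => {}s.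
  by rewrite ncsum_left (ps_comp_head (sh b s) ncsum_q0) ncsum_shiftS /sh add0n; ring.
by move/eqP: (h 1%N); rewrite subr_eq0 -ncsum_shiftS ncsum_shift0 => /eqP.
Qed.

End NCSystem.

Section CompInverse.
Variable A : comPzRingType.
Implicit Types f g h u d : ps A.
Local Notation X := (psX A).

Lemma vanish_expB m f g i : vanish_below m (f - g) -> vanish_below m (f ^+ i - g ^+ i).
Proof. by move=> dv; rewrite subrXX; apply: vanishM. Qed.

Lemma vanish_compB m u f g : f 0%N = 0 -> g 0%N = 0 -> vanish_below m (f - g) ->
  vanish_below m (psComp u f - psComp u g).
Proof.
move=> f0 g0 dv i im; rewrite psB /psComp /ps_comp -sumrB big1 // => j _.
by rewrite !ps_expE -mulrBr -psB (vanish_expB j dv) // mulr0.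
Qed.

Definition tangent (x : nat -> A) : ps A :=
  fun n => match n with 0 => 0 | 1 => 1 | m.+2 => x m end.

(** The equation [f(g(z)) = z] is unitriangular in the coefficients of [g]. *)
Lemma right_inverse f : f 0%N = 0 -> f 1%N = 1 ->
  exists g, [/\ g 0%N = 0, g 1%N = 1 & psComp f g = X].
Proof.
move=> f0 f1; pose T (x : nat -> A) : nat -> A := fun n => psComp f (tangent x) n.+2.
have [S ST TS] : bijective T.
  apply: (@triangular_bij _ (fun=> 1) (fun=> 1)) => [n|n x y exy]; first exact: mulr1.
  have gx0 : tangent x 0%N = 0 by []. have gy0 : tangent y 0%N = 0 by [].
  have dv : vanish_below n.+2 (tangent x - tangent y).
    by move=> [|[|i]] im; rewrite psB /= ?subrr // exy ?subrr.
  rewrite /T !(ps_comp_head f) // f0 psC0 !add0r -psB.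
  set cx := psComp _ (tangent x); set cy := psComp _ (tangent y).
  have -> : tangent x * cx - tangent y * cy =
    (tangent x - tangent y) * cx + (cx - cy) * tangent y by ring.
  rewrite psD !vanish_lead //; last exact: vanish_compB.
  by rewrite mulr0 addr0 /cx ps_comp0 /ps_tl f1 mulr1 mul1r psB.
exists (tangent (S (fun=> 0))); split=> //; apply/funext=> -[|[|n]].
- by rewrite ps_comp0 f0.
- by rewrite ps_comp_head // f0 psC0 add0r psM !big_ord_recl big_ord0 /= ps_comp0 /ps_tl f1
  mul0r add0r addr0 mulr1.
exact: (congr1 (@^~ n) (TS (fun=> 0))).
Qed.

(** The right inverse of a right inverse is [f] itself. *)
Lemma two_sided_inverse f : f 0%N = 0 -> f 1%N = 1 ->
  exists g, [/\ g 0%N = 0, g 1%N = 1, psComp f g = X & psComp g f = X].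
Proof.
move=> f0 f1; have [g [g0 g1 fg]] := right_inverse f0 f1.
exists g; split=> //; have [h [h0 h1 gh]] := right_inverse g0 g1.
suff -> : f = h by [].
by rewrite -(ps_comp_gX f) -gh -ps_compA // fg ps_compXg.
Qed.

Lemma inverse_uniq f g h : f 0%N = 0 -> g 0%N = 0 -> h 0%N = 0 ->
  psComp g f = X -> psComp f h = X -> g = h.
Proof.
by move=> f0 g0 h0 gf fh; rewrite -(ps_comp_gX g) -fh -ps_compA // gf ps_compXg.
Qed.

Definition gp_series (f : Gplus A) : ps A := ps_of_seqP f.

Lemma gp_series0 (f : Gplus A) : gp_series f 0%N = 0. Proof. by []. Qed.
Lemma gp_series1 (f : Gplus A) : gp_series f 1%N = 1. Proof. exact: (eqP (gp_seq1 f)). Qed.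
Lemma gp_seriesS (f : Gplus A) n : gp_series f n.+1 = gp_seq f n. Proof. by []. Qed.
Lemma gp_series_inj : injective gp_series.
Proof.
by move=> f g e; apply: val_inj; apply/funext=> n; rewrite /= -gp_seriesS e.
Qed.

Definition gp_of f (f1 : f 1%N = 1) : Gplus A :=
  @MkGplus A (fun n => f n.+1) (introT eqP f1).
Lemma gp_ofE f (f1 : f 1%N = 1) : f 0%N = 0 -> gp_series (gp_of f1) = f.
Proof. by move=> f0; apply/funext=> -[|n]. Qed.

Lemma compinv_spec (f : Gplus A) : psComp (gp_series f) (gp_series (gp_compinv f)) = X /\
  psComp (gp_series (gp_compinv f)) (gp_series f) = X.
Proof.
rewrite /gp_compinv; match goal with |- context [the ?t ?P] => apply: (@the_spec _ t P) end.
have [g [g0 g1 fg gf]] := two_sided_inverse (gp_series0 f) (gp_series1 f).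
exists (gp_of g1); rewrite -/(gp_series f) -/(gp_series (gp_of g1)) gp_ofE //.
Qed.

Lemma compinv_eq (f g : Gplus A) : psComp (gp_series f) (gp_series g) = X -> gp_compinv f = g.
Proof.
move=> fg; apply: gp_series_inj; case: (compinv_spec f) => _ gf.
exact: (inverse_uniq (gp_series0 f) (gp_series0 _) (gp_series0 _) gf fg).
Qed.

Lemma compinvK : involutive (@gp_compinv A).
Proof. by move=> f; apply: compinv_eq; case: (compinv_spec f). Qed.

Lemma FtransE (f : Gplus A) : X * (lam_coef (Ftrans f) : ps A) = gp_series (gp_compinv f).
Proof. by apply/funext=> -[|n]; rewrite psXM. Qed.

Lemma StransE (f : Gplus A) : lam_coef (Strans f) = (1 + X) * (lam_coef (Ftrans f) : ps A).
Proof. by []. Qed.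

Lemma Ftrans_inj : injective (@Ftrans A).
Proof.
move=> f g e; rewrite -(compinvK f) -(compinvK g); congr gp_compinv.
by apply: gp_series_inj; rewrite -!FtransE e.
Qed.

Lemma Ftrans_bij : bijective (@Ftrans A).
Proof.
apply: inj_surj_bij; first exact: Ftrans_inj.
move=> L; have g1 : (X * (lam_coef L : ps A)) 1%N = 1 by rewrite psXM lam0.
exists (gp_compinv (gp_of g1)); apply: val_inj; apply: psX_inj.
by rewrite FtransE compinvK gp_ofE ?psXM.
Qed.

Lemma oneX0 : (1 + X) 0%N = 1. Proof. by rewrite psD addr0. Qed.

Lemma ps_cancel (f u v : ps A) : f 0%N = 1 -> f * u = f * v -> u = v.
Proof.
move=> f0 e; rewrite -[u]mul1r -[v]mul1r -(ps_mulV f0).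
by rewrite ![f * psV f]mulrC -!mulrA e.
Qed.

Lemma Strans_bij : bijective (@Strans A).
Proof.
apply: inj_surj_bij => [f g e|L].
  apply: Ftrans_inj; apply: val_inj; apply: (ps_cancel oneX0).
  by rewrite -[LHS](StransE f) -[RHS](StransE g) e.
have h0 : (psV (1 + X) * (lam_coef L : ps A)) 0%N == 1 by rewrite psM0 ps_inv0 lam0 mulr1.
have [f e] := bij_surj Ftrans_bij (MkLambda h0).
exists f; apply: val_inj.
by rewrite -[LHS]/(lam_coef (Strans f)) StransE e /= mulrA ps_mulV ?mul1r // oneX0.
Qed.

End CompInverse.

(** * The R-, S- and F-transforms *)

Section Cumulants.
Variable A : comPzRingType.
Implicit Types (C M : ps A) (c m : seqP A).
Local Notation X := (psX A).

Lemma cons1_inj : injective (@cons1 A).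
Proof. by move=> c d e; apply/funext=> n; exact: (congr1 (@^~ n.+1) e). Qed.

Lemma cons1_tl C : C 0%N = 1 -> cons1 (ps_tl C) = C.
Proof. by move=> C0; apply/funext=> -[|n]. Qed.

(** With weights [1] on the complement, enlarging its last block changes nothing, so
    [p = z M(z)] and the general system becomes [M(z) = C(z M(z))]. *)
Lemma moments_of_cumulants_fix c :
  psComp (cons1 c) (X * (cons1 (moments_of_cumulants c) : ps A)) = cons1 (moments_of_cumulants c).
Proof.
have -> : cons1 (moments_of_cumulants c) = ncsum (cons1 c) (fun=> 1) 0 0.
  by apply/funext=> -[|n]; rewrite ?ncsum0 ?mulr1 //= moments_ncsum.
have [p [q [[p0 q0 hp hq pq] [ep e1]]]] := @ncsum_system A (cons1 c) (fun=> 1) erefl erefl.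
have e2 : ncsum (cons1 c) (fun=> 1) 0 1 = ncsum (cons1 c) (fun=> 1) 0 0.
  by rewrite e1; exact: (esym hq).
by rewrite -[in LHS]e2 -ep -hp.
Qed.

(** The equation [M(z) = C(z M(z))] says that [z M(z)] is inverse to [z / C(z)]. *)
Lemma fix_inverse C M : C 0%N = 1 -> M 0%N = 1 -> psComp C (X * M) = M ->
  psComp (X * psV C) (X * M) = X.
Proof.
move=> C0 M0 fx; have u0 : (X * M) 0%N = 0 by rewrite psXM.
have e : psComp (psV C) (X * M) * M = 1.
  by rewrite -{2}fx -ps_compM // mulrC ps_mulV // ps_comp1.
by rewrite ps_compX // -mulrA [M * _]mulrC e mulr1.
Qed.

Lemma inverse_fix C u : C 0%N = 1 -> u 0%N = 0 -> psComp (X * psV C) u = X ->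
  u = X * psComp C u.
Proof.
move=> C0 u0; rewrite ps_compX // => e; rewrite -e -mulrA -ps_compM // mulrC.
by rewrite [psV C * C]mulrC ps_mulV // ps_comp1 mul1r.
Qed.

Lemma fix_uniq C M M' : C 0%N = 1 -> M 0%N = 1 -> M' 0%N = 1 ->
  psComp C (X * M) = M -> psComp C (X * M') = M' -> M = M'.
Proof.
move=> C0 M0 M0' fx fx'.
have v0 : (X * psV C) 0%N = 0 by rewrite psXM.
have v1 : (X * psV C) 1%N = 1 by rewrite psXM ps_inv0.
have [w [w0 _ vw wv]] := two_sided_inverse v0 v1.
apply: psX_inj; transitivity w.
  by apply/esym; apply: (inverse_uniq v0 w0 _ wv); rewrite ?psXM // fix_inverse.
by apply: (inverse_uniq v0 w0 _ wv); rewrite ?psXM // fix_inverse.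
Qed.

(** Given [M], the series [C] is [M] composed with the inverse of [z M(z)]. *)
Lemma moments_of_cumulants_bij : bijective (@moments_of_cumulants A).
Proof.
(* [w] is the inverse of [z M(z)]. *)
have inv m : exists w : ps A, [/\ w 0%N = 0, psComp (X * (cons1 m : ps A)) w = X &
    psComp w (X * (cons1 m : ps A)) = X].
  have u0 : (X * (cons1 m : ps A)) 0%N = 0 by rewrite psXM.
  have u1 : (X * (cons1 m : ps A)) 1%N = 1 by rewrite psXM.
  by have [w [w0 _ ? ?]] := two_sided_inverse u0 u1; exists w.
apply: inj_surj_bij => [c d e|m].
  have [w [w0 uw wu]] := inv (moments_of_cumulants c).
  have u0 : (X * (cons1 (moments_of_cumulants c) : ps A)) 0%N = 0 by rewrite psXM.
  apply: cons1_inj; rewrite -[LHS]ps_comp_gX -[RHS]ps_comp_gX -uw -!ps_compA //.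
  by rewrite moments_of_cumulants_fix e moments_of_cumulants_fix.
have [w [w0 uw wu]] := inv m.
have u0 : (X * (cons1 m : ps A)) 0%N = 0 by rewrite psXM.
pose C := psComp (cons1 m) w.
have C0 : C 0%N = 1 by rewrite /C ps_comp0.
exists (ps_tl C); apply: cons1_inj.
apply: (@fix_uniq C) => //.
  by have := moments_of_cumulants_fix (ps_tl C); rewrite cons1_tl.
by rewrite /C ps_compA // wu ps_comp_gX.
Qed.

Lemma RtransK c : Rtrans (moments_of_cumulants c) = c.
Proof. exact: (inv_map_eq _ moments_of_cumulants_bij). Qed.
Lemma moments_Rtrans m : moments_of_cumulants (Rtrans m) = m.
Proof. exact: (inv_mapK _ moments_of_cumulants_bij). Qed.

Lemma Rtrans_bij : bijective (@Rtrans A).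
Proof. by exists (@moments_of_cumulants A) => [m|c]; rewrite ?moments_Rtrans ?RtransK. Qed.

Lemma moment_series_cons1 (T : fock_ncps A) : moment_series T = cons1 (moments T).
Proof. by apply/funext=> -[|n]. Qed.

Lemma fock_moments (T : fock_ncps A) C : C 0%N = 1 -> psComp (moment_series T) (X * psV C) = C ->
  moments T = moments_of_cumulants (ps_tl C).
Proof.
move=> C0 e.
have v0 : (X * psV C) 0%N = 0 by rewrite psXM.
have v1 : (X * psV C) 1%N = 1 by rewrite psXM ps_inv0.
have [u [u0 _ vu uv]] := two_sided_inverse v0 v1.
have eM : moment_series T = psComp C u by rewrite -e ps_compA // vu ps_comp_gX.
have eu := inverse_fix C0 u0 vu; rewrite -eM in eu.
apply: cons1_inj; rewrite -moment_series_cons1.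
apply: (@fix_uniq C) => //.
  by rewrite -eu.
by have := moments_of_cumulants_fix (ps_tl C); rewrite cons1_tl.
Qed.

Lemma tl_oneX (f : ps A) : ps_tl (1 + X * f) = f.
Proof. by apply/funext=> n; rewrite /ps_tl psD psXM ps1 add0r. Qed.
Lemma oneXf0 (f : ps A) : (1 + X * f) 0%N = 1.
Proof. by rewrite psD psXM addr0. Qed.

Lemma moments_add_model i (f : ps A) :
  moments (add_model i f : fock_ncps A) = moments_of_cumulants f.
Proof.
by rewrite (fock_moments (oneXf0 f)) ?tl_oneX // moment_series_add_model.
Qed.

Lemma moments_add_model2 (f g : ps A) :
  moments (add_model true f + add_model false g : fock_ncps A) = moments_of_cumulants (f + g).
Proof.
by rewrite (fock_moments (oneXf0 (f + g))) ?tl_oneX // moment_series_add_model2.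
Qed.

Lemma add_model_local i f : leg_local i (add_model i f : endo A).
Proof. by apply: local_add; [exact: local_annih | exact: local_creat]. Qed.
Lemma mul_model_local i f : leg_local i (mul_model i f : endo A).
Proof.
apply: local_mul; first exact: local_creat.
by apply: local_add; [exact: local_1 | exact: local_annih].
Qed.

Lemma add_models_free f g : Defs.free (add_model true f : fock_ncps A) (add_model false g).
Proof. by apply: local_free; apply: add_model_local. Qed.
Lemma mul_models_free f g : Defs.free (mul_model true f : fock_ncps A) (mul_model false g).
Proof. by apply: local_free; apply: mul_model_local. Qed.

End Cumulants.

Lemma moments_of_cumulants_nat (A B : comPzRingType) (phi : {rmorphism A -> B}) (c : seqP A) :
  moments_of_cumulants (fun n => phi (c n)) = (fun n => phi (moments_of_cumulants c n)).
Proof.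
apply/funext=> n; rewrite /moments_of_cumulants /Defs.mkseqP rmorph_sum.
by apply: eq_bigr => P _; rewrite rmorph_prod.
Qed.

Lemma Rtrans_nat (A B : comPzRingType) (phi : {rmorphism A -> B}) (c : seqP A) :
  Rtrans (fun n => phi (c n)) = (fun n => phi (Rtrans c n)).
Proof.
apply: (bij_inj (moments_of_cumulants_bij B)).
by rewrite moments_of_cumulants_nat !moments_Rtrans.
Qed.

(** Existence over every ring: any two free variables have the joint moments of
    the models with the same cumulants, and the cumulants of the models add up. *)
Lemma boxplus_spec : natural_op (F := seq_functor) boxplus /\
  forall (A : comPzRingType) (M : ncps A) (x y : M), Defs.free x y ->
    moments (x + y) = boxplus (moments x) (moments y).
Proof.
rewrite /boxplus; match goal with |- context [the ?t ?P] => apply: (@the_spec _ t P) end.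
exists (fun A a b => moments_of_cumulants (ptw_add (Rtrans a) (Rtrans b))); split.
  move=> A B phi a b /=; rewrite !Rtrans_nat -moments_of_cumulants_nat.
  by congr moments_of_cumulants; apply/funext=> n; rewrite /ptw_add rmorphD.
move=> A M x y fxy; rewrite -[RHS]moments_add_model2.
by apply: free_moments_add => //; rewrite ?moments_add_model ?moments_Rtrans //;
  apply: add_models_free.
Qed.

(** Uniqueness: the models realise arbitrary moment sequences. *)
Lemma Rtrans_boxplus (A : comPzRingType) (a b : seqP A) :
  Rtrans (boxplus a b) = ptw_add (Rtrans a) (Rtrans b).
Proof.
have [_ /(_ A _ _ _ (@add_models_free A (Rtrans a) (Rtrans b)))] := boxplus_spec.
by rewrite !moments_add_model moments_add_model2 !moments_Rtrans => <-; rewrite RtransK.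
Qed.

Lemma Rtrans_boxdot (A : comPzRingType) (a b : seqP A) :
  Rtrans (boxdot a b) = ptw_mul (Rtrans a) (Rtrans b).
Proof. exact: (inv_mapK _ (Rtrans_bij A)). Qed.

Section STransform.
Variable A : comPzRingType.
Local Notation X := (psX A).

(** The functional equation says that [z / ((1 + z) f)] is inverse to the moment
    series without its constant term. *)
Lemma mul_model_gp (T : fock_ncps A) (f : ps A) : f 0%N = 1 ->
  psComp (moment_series T) (X * psV ((1 + X) * f)) = 1 + X ->
  exists g : Gplus A, moments T = g /\ lam_coef (Strans g) = psV f.
Proof.
move=> f0 e; set chi := X * _ in e.
have F0 : ((1 + X) * f) 0%N = 1 by rewrite psM0 oneX0 f0 mulr1.
have chi0 : chi 0%N = 0 by rewrite /chi psXM.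
have psiE : moment_series T = 1 + (ps_of_seqP (moments T) : ps A).
  by apply/funext=> -[|n]; rewrite psD ?addr0 ?add0r //= /vstate /= ?efun1.
have e2 : psComp (ps_of_seqP (moments T)) chi = X.
  by apply: (addrI 1); rewrite -e psiE ps_compDl ps_comp1.
have m1 : (ps_of_seqP (moments T) : ps A) 1%N = 1.
  have := congr1 (@^~ 1%N) e2; rewrite ps_comp_head // psD psCE mul0rn add0r.
  by rewrite /chi -mulrA psXM psM0 ps_inv0 mul1r ps_comp0.
have m1' : ent (moments T) 1 == 1 by apply/eqP.
pose g := MkGplus m1'; exists g; split=> //.
have chi1 : chi 1%N = 1 by rewrite /chi psXM ps_inv0.
have ce : gp_compinv g = gp_of chi1 by apply: compinv_eq; rewrite gp_ofE.
have : X * (lam_coef (Ftrans g) : ps A) = X * psV ((1 + X) * f) by rewrite FtransE ce gp_ofE.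
move/psX_inj => eF; rewrite StransE eF psVM ?oneX0 // mulrA ps_mulV ?oneX0 //.
by rewrite mul1r.
Qed.

Lemma psVK (f : ps A) : f 0%N = 1 -> psV (psV f) = f.
Proof. by move=> f0; apply: ps_inv_uniq; rewrite ?ps_inv0 // mulrC ps_mulV. Qed.

(** The model whose moments are the coefficients of [g]. *)
Definition smodel (i : bool) (g : Gplus A) : fock_ncps A :=
  mul_model i (psV (lam_coef (Strans g))).

Lemma moments_smodel i g : moments (smodel i g) = g.
Proof.
have f0 : (psV (lam_coef (Strans g))) 0%N = 1 by rewrite ps_inv0.
have [h [-> e]] := mul_model_gp f0 (moment_series_mul_model i f0).
congr gp_seq; apply: (bij_inj (Strans_bij A)); apply: val_inj.
by rewrite -[LHS]/(lam_coef (Strans h)) e psVK ?lam0.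
Qed.

Lemma moments_smodel2 f g : exists h : Gplus A,
  moments (smodel true f * smodel false g) = h /\ Strans h = lam_add (Strans f) (Strans g).
Proof.
have f0 : (psV (lam_coef (Strans f))) 0%N = 1 by rewrite ps_inv0.
have g0 : (psV (lam_coef (Strans g))) 0%N = 1 by rewrite ps_inv0.
have fg0 : (psV (lam_coef (Strans f)) * psV (lam_coef (Strans g))) 0%N = 1.
  by rewrite psM0 f0 g0 mulr1.
have [h [e1 e2]] := mul_model_gp fg0 (moment_series_mul_model2 f0 g0).
exists h; split; first exact: e1.
apply: val_inj.
by rewrite -[LHS]/(lam_coef (Strans h)) e2 psVM // !psVK ?lam0.
Qed.

Lemma smodels_free f g : Defs.free (smodel true f) (smodel false g).
Proof. exact: mul_models_free. Qed.

End STransform.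

Lemma compinv_nat (A B : comPzRingType) (phi : {rmorphism A -> B}) (f : Gplus A) :
  gp_compinv (Gplus_map phi f) = Gplus_map phi (gp_compinv f).
Proof.
apply: compinv_eq; have gm (g : Gplus A) : gp_series (Gplus_map phi g) = pmap phi (gp_series g).
  by apply/funext=> -[|n]; rewrite /pmap /= ?rmorph0.
by rewrite !gm -pmap_comp; case: (compinv_spec f) => -> _; rewrite pmap_monom rmorph1.
Qed.

Lemma Ftrans_nat (A B : comPzRingType) (phi : {rmorphism A -> B}) (f : Gplus A) :
  Ftrans (Gplus_map phi f) = Lambda_map phi (Ftrans f).
Proof. by apply: lam_eq => n; rewrite /= compinv_nat. Qed.

Lemma Strans_nat (A B : comPzRingType) (phi : {rmorphism A -> B}) (f : Gplus A) :
  Strans (Gplus_map phi f) = Lambda_map phi (Strans f).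
Proof.
apply: val_inj; rewrite -[LHS]/(lam_coef (Strans (Gplus_map phi f))) StransE Ftrans_nat.
rewrite -[RHS]/(pmap phi (lam_coef (Strans f))) StransE pmapM pmapD pmap1 pmap_monom.
by rewrite rmorph1.
Qed.

Lemma boxtimes_spec : natural_op (F := Gplus_functor) boxtimes /\
  forall (A : comPzRingType) (M : ncps A) (x y : M) (f g : Gplus A),
    Defs.free x y -> moments x = f -> moments y = g ->
    moments (x * y) = boxtimes f g.
Proof.
rewrite /boxtimes; match goal with |- context [the ?t ?P] => apply: (@the_spec _ t P) end.
pose op (A : comPzRingType) (f g : Gplus A) : Gplus A :=
  inv_map (gp_id A) (@Strans A) (lam_add (Strans f) (Strans g)).
have opE A f g : Strans (op A f g) = lam_add (Strans f) (Strans g).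
  exact: (inv_mapK _ (Strans_bij A)).
exists op; split.
  move=> A B phi f g; apply: (bij_inj (Strans_bij B)).
  by rewrite opE -[fmap _ _]/(Gplus_map phi _) !Strans_nat opE lam_add_nat.
move=> A M x y f g fxy mx my; have [h [e1 e2]] := moments_smodel2 f g.
have -> : op A f g = h by apply: (bij_inj (Strans_bij A)); rewrite opE e2.
rewrite -e1; apply: free_moments_mul => //; rewrite ?moments_smodel //.
exact: smodels_free.
Qed.

Lemma Strans_boxtimes (A : comPzRingType) (f g : Gplus A) :
  Strans (boxtimes f g) = lam_add (Strans f) (Strans g).
Proof.
have [_ h] := boxtimes_spec.
have := h A _ _ _ f g (@smodels_free A f g) (moments_smodel true f) (moments_smodel false g).
have [k [-> <-]] := moments_smodel2 f g => e.
by congr Strans; apply: val_inj.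
Qed.

Lemma Strans_circledast (A : comPzRingType) (f g : Gplus A) :
  Strans (circledast f g) = lam_mul (Strans f) (Strans g).
Proof. exact: (inv_mapK _ (Strans_bij A)). Qed.

Lemma Ftrans_circledastNS (A : comPzRingType) (f g : Gplus A) :
  Ftrans (circledastNS f g) = lam_mul (Ftrans f) (Ftrans g).
Proof. exact: (inv_mapK _ (Ftrans_bij A)). Qed.

(** Substituting the inverse of [h] in [f o p = g o q = h] and [p q = z h]. *)
Lemma Ftrans_boxtimesNS (A : comPzRingType) (f g : Gplus A) :
  Ftrans (boxtimesNS f g) = lam_add (Ftrans f) (Ftrans g).
Proof.
have cE (u : Gplus A) : cons1 (gp_seq u) = 1 + gp_series u :> ps A.
  by apply/funext=> -[|n]; rewrite psD ?addr0 ?add0r.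
have [p [q [[p0 q0 hp hq pq] _]]] := @ncsum_system A (cons1 f) (cons1 g) erefl erefl.
have hE : ncsum (cons1 f) (cons1 g) 0 0 = 1 + gp_series (boxtimesNS f g) :> ps A.
  rewrite -cE; apply/funext=> -[|n]; first by rewrite ncsum0 mulr1.
  by rewrite /= boxtimesNS_ncsum.
rewrite hE in hp hq pq.
set h := boxtimesNS f g in hp hq pq *.
have {}hp : gp_series h = psComp (gp_series f) p.
  by apply: (addrI 1); rewrite hp cE ps_compDl ps_comp1.
have {}hq : gp_series h = psComp (gp_series g) q.
  by apply: (addrI 1); rewrite hq cE ps_compDl ps_comp1.
have [_ invf] := compinv_spec f; have [_ invg] := compinv_spec g.
have [hinv _] := compinv_spec h.
have ep : psComp p (gp_series (gp_compinv h)) = gp_series (gp_compinv f).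
  have -> : p = psComp (gp_series (gp_compinv f)) (gp_series h).
    by rewrite hp -ps_compA // invf ps_compXg.
  by rewrite ps_compA // hinv ps_comp_gX.
have eq : psComp q (gp_series (gp_compinv h)) = gp_series (gp_compinv g).
  have -> : q = psComp (gp_series (gp_compinv g)) (gp_series h).
    by rewrite hq -ps_compA // invg ps_compXg.
  by rewrite ps_compA // hinv ps_comp_gX.
have := congr1 (fun u => psComp u (gp_series (gp_compinv h))) pq.
rewrite /= addrC addKr !ps_compM // ep eq hinv ps_compXg // -!FtransE => e.
apply: val_inj; apply: psX_inj; apply: psX_inj.
rewrite -[LHS]/(psX A * (psX A * (lam_coef (Ftrans h) : ps A))).
rewrite -[RHS]/(psX A * (psX A * ((lam_coef (Ftrans f) : ps A) * (lam_coef (Ftrans g) : ps A)))).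
rewrite [LHS]mulrC -e; ring.
Qed.

(** * Transport of ring structures and the isomorphisms *)

Section Transfer.
Variables (T U : Type) (addT mulT : T -> T -> T) (addU mulU : U -> U -> U) (f : T -> U).
Hypothesis fb : bijective f.
Hypothesis fD : forall x y, f (addT x y) = addU (f x) (f y).
Hypothesis fM : forall x y, f (mulT x y) = mulU (f x) (f y).

Lemma bij_unity e : is_unity mulT e <-> is_unity mulU (f e).
Proof.
split=> -[le re]; split=> x.
- by have [y <-] := bij_surj fb x; rewrite -fM le.
- by have [y <-] := bij_surj fb x; rewrite -fM re.
- by apply: (bij_inj fb); rewrite fM le.
- by apply: (bij_inj fb); rewrite fM re.
Qed.

Lemma bij_ringhom : is_ringhom addT mulT addU mulU f.
Proof. by split=> // e /bij_unity. Qed.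

Lemma bij_comring : is_comring addU mulU -> is_comring addT mulT.
Proof.
case=> z [o [n [[aA aC a0 aN] [mA mC mo mD]]]].
have [z' ez] := bij_surj fb z; have [o' eo] := bij_surj fb o.
have fi := bij_inj fb; case: (fb) => g _ gK.
exists z', o', (fun x => g (n (f x))); split; split.
- by move=> x y t; apply: fi; rewrite !fD aA.
- by move=> x y; apply: fi; rewrite !fD aC.
- by move=> x; apply: fi; rewrite fD ez a0.
- by move=> x; apply: fi; rewrite fD gK aN ez.
- by move=> x y t; apply: fi; rewrite !fM mA.
- by move=> x y; apply: fi; rewrite !fM mC.
- by apply/bij_unity; rewrite eo.
- by move=> x y t; apply: fi; rewrite !(fM, fD) mD.
Qed.

End Transfer.

Section Schemes.
Variable k : fieldType.
Implicit Types X Y Z : scheme2 k.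

Lemma natural_ring_iso_intro X Y (h : forall A : kalg k, X A -> Y A) :
  (forall A : kalg k, bijective (h A)) ->
  (forall (A : kalg k) (x y : X A), h A (sadd x y) = sadd (h A x) (h A y)) ->
  (forall (A : kalg k) (x y : X A), h A (smul x y) = smul (h A x) (h A y)) ->
  (forall (A B : kalg k) (phi : {rmorphism A -> B}) (x : X A),
     h B (fmap phi x) = fmap phi (h A x)) ->
  natural_ring_iso h.
Proof.
move=> hb hD hM hn; split=> [A|A B phi _ x]; last exact: hn.
by split=> //; apply: bij_ringhom.
Qed.

Lemma natural_ring_iso_comp X Y Z (f : forall A : kalg k, X A -> Y A)
    (g : forall A : kalg k, Y A -> Z A) :
  natural_ring_iso f -> natural_ring_iso g -> natural_ring_iso (fun A x => g A (f A x)).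
Proof.
move=> [f1 fn] [g1 gn]; split=> [A|A B phi kphi x]; last by rewrite fn // gn.
have [fb [fD fM f_1]] := f1 A; have [gb [gD gM g_1]] := g1 A.
split; first exact: (bij_comp gb fb).
by split=> [x y|x y|e /f_1 /g_1 //]; rewrite ?fD ?gD ?fM ?gM.
Qed.

Lemma natural_ring_iso_scheme X Y (h : forall A : kalg k, X A -> Y A) :
  natural_ring_iso h -> is_ring_scheme Y -> is_ring_scheme X.
Proof.
move=> [h1 hn] [Yr Yh]; split=> [A|A B phi kphi].
  by have [hb [hD hM _]] := h1 A; apply: (bij_comring hb hD hM).
have [hb [hD hM _]] := h1 A; have [hb' [hD' hM' _]] := h1 B.
have [pD pM p1] := Yh A B phi kphi.
split=> [x y|x y|e e1].
- by apply: (bij_inj hb'); rewrite hn // hD pD hD' !hn.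
- by apply: (bij_inj hb'); rewrite hn // hM pM hM' !hn.
apply/(bij_unity hb' hM'); rewrite hn //; apply: p1.
exact/(bij_unity hb hM).
Qed.

Lemma natural_ring_iso_span X Y Z (f : forall A : kalg k, X A -> Z A)
    (g : forall A : kalg k, Y A -> Z A) :
  natural_ring_iso f -> natural_ring_iso g -> isomorphic_schemes X Y.
Proof.
move=> [f1 fn] [g1 gn].
have inv (A : kalg k) (z : Z A) : {y : Y A | g A y = z}.
  by apply: cid; apply: bij_surj; case: (g1 A).
pose h (A : kalg k) (x : X A) : Y A := sval (inv A (f A x)).
have hE A x : g A (h A x) = f A x by apply: (svalP (inv A (f A x))).
exists h; split=> [A|A B phi kphi x]; last first.
  have [gb _] := g1 B; apply: (bij_inj gb).
  by rewrite gn // !hE fn.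
have [fb [fD fM _]] := f1 A; have [gb [gD gM _]] := g1 A.
have hb : bijective (h A).
  apply: inj_surj_bij => [x y e|y].
    by apply: (bij_inj fb); rewrite -!hE e.
  have [x e] := bij_surj fb (g A y); exists x.
  by apply: (bij_inj gb); rewrite hE.
split=> //; apply: bij_ringhom => // x y; apply: (bij_inj gb).
  by rewrite gD !hE fD.
by rewrite gM !hE fM.
Qed.

Lemma pointwise_ring_scheme : is_ring_scheme (pointwise_scheme k).
Proof.
split=> [A|A B phi _].
  exists (fun=> 0), (fun=> 1), (fun a n => - a n).
  split; split.
  - by move=> a b c; apply/funext=> n; apply: addrA.
  - by move=> a b; apply/funext=> n; apply: addrC.
  - by move=> a; apply/funext=> n; apply: add0r.
  - by move=> a; apply/funext=> n; apply: addNr.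
  - by move=> a b c; apply/funext=> n; apply: mulrA.
  - by move=> a b; apply/funext=> n; apply: mulrC.
  - by split=> a; apply/funext=> n; [apply: mul1r | apply: mulr1].
  by move=> a b c; apply/funext=> n; apply: mulrDl.
split=> [x y|x y|e [e1 _]]; try apply/funext=> n.
- exact: rmorphD.
- exact: rmorphM.
have en n : e n = 1.
  by have := congr1 (@^~ n) (e1 (fun=> 1)); rewrite /= /ptw_mul mulr1.
by split=> a; apply/funext=> n; rewrite /= /ptw_mul en rmorph1 ?mul1r ?mulr1.
Qed.

Lemma pointwise_id : natural_ring_iso (X := pointwise_scheme k) (Y :=
  pointwise_scheme k) (fun A x => x).
Proof. by apply: natural_ring_iso_intro => // A; exists id. Qed.

Hypothesis char0 : [pchar k] =i pred0.

Lemma kalg_Qring (A : kalg k) : Qring A.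
Proof.
exists (fun n => kalg_scal A (n.+1%:R^-1)) => n.
rewrite -(rmorph_nat (kalg_scal A)) -rmorphM divff ?rmorph1 //.
by move/pcharf0P: char0 => ->.
Qed.

Lemma ghost_iso : natural_ring_iso (X := witt_scheme k) (Y :=
  pointwise_scheme k) (fun A => @ghost A).
Proof.
apply: natural_ring_iso_intro => [A|A x y|A x y|A B phi x].
- exact: (ghost_bij (kalg_Qring A)).
- by case: witt_add_spec => _; apply.
- by case: witt_mul_spec => _; apply.
by rewrite -!zdlog_artin_hasse artin_hasse_nat zdlog_nat.
Qed.

Lemma MR_iso : natural_ring_iso (X := necklace_scheme k) (Y :=
  pointwise_scheme k) (fun A => @MR A).
Proof.
apply: natural_ring_iso_intro => [A|A x y|A x y|A B phi x].
- exact: (MR_bij (kalg_Qring A)).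
- apply/funext=> n; rewrite /= /MR /ptw_add /Defs.mkseqP -big_split.
  by apply: eq_bigr => d _; rewrite /ent mulrnDl.
- exact: MR_mul.
apply/funext=> n; rewrite /= /MR /Defs.mkseqP rmorph_sum.
by apply: eq_bigr => d _; rewrite rmorphMn.
Qed.

Lemma zdlog_iso : natural_ring_iso (X := Lambda_scheme k) (Y :=
  pointwise_scheme k) (fun A => @zdlog A).
Proof.
apply: natural_ring_iso_intro => [A|A x y|A x y|A B phi x].
- exact: (zdlog_bij (kalg_Qring A)).
- exact: zdlogD.
- exact: (zdlogM _ _ (kalg_Qring A)).
exact: zdlog_nat.
Qed.

Lemma GS_iso (lam : k) : lam != 0 ->
  natural_ring_iso (X := hurwitz_scheme lam) (Y := pointwise_scheme k)
    (fun A => @GS A (kalg_scal A lam)).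
Proof.
move=> lam0; split=> [A|A B phi kphi x].
  have gb : bijective (@GS A (kalg_scal A lam)).
    apply: (@GS_bij _ _ (kalg_scal A lam^-1)).
    by rewrite -rmorphM divff ?rmorph1.
  split=> //; apply: bij_ringhom => // x y; last exact: GS_hurwitz.
  apply/funext=> n; rewrite /GS /= /ptw_add -big_split.
  by apply: eq_bigr => j _; rewrite mulrDr mulrnDl.
apply/funext=> n; rewrite /= /GS rmorph_sum; apply: eq_bigr => j _.
by rewrite rmorphMn rmorphM rmorphXn kphi.
Qed.

Lemma Strans_iso : natural_ring_iso (X := boxtimes_scheme k) (Y :=
  Lambda_scheme k) (fun A => @Strans A).
Proof.
apply: natural_ring_iso_intro => [A|A x y|A x y|A B phi x].
- exact: Strans_bij.
- exact: Strans_boxtimes.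
- exact: Strans_circledast.
exact: Strans_nat.
Qed.

Lemma Ftrans_iso : natural_ring_iso (X := boxtimesNS_scheme k) (Y :=
  Lambda_scheme k) (fun A => @Ftrans A).
Proof.
apply: natural_ring_iso_intro => [A|A x y|A x y|A B phi x].
- exact: Ftrans_bij.
- exact: Ftrans_boxtimesNS.
- exact: Ftrans_circledastNS.
exact: Ftrans_nat.
Qed.

Lemma Rtrans_iso : natural_ring_iso (X := boxplus_scheme k) (Y :=
  pointwise_scheme k) (fun A => @Rtrans A).
Proof.
apply: natural_ring_iso_intro => [A|A x y|A x y|A B phi x].
- exact: Rtrans_bij.
- exact: Rtrans_boxplus.
- exact: Rtrans_boxdot.
exact: Rtrans_nat.
Qed.

Lemma AH_iso : natural_ring_iso (X := Lambda_scheme k) (Y := witt_scheme k) (fun A => @AH A).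
Proof.
apply: natural_ring_iso_intro => [A|A x y|A x y|A B phi x].
- by exists (@artin_hasse A) => [f|x]; [exact: AHK | exact: artin_hasseK].
- apply: (bij_inj (ghost_bij (kalg_Qring A))).
  by case: witt_add_spec => _ /= ->; rewrite !ghost_AH zdlogD.
- apply: (bij_inj (ghost_bij (kalg_Qring A))).
  case: witt_mul_spec => _ /= ->; rewrite !ghost_AH zdlogM //.
  exact: kalg_Qring.
exact: AH_nat.
Qed.

Lemma scheme_iso_pointwise (lam : k) X : lam != 0 -> List.In X (all_schemes lam) ->
  exists h, natural_ring_iso (X := X) (Y := pointwise_scheme k) h.
Proof.
move=> lam0 /=.
case=> [<-|[<-|[<-|[<-|[<-|[<-|[<-|[<-|[]]]]]]]]]; eexists.
- exact: ghost_iso.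
- exact: MR_iso.
- exact: zdlog_iso.
- exact: GS_iso.
- exact: pointwise_id.
- exact: (natural_ring_iso_comp Strans_iso zdlog_iso).
- exact: Rtrans_iso.
exact: (natural_ring_iso_comp Ftrans_iso zdlog_iso).
Qed.

End Schemes.

Theorem theorem3p15 (k : fieldType) (char0 : [pchar k] =i pred0)
    (lam : k) (lam_neq0 : lam != 0) :
  [/\ (forall X : scheme2 k, List.In X (all_schemes lam) -> is_ring_scheme X),
      (forall X Y : scheme2 k, List.In X (all_schemes lam) ->
         List.In Y (all_schemes lam) -> isomorphic_schemes X Y),
      (forall A : kalg k,
         is_unity (@smul k (hurwitz_scheme lam) A) (fun n => (n == 0%N)%:R)),
      [/\ @natural_ring_iso k (witt_scheme k) (pointwise_scheme k)
            (fun A => @ghost A),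
          @natural_ring_iso k (necklace_scheme k) (pointwise_scheme k)
            (fun A => @MR A),
          @natural_ring_iso k (Lambda_scheme k) (pointwise_scheme k)
            (fun A => @zdlog A)
        & @natural_ring_iso k (hurwitz_scheme lam) (pointwise_scheme k)
            (fun A => @GS A (kalg_scal A lam))] /\
      [/\ @natural_ring_iso k (boxtimes_scheme k) (pointwise_scheme k)
            (fun A f => zdlog (Strans f)),
          @natural_ring_iso k (boxplus_scheme k) (pointwise_scheme k)
            (fun A => @Rtrans A)
        & @natural_ring_iso k (boxtimesNS_scheme k) (pointwise_scheme k)
            (fun A f => zdlog (Ftrans f))]
    & [/\ @natural_ring_iso k (boxtimes_scheme k) (Lambda_scheme k)
            (fun A => @Strans A),
          @natural_ring_iso k (boxtimesNS_scheme k) (Lambda_scheme k)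
            (fun A => @Ftrans A)
        & @natural_ring_iso k (Lambda_scheme k) (witt_scheme k)
            (fun A => @AH A)]].
Proof.
split.
- move=> X /(scheme_iso_pointwise char0 lam_neq0)[h hX].
  exact: (natural_ring_iso_scheme hX (pointwise_ring_scheme k)).
- move=> X Y /(scheme_iso_pointwise char0 lam_neq0)[f fX].
  move=> /(scheme_iso_pointwise char0 lam_neq0)[g gY].
  exact: (natural_ring_iso_span fX gY).
- move=> A; have [/(_ A)[gb [_ gM _]] _] := GS_iso lam_neq0.
  apply/(bij_unity gb gM).
  by split=> x; apply/funext=> n; rewrite /= /ptw_mul GS_unit ?mul1r ?mulr1.
- split; split.
  + exact: ghost_iso.
  + exact: MR_iso.
  + exact: zdlog_iso.
  + exact: GS_iso.
  + exact: (natural_ring_iso_comp (Strans_iso k) (zdlog_iso char0)).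
  + exact: Rtrans_iso.
  + exact: (natural_ring_iso_comp (Ftrans_iso k) (zdlog_iso char0)).
split.
- exact: Strans_iso.
- exact: Ftrans_iso.
exact: AH_iso.
Qed.
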